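(* Let $k$ be a field, $B$ an associative $k$-algebra with $1$, and $M_1,\dots,M_n$ right $B$-modules. Let $\mathrm{filt}(M_i)$ be the full subcategory of the category of right $B$-modules whose objects admit finite filtrations with all subquotients isomorphic to modules among $M_1,\dots,M_n$. Let $\mathcal A$ be the $A_\infty$-category with objects $1,\dots,n$ and morphism spaces $\mathcal A(i,j)=\mathrm{Ext}^*_B(M_i,M_j)$, with $m_1=0$, $m_2$ the Yoneda composition, and $m_l$, $l\ge3$, the canonical higher compositions (see context). Assume that these higher compositions may be, and have been, chosen so that $\mathcal A$ is strictly unital. Let $\mathrm{filt}\,\mathcal A$ be the full subcategory of $H^0\mathrm{tw}\,\mathcal A$ whose objects are the twisted objects built from filtered direct sums of non-shifted copies of objects of $\mathcal A$ (see context). Then there is an equivalence of categories $$\mathrm{filt}\,\mathcal A\ \xrightarrow{\ \sim\ }\ \mathrm{filt}(M_i).$$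
   Context: Graded means $\mathbf Z$-graded; the Koszul sign rule $(f\otimes g)(x\otimes y)=(-1)^{|g||x|}f(x)\otimes g(y)$ is used. $A_\infty$-category $\mathcal A$ over $k$: a class of objects, graded vector spaces $(A,A')=\mathrm{Hom}_{\mathcal A}(A,A')=\mathcal A(A,A')$, and for $n\ge1$ graded maps $m_n:(A_{n-1},A_n)\otimes\cdots\otimes(A_0,A_1)\to(A_0,A_n)$ of degree $2-n$ such that for all $n\geq 1$, $\sum(-1)^{r+st}m_u(\mathbf 1^{\otimes r}\otimes m_s\otimes\mathbf 1^{\otimes t})=0$ (sum over $n=r+s+t$, $r,t\ge 0$, $s\ge1$, $u=r+1+t$). Dg categories are the case $m_n=0$ for $n\ge3$. $\mathcal A$ is strictly unital (has strict identities) if every object $A$ has a morphism $e_A\in\mathrm{Hom}^0(A,A)$ with $m_2(f,e_A)=f$, $m_2(e_A,g)=g$ whenever these make sense, and $m_n(\dots,e_A,\dots)=0$ for all $n\ne2$. $A_\infty$-functor $F:\mathcal A\to\mathcal B$: a map on objects and graded maps $F_n:(A_{n-1},A_n)\otimes\cdots\otimes(A_0,A_1)\to\mathrm{Hom}_{\mathcal B}(FA_0,FA_n)$ of degree $1-n$, $n\geq 1$, with $\sum(-1)^{r+st}F_u(\mathbf 1^{\otimes r}\otimes m_s\otimes\mathbf 1^{\otimes t})=\sum(-1)^\sigma m_r(F_{i_1}\otimes\cdots\otimes F_{i_r})$ for all $n\ge 1$, the second sum over $1\le r\le n$, $n=i_1+\dots+i_r$, with $\sigma=\sum_{j=1}^{r-1}(r-j)(i_j-1)$.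 Canonical higher compositions: choose injective resolutions $M_i\to I_i$ and let $\mathcal E$ be the dg category with objects $1,\dots,n$ and morphism complexes $\mathrm{Hom}^\bullet_B(I_i,I_j)$ (graded $B$-linear maps, $d(f)=d f-(-1)^{|f|}f d$), so that $H^*\mathcal E(i,j)=\mathrm{Ext}_B^*(M_i,M_j)$. The $m_l$, $l\ge3$, are such that together with $m_1=0$ and the Yoneda composition $m_2$ they make $\mathcal A$ an $A_\infty$-category for which there is an $A_\infty$-functor $F:\mathcal A\to\mathcal E$, the identity on objects, with $F_1$ inducing the identity $\mathrm{Ext}^*_B(M_i,M_j)\to H^*\mathcal E(i,j)$. The category $\mathrm{filt}\,\mathcal A$. Write $s:V\to SV$ for the canonical degree $-1$ map to the suspension $(SV)^p=V^{p+1}$ of a graded space, and define degree $1$ maps $b'_n$ on tensor products of suspended morphism spaces of $\mathcal A$ by $b'_n\circ s^{\otimes n}=s\circ m_n$. Extend $m_n$ and $b'_n$ to matrices of morphisms in the obvious way. Objects: pairs $(V,\delta)$, where $V=(a_1,\dots,a_r)$ is a finite sequence of objects of $\mathcal A$ and $\delta=(\delta_{ij})$ is a matrix with $\delta_{ij}\in\mathrm{Hom}^1_{\mathcal A}(a_j,a_i)$, $\delta_{ij}=0$ for $i\ge j$, and $\sum_{t\ge1}(-1)^{t(t-1)/2}m_t(\delta,\dots,\delta)=0$ (a finite sum because $\delta$ is strictly upper triangular; equivalently $\sum_{t\ge1}b'_t(s\delta,\dots,s\delta)=0$). Graded morphism spaces: $\mathrm{Hom}_{\mathrm{tw}\mathcal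 A}((V,\delta),(V',\delta'))=\bigoplus_{i,j}\mathrm{Hom}_{\mathcal A}(a_i,a'_j)$. Twisted compositions: for objects $(V_0,\delta_0),\dots,(V_n,\delta_n)$ and $y_i\in S\mathrm{Hom}(V_{i-1},V_i)$ put $\alpha_i=s\delta_i$ (of degree $0$) and $$b_n(y_n,\dots,y_1)=\sum_{j_0,\dots,j_n\ge0}b'_{n+j_0+\dots+j_n}(\alpha_n^{\otimes j_n}\otimes y_n\otimes\alpha_{n-1}^{\otimes j_{n-1}}\otimes y_{n-1}\otimes\cdots\otimes y_1\otimes\alpha_0^{\otimes j_0}),$$ and define $m_n^{\mathrm{tw}\mathcal A}$ by $b_n\circ s^{\otimes n}=s\circ m_n^{\mathrm{tw}\mathcal A}$. Then the set of morphisms from $(V,\delta)$ to $(V',\delta')$ in $\mathrm{filt}\,\mathcal A$ is the degree $0$ homology of $\mathrm{Hom}_{\mathrm{tw}\mathcal A}((V,\delta),(V',\delta'))$ for the differential $m_1^{\mathrm{tw}\mathcal A}$, and composition is induced by $m_2^{\mathrm{tw}\mathcal A}$. (The full $A_\infty$-category $\mathrm{tw}\,\mathcal A$ allows in addition formal shifts of the objects $a_i$; $\mathrm{filt}\,\mathcal A$ is the full subcategory of $H^0\mathrm{tw}\,\mathcal A$ on the non-shifted objects just described.) *)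

(* Defs.v *)
From HB Require Import structures.
From mathcomp Require Import all_boot all_order all_algebra.
From mathcomp Require Import generic_quotient ring_quotient.
From mathcomp Require Import boolp.

Set Implicit Arguments.
Unset Strict Implicit.
Unset Printing Implicit Defensive.

Import Order.TTheory GRing.Theory Num.Theory.
Local Open Scope ring_scope.
Local Open Scope quotient_scope.

Section LinearAlgebra.
Variable R : pzRingType.

Section DependentProduct.
Variables (T : Type) (V : T -> lmodType R).

Definition dprod := forall t, V t.
HB.instance Definition _ := gen_eqMixin dprod.
HB.instance Definition _ := gen_choiceMixin dprod.

Definition dprod_add (f g : dprod) : dprod := fun t => f t + g t.
Definition dprod_opp (f : dprod) : dprod := fun t => - f t.
Definition dprod_zero : dprod := fun _ => 0.
Definition dprod_scale (c : R) (f : dprod) : dprod := fun t => c *: f t.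

Fact dprod_addA : associative dprod_add.
Proof. by move=> f g h; apply: functional_extensionality_dep => t; apply: addrA. Qed.
Fact dprod_addC : commutative dprod_add.
Proof. by move=> f g; apply: functional_extensionality_dep => t; apply: addrC. Qed.
Fact dprod_add0 : left_id dprod_zero dprod_add.
Proof. by move=> f; apply: functional_extensionality_dep => t; apply: add0r. Qed.
Fact dprod_addN : left_inverse dprod_zero dprod_opp dprod_add.
Proof. by move=> f; apply: functional_extensionality_dep => t; apply: addNr. Qed.
HB.instance Definition _ :=
  GRing.isZmodule.Build dprod dprod_addA dprod_addC dprod_add0 dprod_addN.

Fact dprod_scaleA a b f :
  dprod_scale a (dprod_scale b f) = dprod_scale (a * b) f.
Proof. by apply: functional_extensionality_dep => t; apply: scalerA. Qed.
Fact dprod_scale1 : left_id 1 dprod_scale.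
Proof. by move=> f; apply: functional_extensionality_dep => t; apply: scale1r. Qed.
Fact dprod_scaleDr : right_distributive dprod_scale +%R.
Proof. by move=> a f g; apply: functional_extensionality_dep => t; apply: scalerDr. Qed.
Fact dprod_scaleDl f : {morph dprod_scale^~ f : a b / a + b}.
Proof. by move=> a b; apply: functional_extensionality_dep => t; apply: scalerDl. Qed.
HB.instance Definition _ := GRing.Zmodule_isLmodule.Build R dprod
  dprod_scaleA dprod_scale1 dprod_scaleDr dprod_scaleDl.

End DependentProduct.

Section Subquotient.
Variables (V : lmodType R) (Z W : submodClosed V).

Definition submod := {x : V | x \in Z}.
HB.instance Definition _ := SubChoice.on submod.
HB.instance Definition _ := [SubChoice_isSubLmodule of submod by <:].

Definition subpred : {pred submod} := [pred z | val z \in W].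
Fact subpred_closed : submod_closed subpred.
Proof.
split=> [|c x y]; rewrite !inE ?linear0 ?rpred0 // => xW yW.
by rewrite linearP rpredD // rpredZ.
Qed.
HB.instance Definition _ := GRing.isSubmodClosed.Build R submod subpred
  subpred_closed.

(* Z / (Z :&: W) *)
Definition subquot := Quotient.quot subpred.
HB.instance Definition _ := GRing.Zmodule.on subquot.

Definition subquot_pi (z : submod) : subquot := \pi z.
Definition subquot_scale (c : R) (x : subquot) : subquot :=
  subquot_pi (c *: repr x).

Lemma subquot_pi_eq (x y : submod) :
  (subquot_pi x = subquot_pi y) <-> (val x - val y \in W).
Proof.
have E : (val (x - y) \in W) = (\pi_subquot x == \pi_subquot y).
  by rewrite -Quotient.idealrBE.
by rewrite -linearB E; split=> [/eqP|/eqP].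
Qed.

Lemma subquot_reprK x : subquot_pi (repr x) = x.
Proof. exact: reprK. Qed.

Lemma subquot_piD : {morph subquot_pi : x y / x + y}.
Proof. by move=> x y; rewrite /subquot_pi !piE. Qed.

Lemma subquot_piZ c x : subquot_pi (c *: x) = subquot_scale c (subquot_pi x).
Proof.
apply/subquot_pi_eq; rewrite -linearB -scalerBr linearZ rpredZ // linearB.
by apply/subquot_pi_eq; rewrite subquot_reprK.
Qed.

Fact subquot_scaleA a b x :
  subquot_scale a (subquot_scale b x) = subquot_scale (a * b) x.
Proof. by rewrite -(subquot_reprK x) -!subquot_piZ scalerA. Qed.
Fact subquot_scale1 : left_id 1 subquot_scale.
Proof. by move=> x; rewrite -(subquot_reprK x) -subquot_piZ scale1r. Qed.
Fact subquot_scaleDr : right_distributive subquot_scale +%R.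
Proof.
move=> c x y; rewrite -(subquot_reprK x) -(subquot_reprK y).
by rewrite -subquot_piD -!subquot_piZ -subquot_piD scalerDr.
Qed.
Fact subquot_scaleDl x : {morph subquot_scale^~ x : a b / a + b}.
Proof.
by move=> a b; rewrite -(subquot_reprK x) -!subquot_piZ -subquot_piD scalerDl.
Qed.
HB.instance Definition _ := GRing.Zmodule_isLmodule.Build R subquot
  subquot_scaleA subquot_scale1 subquot_scaleDr subquot_scaleDl.

End Subquotient.

Section Cohomology.
Variables (U V W : lmodType R) (d0 : {linear U -> V}) (d1 : {linear V -> W}).

Definition cocycle : {pred V} := [pred x | d1 x == 0].
Definition coboundary : {pred V} := [pred x | `[< exists u, d0 u = x >]].

Fact cocycle_closed : submod_closed cocycle.
Proof.
split=> [|c x y]; rewrite !inE ?linear0 // => /eqP x0 /eqP y0.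
by rewrite linearP x0 y0 scaler0 addr0.
Qed.
HB.instance Definition _ := GRing.isSubmodClosed.Build R V cocycle
  cocycle_closed.

Fact coboundary_closed : submod_closed coboundary.
Proof.
split=> [|c x y]; rewrite !inE; first by apply/asboolP; exists 0; rewrite linear0.
move=> /asboolP[u <-] /asboolP[v <-]; apply/asboolP.
by exists (c *: u + v); rewrite linearP.
Qed.
HB.instance Definition _ := GRing.isSubmodClosed.Build R V coboundary
  coboundary_closed.

Definition cohomology := subquot cocycle coboundary.
HB.instance Definition _ := GRing.Lmodule.on cohomology.

Definition cohomology_class (z : submod cocycle) : cohomology :=
  subquot_pi coboundary z.

End Cohomology.
End LinearAlgebra.

(* k-algebras with 1, given by their central structure map.  Unlike algType,
   this allows the zero algebra. *)
Record kAlgebra (k : fieldType) := KAlgebra {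
  alg_ring :> pzRingType;
  alg_map : {rmorphism k -> alg_ring};
  alg_central : forall c b, alg_map c * b = b * alg_map c }.

(* Right B-modules are left modules over the opposite ring B^c: the element
   b *: x stands for x b. *)
Notation rmodType B := (lmodType (alg_ring B)^c).

Lemma linear_eq (R : pzRingType) (X Y : lmodType R) (f g : {linear X -> Y}) :
  f =1 g -> f = g.
Proof.
case: f g => f [[Mf] [Sf]] [g [[Mg] [Sg]]] /= E.
have {}E : f = g by apply: functional_extensionality_dep.
by subst g; congr (GRing.Linear.Pack (GRing.Linear.Class _ _));
  congr (_ _); apply: Prop_irrelevance.
Qed.

Definition sg (k : fieldType) (z : int) : k := (-1) ^+ `|z|%N.

Section HomSpaces.
Variables (k : fieldType) (B : kAlgebra k).

Section ModuleHom.
Variables X Y : rmodType B.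

Definition homB := {linear X -> Y}.
HB.instance Definition _ := gen_eqMixin homB.
HB.instance Definition _ := gen_choiceMixin homB.

Definition homB_add (f g : homB) : homB := f \+ g.
Definition homB_opp (f : homB) : homB := \- f.
Definition homB_zero : homB := \0.

Definition homB_scale_fun (c : k) (f : homB) (x : X) : Y :=
  (alg_map B c : B^c) *: f x.
Fact homB_scale_linear c f : linear (homB_scale_fun c f).
Proof.
move=> b x y; rewrite /homB_scale_fun linearP scalerDr !scalerA.
by congr (_ *: _ + _); apply/esym/(alg_central c (b : B)).
Qed.
HB.instance Definition _ c f :=
  GRing.isLinear.Build _ X Y _ (homB_scale_fun c f) (homB_scale_linear c f).
Definition homB_scale (c : k) (f : homB) : homB := homB_scale_fun c f.

Fact homB_addA : associative homB_add.
Proof. by move=> f g h; apply: linear_eq => x; apply: addrA. Qed.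
Fact homB_addC : commutative homB_add.
Proof. by move=> f g; apply: linear_eq => x; apply: addrC. Qed.
Fact homB_add0 : left_id homB_zero homB_add.
Proof. by move=> f; apply: linear_eq => x; apply: add0r. Qed.
Fact homB_addN : left_inverse homB_zero homB_opp homB_add.
Proof. by move=> f; apply: linear_eq => x; apply: addNr. Qed.
HB.instance Definition _ :=
  GRing.isZmodule.Build homB homB_addA homB_addC homB_add0 homB_addN.

Fact homB_scaleA a b f : homB_scale a (homB_scale b f) = homB_scale (a * b) f.
Proof.
apply: linear_eq => x; rewrite /= /homB_scale_fun /= /homB_scale_fun scalerA.
by rewrite [a * b]mulrC rmorphM.
Qed.
Fact homB_scale1 : left_id 1 homB_scale.
Proof.
by move=> f; apply: linear_eq => x; rewrite /= /homB_scale_fun rmorph1 scale1r.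
Qed.
Fact homB_scaleDr : right_distributive homB_scale +%R.
Proof. by move=> a f g; apply: linear_eq => x; apply: scalerDr. Qed.
Fact homB_scaleDl f : {morph homB_scale^~ f : a b / a + b}.
Proof.
move=> a b; apply: linear_eq => x /=.
by rewrite /homB_scale_fun rmorphD scalerDl.
Qed.
HB.instance Definition _ := GRing.Zmodule_isLmodule.Build k homB
  homB_scaleA homB_scale1 homB_scaleDr homB_scaleDl.

End ModuleHom.

Definition homB_comp (X Y Z : rmodType B) (g : homB Y Z) (f : homB X Y) :
  homB X Z := g \o f.

End HomSpaces.

Section InjectiveResolutions.
Variable R : pzRingType.

Definition injective_module (E : lmodType R) : Prop :=
  forall (X Y : lmodType R) (i : {linear X -> Y}) (f : {linear X -> E}),
    injective i -> exists g : {linear Y -> E}, forall x, g (i x) = f x.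

Record injective_resolution (M : lmodType R) := InjectiveResolution {
  res_obj :> nat -> lmodType R;
  res_diff : forall q, {linear res_obj q -> res_obj q.+1};
  res_aug : {linear M -> res_obj 0%N};
  res_aug_inj : injective res_aug;
  res_aug_exact : forall y, res_diff 0%N y = 0 <-> exists x, res_aug x = y;
  res_diff_exact : forall q y,
    res_diff q.+1 y = 0 <-> exists x, res_diff q x = y;
  res_injective : forall q, injective_module (res_obj q) }.

End InjectiveResolutions.

Section HomComplex.
Variables (k : fieldType) (B : kAlgebra k).

(* Families of maps I^q -> J^r over all pairs (q, r); those of degree p are
   supported on the pairs with r = q + p. *)
Definition raw_hom (I J : nat -> rmodType B) :=
  dprod (fun t : nat * nat => homB (I t.1) (J t.2)).
HB.instance Definition _ I J := GRing.Lmodule.on (raw_hom I J).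

Definition deg_pred (I J : nat -> rmodType B) (p : int) : {pred raw_hom I J} :=
  [pred f : raw_hom I J |
     `[< forall t, (t.2%:Z != t.1%:Z + p) -> f t = 0 >]].

Fact deg_pred_closed I J p : submod_closed (@deg_pred I J p).
Proof.
split=> [|c f g]; rewrite !inE; first exact/asboolP.
move=> /asboolP f0 /asboolP g0; apply/asboolP => t tp.
by rewrite -[LHS]/(c *: f t + g t) f0 // g0 // scaler0 addr0.
Qed.
HB.instance Definition _ I J p :=
  GRing.isSubmodClosed.Build k (raw_hom I J) (@deg_pred I J p)
    (@deg_pred_closed I J p).

Definition ghom I J p := submod (@deg_pred I J p).
HB.instance Definition _ I J p := GRing.Lmodule.on (ghom I J p).

Definition ghom_proj_raw (I J : nat -> rmodType B) (p : int)
  (f : raw_hom I J) : raw_hom I J :=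
  fun t => if t.2%:Z == t.1%:Z + p then f t else 0.
Fact ghom_proj_subproof I J p f : @ghom_proj_raw I J p f \in @deg_pred I J p.
Proof. by rewrite inE; apply/asboolP => t /negbTE tp; rewrite /ghom_proj_raw tp. Qed.

(* The degree p component of a family. *)
Definition ghom_proj I J p f : ghom I J p :=
  exist _ (@ghom_proj_raw I J p f) (@ghom_proj_subproof I J p f).

Fact ghom_proj_linear I J p : linear (@ghom_proj I J p).
Proof.
move=> c f g; apply/val_inj/functional_extensionality_dep => t /=.
rewrite -[RHS]/(c *: ghom_proj_raw p f t + ghom_proj_raw p g t).
by rewrite /ghom_proj_raw; case: ifP; rewrite ?scaler0 ?addr0.
Qed.
HB.instance Definition _ I J p :=
  GRing.isLinear.Build k (raw_hom I J) (ghom I J p) _ (@ghom_proj I J p)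
    (@ghom_proj_linear I J p).

Section Operations.
Variables (M N L : rmodType B).
Variables (I : injective_resolution M) (J : injective_resolution N).
Variable K : injective_resolution L.

(* d f - (-1)^p f d; nothing in J is mapped by d to J^0. *)
Definition raw_diff (p : int) (f : raw_hom I J) : raw_hom I J :=
  fun t => let: (q, r) := t in
    match r return homB (I q) (J r) with
    | 0 => 0
    | r'.+1 => homB_comp (res_diff J r' : homB _ _) (f (q, r'))
    end
    - sg k p *: homB_comp (f (q.+1, r)) (res_diff I q : homB _ _).

(* The component in degree p' of the differential of f, hence zero unless
   p' = p + 1. *)
Definition ghom_diff (p p' : int) (f : ghom I J p) : ghom I J p' :=
  ghom_proj p' (raw_diff p (val f)).

(* The component in degree r of the composite, zero unless r = p' + p.  As f
   has degree p, the only s that contributes to the sum is t.1 + p. *)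
Definition ghom_comp (p' p : int) (g : ghom J K p') (f : ghom I J p)
  (r : int) : ghom I K r :=
  ghom_proj r (fun t => \sum_(s < (t.1 + `|p|%N).+1)
    (homB_comp (val g (s : nat, t.2)) (val f (t.1, s : nat))
      : homB (I t.1) (K t.2))).

Fact ghom_diff_linear p p' : linear (@ghom_diff p p').
Proof.
move=> c f g; rewrite /ghom_diff -linearP; congr (ghom_proj _ _).
apply: functional_extensionality_dep => -[q r].
rewrite -[RHS]/(c *: raw_diff p (val f) (q, r) + raw_diff p (val g) (q, r)).
rewrite /raw_diff scalerBr addrACA -opprD; congr (_ - _); last first.
  rewrite !scalerA [c * _]mulrC -!scalerA -scalerDr; congr (_ *: _).
  by apply: linear_eq => x.
case: r => [|r]; first by rewrite scaler0 addr0.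
apply: linear_eq => x /=.
rewrite -[LHS]/(res_diff J r ((alg_map B c : B^c) *: val f (q, r) x
  + val g (q, r) x)).
by rewrite linearP.
Qed.
HB.instance Definition _ p p' :=
  GRing.isLinear.Build k (ghom I J p) (ghom I J p') _ (@ghom_diff p p')
    (@ghom_diff_linear p p').

End Operations.

Definition ext (M N : rmodType B) (I : injective_resolution M)
  (J : injective_resolution N) (p : int) :=
  cohomology (@ghom_diff M N I J (p - 1) p) (@ghom_diff M N I J p (p + 1)).
HB.instance Definition _ M N I J p := GRing.Lmodule.on (@ext M N I J p).

Definition ext_class (M N : rmodType B) (I : injective_resolution M)
  (J : injective_resolution N) (p : int)
  (z : submod (cocycle (@ghom_diff M N I J p (p + 1)))) : ext I J p :=
  cohomology_class _ z.

End HomComplex.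

Section Paths.
Variables (O : Type) (V : O -> O -> int -> Type).

(* mpath a b: sequences (x_n, ..., x_1) of composable homogeneous morphisms
   from a to b, the last one first, as in the tensor product
   V(a_{n-1}, a_n) (x) ... (x) V(a_0, a_1). *)
Inductive mpath : O -> O -> Type :=
| pnil a : mpath a a
| pcons a b c (d : int) (x : V b c d) (P : mpath a b) : mpath a c.

Fixpoint plen a b (P : mpath a b) : nat :=
  if P is pcons _ _ _ _ _ P' then (plen P').+1 else 0%N.

Fixpoint pdeg a b (P : mpath a b) : int :=
  if P is pcons _ _ _ d _ P' then d + pdeg P' else 0.

Fixpoint pcat a b c (P : mpath b c) : mpath a b -> mpath a c :=
  match P in mpath b c return mpath a b -> mpath a c with
  | pnil _ => fun Q => Q
  | pcons _ _ _ d x P' => fun Q => pcons x (pcat P' Q)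
  end.

(* Exponent sum_i (i - 1) |x_i| of the Koszul sign of s^(x)n on
   x_n (x) ... (x) x_1. *)
Fixpoint psusp a b (P : mpath a b) : int :=
  if P is pcons _ _ _ d _ P' then (plen P')%:Z * d + psusp P' else 0.

Record splitting a c := Splitting {
  split_mid : O; split_left : mpath split_mid c; split_right : mpath a split_mid }.

Fixpoint splits a c (P : mpath a c) : seq (splitting a c) :=
  match P in mpath a c return seq (splitting a c) with
  | pnil a => [:: Splitting (pnil a) (pnil a)]
  | pcons a b c d x P' =>
      Splitting (pnil c) (pcons x P')
      :: [seq Splitting (pcons x (split_left s)) (split_right s)
         | s <- splits P']
  end.

(* Decompositions of a path into consecutive paths, the last one first. *)
Inductive blocks : O -> O -> Type :=
| bnil a : blocks a a
| bcons a b c (P : mpath b c) (D : blocks a b) : blocks a c.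

Definition add_to_first_block a b (D : blocks a b) :
  forall c d, V b c d -> seq (blocks a c) :=
  match D in blocks a b return forall c d, V b c d -> seq (blocks a c) with
  | bnil _ => fun c d x => [::]
  | bcons _ _ _ P D' => fun c d x => [:: bcons (pcons x P) D']
  end.

(* All decompositions of P into nonempty consecutive paths. *)
Fixpoint decompositions a c (P : mpath a c) : seq (blocks a c) :=
  match P in mpath a c return seq (blocks a c) with
  | pnil a => [:: bnil a]
  | pcons a b c d x P' =>
      flatten [seq bcons (pcons x (pnil b)) D :: add_to_first_block D x
              | D <- decompositions P']
  end.

Fixpoint nblocks a b (D : blocks a b) : nat :=
  if D is bcons _ _ _ _ D' then (nblocks D').+1 else 0%N.

(* sum_j (i_j - 1), where i_j is the length of the j-th block *)
Fixpoint bexcess a b (D : blocks a b) : int :=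
  if D is bcons _ _ _ P D' then ((plen P)%:Z - 1) + bexcess D' else 0.

(* sigma = sum_j (r - j) (i_j - 1), plus the Koszul exponent of
   F_{i_1} (x) ... (x) F_{i_r}: each F_{i_j}, of degree 1 - i_j, moves past
   the elements of the blocks on its left. *)
Fixpoint bsign a b (D : blocks a b) : int :=
  if D is bcons _ _ _ P D'
  then (nblocks D')%:Z * ((plen P)%:Z - 1) + pdeg P * bexcess D' + bsign D'
  else 0.

End Paths.

Notation hpath V := (mpath (fun a b d => V a b d : Type)).

Arguments pnil {O V} a.
Arguments bnil {O V} a.

Section AInfinity.
Variable k : fieldType.

(* A family of operations sends a path to the components of its value; the
   component in degree r vanishes unless r is the degree of the value.  The
   values on empty paths are irrelevant. *)
Definition operations (O O' : Type) (V : O -> O -> int -> lmodType k)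
  (W : O' -> O' -> int -> lmodType k) (f : O -> O') :=
  forall a b, hpath V a b -> forall r, W (f a) (f b) r.

Definition multilinear O O' (V : O -> O -> int -> lmodType k)
  (W : O' -> O' -> int -> lmodType k) f (m : operations V W f) : Prop :=
  forall a b b' c d (P : hpath V b' c)
    (Q : hpath V a b) (l : k) (x y : V b b' d) r,
    m a c (pcat P (pcons (l *: x + y) Q)) r =
    l *: m a c (pcat P (pcons x Q)) r + m a c (pcat P (pcons y Q)) r.

(* the operation in n arguments has degree e - n *)
Definition graded_of_degree O O' (V : O -> O -> int -> lmodType k)
  (W : O' -> O' -> int -> lmodType k) f (m : operations V W f) (e : int)
  : Prop :=
  forall a b (P : hpath V a b) r,
    r != pdeg P + e - (plen P)%:Z -> m a b P r = 0.

Section Relations.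
Variables (O : Type) (V : O -> O -> int -> lmodType k).

(* sum (-1)^(r + s t) g_u (1^(x)r (x) m_s (x) 1^(x)t) (P), where m_s, of
   degree 2 - s, moves past the r elements on its left. *)
Definition insertion_sum O' (W : O' -> O' -> int -> lmodType k) (f : O -> O')
  (g : operations V W f) (m : operations V V id) a c (P : hpath V a c) (e : int)
  : W (f a) (f c) e :=
  \sum_(S1 <- splits P)
    \sum_(S2 <- splits (split_right S1) | (0 < plen (split_left S2))%N)
      let: r := plen (split_left S1) in
      let: s := plen (split_left S2) in
      let: t := plen (split_right S2) in
      sg k (r%:Z + s%:Z * t%:Z + s%:Z * pdeg (split_left S1)) *:
      g a c (pcat (split_left S1)
        (pcons (m _ _ (split_left S2) (pdeg (split_left S2) + 2 - s%:Z))
          (split_right S2))) e.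

Record ainf_category := AInfCategory {
  ainf_op :> forall a b, hpath V a b -> forall r, V a b r;
  ainf_multilinear : multilinear (ainf_op : operations V V id);
  ainf_graded : graded_of_degree (ainf_op : operations V V id) 2;
  ainf_relation : forall a c (P : hpath V a c) e,
    insertion_sum (ainf_op : operations V V id) ainf_op P e = 0 }.

Definition strictly_unital (m : ainf_category) : Prop :=
  exists u : forall a, V a a 0,
    [/\ forall a b d (f : V a b d),
          m a b (pcons f (pcons (u a) (pnil a))) d = f,
        forall a b d (g : V a b d),
          m a b (pcons (u b) (pcons g (pnil a))) d = g &
        forall a b c (P : hpath V b c) (Q : hpath V a b) e,
          (plen P + 1 + plen Q)%N != 2 ->
          m a c (pcat P (pcons (u b) Q)) e = 0].

End Relations.

Section Functors.
Variables (O O' : Type) (V : O -> O -> int -> lmodType k).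
Variables (W : O' -> O' -> int -> lmodType k) (f : O -> O').

(* (F_{i_1} (x) ... (x) F_{i_r}) (D), up to its Koszul sign *)
Fixpoint apply_blocks (F : operations V W f) a c
  (D : blocks (fun a b d => V a b d : Type) a c)
  : hpath W (f a) (f c) :=
  match D in blocks _ a c return hpath W (f a) (f c) with
  | bnil a => pnil (f a)
  | bcons _ _ _ P D' =>
      pcons (F _ _ P (pdeg P + 1 - (plen P)%:Z)) (apply_blocks F D')
  end.

Definition is_ainf_functor (mV : operations V V id) (mW : operations W W id)
  (F : operations V W f) : Prop :=
  [/\ multilinear F, graded_of_degree F 1 &
      forall a c (P : hpath V a c) e, (0 < plen P)%N ->
        insertion_sum F mV P e =
        \sum_(D <- decompositions P)
          sg k (bsign D) *: mW _ _ (apply_blocks F D) e].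

End Functors.

Section Twisted.
Variables (O : Type) (V : O -> O -> int -> lmodType k).
Variable m : ainf_category V.

Record objseq := ObjSeq { objseq_len : nat; objseq_obj :> 'I_objseq_len -> O }.

(* The entry at (i, j) is the component X i -> Y j. *)
Definition mat (X Y : objseq) (p : int) :=
  dprod (fun t : 'I_(objseq_len X) * 'I_(objseq_len Y) => V (X t.1) (Y t.2) p).
HB.instance Definition _ X Y p := GRing.Lmodule.on (mat X Y p).
Notation matpath := (hpath mat).

(* The paths of entries occurring in the (i, j) entry of the product of a
   path of matrices. *)
Fixpoint entries (X Y : objseq) (P : matpath X Y) :
  forall i j, seq (hpath V (X i) (Y j)) :=
  match P in mpath _ X Y
    return forall i j, seq (hpath V (X i) (Y j)) with
  | pnil X => fun i j =>
      match i =P j with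
      | ReflectT e =>
          [:: eq_rect i (fun j => mpath _ (X i) (X j)) (pnil (X i)) j e]
      | ReflectF _ => [::]
      end
  | pcons X Y Z d x P' => fun i l =>
      flatten [seq [seq pcons (x (j, l) : V (Y j) (Z l) d) q | q <- entries P' i j]
              | j <- enum 'I_(objseq_len Y)]
  end.

Definition mat_op (X Y : objseq) (P : matpath X Y) (r : int) : mat X Y r :=
  fun t => \sum_(q <- entries P t.1 t.2) m _ _ q r.

(* b' on matrices: b'_n (s x_n, ..., s x_1) = s (mat_susp_op (x_n, ..., x_1)).
   The sign is that of psusp, from b'_n o s^(x)n = s o m_n. *)
Definition mat_susp_op (X Y : objseq) (P : matpath X Y) (r : int) : mat X Y r :=
  sg k (psusp P) *: mat_op P r.

Fixpoint mat_pow (X : objseq) (delta : mat X X 1) (t : nat) : matpath X X :=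
  if t is t'.+1 then pcons delta (mat_pow delta t') else pnil X.

(* tw_delta (j, i) is delta_ij : a_j -> a_i.  Being strictly upper
   triangular, delta has no nonzero products of length objseq_len or more, so
   that all sums over its powers may be truncated there. *)
Record tw_object := TwObject {
  tw_objseq :> objseq;
  tw_delta : mat tw_objseq tw_objseq 1;
  tw_triangular : forall i j : 'I_(objseq_len tw_objseq),
    (j <= i)%N -> tw_delta (j, i) = 0;
  tw_maurer_cartan :
    \sum_(1 <= t < (objseq_len tw_objseq).+1)
      (-1) ^+ ((t * t.-1)./2)%N *: mat_op (mat_pow tw_delta t) 2 = 0 }.

Arguments tw_delta : clear implicits.

Definition tw_hom (X Y : tw_object) (p : int) : lmodType k := mat X Y p.
Notation twpath := (hpath tw_hom).
Notation twcons y P :=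
  (@pcons tw_object (fun X Y p => tw_hom X Y p : Type) _ _ _ _ y P).

(* The arguments alpha_n^(x)j_n (x) y_n (x) ... (x) y_1 (x) alpha_0^(x)j_0 of
   b' in the sum defining b_n. *)
Fixpoint insertions (X Y : tw_object) (P : twpath X Y) : seq (matpath X Y) :=
  match P in mpath _ X Y return seq (matpath X Y) with
  | pnil X => [seq mat_pow (tw_delta X) t | t <- iota 0 (objseq_len X).+1]
  | pcons X Y Z d y P' =>
      flatten [seq [seq pcat (mat_pow (tw_delta Z) t)
                        (pcons (y : mat Y Z d) Q) | Q <- insertions P']
              | t <- iota 0 (objseq_len Z).+1]
  end.

(* s m^tw (y_n, ..., y_1) = +/- b_n (s y_n, ..., s y_1) *)
Definition tw_op (X Y : tw_object) (P : twpath X Y) (r : int) : tw_hom X Y r :=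
  sg k (psusp P) *: \sum_(Q <- insertions P) mat_susp_op Q r.

Definition tw_diff (X Y : tw_object) (p r : int) (y : tw_hom X Y p)
  : tw_hom X Y r :=
  tw_op (twcons y (pnil X)) r.

Lemma pcatA (O' : Type) (U : O' -> O' -> int -> Type) a b c d
  (P : mpath U c d) (Q : mpath U b c) (S : mpath U a b) :
  pcat (pcat P Q) S = pcat P (pcat Q S).
Proof.
by elim: P Q => [//|c0 d0 e0 dg x P IH] Q /=; rewrite IH.
Qed.

Lemma psusp_pcat_pcons (O' : Type) (U : O' -> O' -> int -> Type) a b b' c d
  (P : mpath U b' c) (x y : U b b' d) (Q : mpath U a b) :
  psusp (pcat P (pcons x Q)) = psusp (pcat P (pcons y Q)).
Proof.
elim: P x y => [//|c0 d0 e0 dg z P IH] x y /=; rewrite (IH x y).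
congr (_%:Z * _ + _); by elim: P x y {IH} => [//|? ? ? ? ? P IH] x y /=; rewrite (IH x y).
Qed.

Lemma mat_op_linear X Y Y' Z d (P : matpath Y' Z) (Q : matpath X Y) (l : k)
  (x y : mat Y Y' d) r :
  mat_op (pcat P (pcons (l *: x + y) Q)) r =
  l *: mat_op (pcat P (pcons x Q)) r + mat_op (pcat P (pcons y Q)) r.
Proof.
apply: functional_extensionality_dep => -[i j].
rewrite -[RHS]/(l *: mat_op (pcat P (pcons x Q)) r (i, j)
  + mat_op (pcat P (pcons y Q)) r (i, j)).
rewrite /mat_op /=.
have H : forall c (L : hpath V (Z j) c),
  \sum_(q <- entries (pcat P (pcons (l *: x + y) Q)) i j) m _ _ (pcat L q) r =
  l *: (\sum_(q <- entries (pcat P (pcons x Q)) i j) m _ _ (pcat L q) r) +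
  \sum_(q <- entries (pcat P (pcons y Q)) i j) m _ _ (pcat L q) r.
  elim: P x y j => [A|A C D d0 z P IH] x y j c L /=.
    rewrite !big_flatten /= !big_map scaler_sumr -big_split /=.
    apply: eq_bigr => j' _; rewrite !big_map scaler_sumr -big_split /=.
    by apply: eq_bigr => q _; rewrite -ainf_multilinear.
  rewrite !big_flatten /= !big_map scaler_sumr -big_split /=.
  apply: eq_bigr => j' _; rewrite !big_map.
  have E w : \sum_(q <- entries (pcat P (pcons w Q)) i j')
      m _ _ (pcat L (pcons (z (j', j)) q)) r =
    \sum_(q <- entries (pcat P (pcons w Q)) i j')
      m _ _ (pcat (pcat L (pcons (z (j', j)) (pnil _))) q) r.
    by apply: eq_bigr => q _; rewrite pcatA.
  by rewrite !E IH.
exact: (H _ (pnil _)).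
Qed.

Lemma tw_diffE X Y p r (y : tw_hom X Y p) :
  tw_diff r y = sg k (0 * p + 0) *:
    \sum_(t <- iota 0 (objseq_len Y).+1) \sum_(t' <- iota 0 (objseq_len X).+1)
      mat_susp_op (pcat (mat_pow (tw_delta Y) t)
        (pcons (y : mat X Y p) (mat_pow (tw_delta X) t'))) r.
Proof.
rewrite /tw_diff /tw_op; congr (_ *: _).
rewrite -[insertions _]/(flatten [seq [seq pcat (mat_pow (tw_delta Y) t)
    (pcons (y : mat X Y p) Q) | Q <- [seq mat_pow (tw_delta X) t' |
    t' <- iota 0 (objseq_len X).+1]] | t <- iota 0 (objseq_len Y).+1]).
rewrite big_flatten big_map; apply: eq_bigr => t _.
by rewrite big_map big_map.
Qed.

Fact tw_diff_linear X Y p r : linear (@tw_diff X Y p r).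
Proof.
move=> l x y; rewrite !tw_diffE scalerA [l * _]mulrC -scalerA -scalerDr.
congr (_ *: _); rewrite scaler_sumr -big_split /=.
apply: eq_bigr => t _; rewrite scaler_sumr -big_split /=.
apply: eq_bigr => t' _; rewrite /mat_susp_op mat_op_linear scalerDr.
rewrite !scalerA [sg _ _ * l]mulrC.
congr (_ * sg _ _ *: _ + sg _ _ *: _); exact: psusp_pcat_pcons.
Qed.
HB.instance Definition _ X Y p r :=
  GRing.isLinear.Build k (tw_hom X Y p) (tw_hom X Y r) _ (@tw_diff X Y p r)
    (@tw_diff_linear X Y p r).

Definition filt_hom (X Y : tw_object) :=
  cohomology (@tw_diff X Y (-1) 0) (@tw_diff X Y 0 1).

Definition filt_class (X Y : tw_object)
  (z : submod (cocycle (@tw_diff X Y 0 1))) : filt_hom X Y :=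
  cohomology_class _ z.

End Twisted.
End AInfinity.

Section CanonicalStructure.
Variables (k : fieldType) (B : kAlgebra k) (n : nat) (M : 'I_n -> rmodType B).
Variable I : forall i, injective_resolution (M i).

Definition dg_hom (i j : 'I_n) (p : int) : lmodType k := ghom (I i) (I j) p.

Definition ext_hom (i j : 'I_n) (p : int) : lmodType k := ext (I i) (I j) p.

(* The dg category E as an A-infinity category: m_1 = d, m_2 is the
   composition and m_l = 0 for l >= 3. *)
Definition dg_op : operations dg_hom dg_hom id :=
  fun i j (P : hpath dg_hom i j) =>
  match P in mpath _ i j return forall r, dg_hom i j r with
  | pnil _ => fun r => 0
  | pcons a b c d x P' =>
      match P' in mpath _ a b
        return forall c d, dg_hom b c d -> forall r, dg_hom a c r with
      | pnil _ => fun c d x r => ghom_diff r x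
      | pcons a b b' e y P'' =>
          match P'' in mpath _ a b
            return dg_hom b b' e ->
                   forall c d, dg_hom b' c d -> forall r, dg_hom a c r with
          | pnil _ => fun y c d x r => ghom_comp x y r
          | pcons _ _ _ _ _ _ => fun _ _ _ _ _ => 0
          end y
      end c d x
  end.

Definition ext_cocycle (i j : 'I_n) (p : int) :=
  submod (cocycle (@ghom_diff _ _ _ _ (I i) (I j) p (p + 1))).

Record canonical_structure (m : ainf_category ext_hom) : Prop := {
  canonical_m1 : forall i j p (x : ext_hom i j p) r,
    m i j (pcons x (pnil i)) r = 0;
  canonical_m2 : forall i j l q p (g : ext_cocycle j l q) (f : ext_cocycle i j p),
    exists w : ext_cocycle i l (q + p),
      val w = ghom_comp (val g) (val f) (q + p) /\
      m i l (pcons (ext_class g : ext_hom j l q)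
        (pcons (ext_class f : ext_hom i j p) (pnil i))) (q + p) = ext_class w;
  canonical_functor : exists F : operations ext_hom dg_hom id,
    is_ainf_functor (m : operations ext_hom ext_hom id) dg_op F /\
    forall i j p (x : ext_hom i j p),
      exists z : ext_cocycle i j p,
        val z = F i j (pcons x (pnil i)) p /\ ext_class z = x }.

(* There are submodules 0 = U_0 <= U_1 <= ... <= U_l = X such that each
   U_(q+1) / U_q is isomorphic to some M_i. *)
Definition filtered (X : rmodType B) : Prop :=
  exists (l : nat) (U : nat -> submodClosed X),
    [/\ forall x, (x \in U 0%N) = (x == 0),
        forall x, x \in U l &
        forall q, (q < l)%N ->
          {subset U q <= U q.+1} /\
          exists i (phi : {linear subquot (U q.+1) (U q) -> M i}),
            bijective phi ].

End CanonicalStructure.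

Record category_on (Ob : Type) (Hom : Ob -> Ob -> Type) := CategoryOn {
  cat_id : forall X, Hom X X;
  cat_comp : forall X Y Z, Hom Y Z -> Hom X Y -> Hom X Z;
  cat_comp1m : forall X Y (f : Hom X Y), cat_comp (cat_id Y) f = f;
  cat_compm1 : forall X Y (f : Hom X Y), cat_comp f (cat_id X) = f;
  cat_compA : forall X Y Z T (h : Hom Z T) (g : Hom Y Z) (f : Hom X Y),
    cat_comp h (cat_comp g f) = cat_comp (cat_comp h g) f }.

Record category := Category {
  cat_ob :> Type;
  cat_hom : cat_ob -> cat_ob -> Type;
  cat_str :> category_on cat_hom }.

Record functor (C D : category) := Functor {
  fun_ob :> C -> D;
  fun_hom : forall X Y : C, cat_hom X Y -> cat_hom (fun_ob X) (fun_ob Y);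
  fun_id : forall X : C, fun_hom (cat_id C X) = cat_id D (fun_ob X);
  fun_comp : forall (X Y Z : C) (g : cat_hom Y Z) (f : cat_hom X Y),
    fun_hom (cat_comp C g f) = cat_comp D (fun_hom g) (fun_hom f) }.

Definition functor_id (C : category) : functor C C :=
  @Functor C C id (fun _ _ => id) (fun _ => erefl) (fun _ _ _ _ _ => erefl).

Lemma functor_comp_id (C D E : category) (G : functor D E) (F : functor C D) X :
  fun_hom G (fun_hom F (cat_id C X)) = cat_id E (G (F X)).
Proof. by rewrite !fun_id. Qed.

Lemma functor_comp_comp (C D E : category) (G : functor D E) (F : functor C D)
  (X Y Z : C) (g : cat_hom Y Z) (f : cat_hom X Y) :
  fun_hom G (fun_hom F (cat_comp C g f)) =
  cat_comp E (fun_hom G (fun_hom F g)) (fun_hom G (fun_hom F f)).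
Proof. by rewrite !fun_comp. Qed.

Definition functor_comp (C D E : category) (G : functor D E) (F : functor C D)
  : functor C E :=
  Functor (functor_comp_id G F) (functor_comp_comp G F).

Definition naturally_isomorphic (C D : category) (F G : functor C D) : Prop :=
  exists (eta : forall X : C, cat_hom (F X) (G X))
         (theta : forall X : C, cat_hom (G X) (F X)),
    [/\ forall (X Y : C) (f : cat_hom X Y),
          cat_comp D (eta Y) (fun_hom F f) = cat_comp D (fun_hom G f) (eta X),
        forall X : C, cat_comp D (theta X) (eta X) = cat_id D (F X) &
        forall X : C, cat_comp D (eta X) (theta X) = cat_id D (G X)].

Definition equivalent (C D : category) : Prop :=
  exists (F : functor C D) (G : functor D C),
    naturally_isomorphic (functor_comp G F) (functor_id C) /\
    naturally_isomorphic (functor_comp F G) (functor_id D).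

Section FiltModules.
Variables (k : fieldType) (B : kAlgebra k) (n : nat) (M : 'I_n -> rmodType B).

Definition filt_module := {X : rmodType B | filtered M X}.
Definition filt_module_hom (X Y : filt_module) :=
  {linear proj1_sig X -> proj1_sig Y}.

Definition filt_module_category_on : category_on filt_module_hom.
Proof.
apply: (@CategoryOn _ filt_module_hom
  (fun X => idfun : {linear proj1_sig X -> proj1_sig X})
  (fun X Y Z g f => g \o f : {linear proj1_sig X -> proj1_sig Z})).
- by move=> X Y f; apply: linear_eq.
- by move=> X Y f; apply: linear_eq.
- by move=> X Y Z T h g f; apply: linear_eq.
Defined.

Definition filt_modules : category := Category filt_module_category_on.

End FiltModules.

Section FiltA.
Variables (k : fieldType) (O : Type) (V : O -> O -> int -> lmodType k).
Variable m : ainf_category V.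

Notation twcons y P :=
  (@pcons (tw_object m) (fun X Y p => tw_hom X Y p : Type) _ _ _ _ y P).

(* C is filt A: its objects and morphism sets are fixed by its type, and its
   composition is induced by m_2 of tw A.  This determines C, identities
   being unique. *)
Definition composition_induced_by_m2 (C : category_on (@filt_hom _ _ _ m))
  : Prop :=
  forall (X Y Z : tw_object m) (g : submod (cocycle (@tw_diff _ _ _ m Y Z 0 1)))
    (f : submod (cocycle (@tw_diff _ _ _ m X Y 0 1))),
    exists w : submod (cocycle (@tw_diff _ _ _ m X Z 0 1)),
      val w = tw_op (twcons (val g) (twcons (val f) (pnil X))) 0 /\
      cat_comp C (filt_class g) (filt_class f) = filt_class w.

End FiltA.

(* Main.v *)
(* Let F : A -> E be the A-infinity functor given by the canonical structure.  A
   twisted object X = (a_1, ..., a_r; delta) yields the complex T(X), the sum of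
   the injective resolutions of the M_(a_i) with differential
   d - sum_t +/- F_t(delta, ..., delta), which is an injective resolution of
   N(X) = ker (T(X)^0 -> T(X)^1); the triangular shape of delta filters N(X) by
   the M_(a_i).  A twisted morphism y : X -> Y acts as
   sum +/- F(delta, ..., y, ..., delta).  This is a chain map from the twisted
   morphisms to Hom(T(X), T(Y)), compatible with compositions up to homotopy, and
   its cone is acyclic because its leading term F_1 is a quasi-isomorphism.  In
   degree 0 this identifies the morphisms X -> Y of filt A with the maps
   N(X) -> N(Y), which makes N a fully faithful functor.  In degree 1 it shows that
   an extension of M_i by N(X) is N(X') for a twisted object X' obtained by adding
   i to X, so that N is essentially surjective.

   All identities between twisted compositions are A-infinity relations summed
   over the paths of one graph, in which X --y--> Y --z--> Z are laid side by side
   and delta, y and z are the arrows.  Shifting the degrees of Y and Z makes the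
   suspended degree of a path, hence its sign, depend on its end points only. *)
Require Import Defs.
From HB Require Import structures.
From mathcomp Require Import all_boot all_order all_algebra.
From mathcomp Require Import boolp ring zify.

Set Implicit Arguments.
Unset Strict Implicit.
Unset Printing Implicit Defensive.

Import Order.TTheory GRing.Theory Num.Theory.
Local Open Scope ring_scope.

(** * Signs and paths *)

(** Degrees are indices of types, so that an equation between degrees cannot be used silently.
    Lemmas therefore receive degree functions [ed], [kd], [pd] together with equations for them
    instead of fixed expressions in [shift]; in use these functions reduce to literals such as 0, 1
    or 2 and no transport appears. Moreover paths form no [eqType], so a property of all paths in a
    list is stated as an equality of sums over that list.

    The category laws of filt $\mathcal A$ are not extracted from the $A_\infty$ relations. The map
    from twisted morphisms to module maps is bijective on morphism sets and carries $m_2$ of tw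
    $\mathcal A$ to composition; identities, unit laws and associativity are pulled back along it.

    An extension is first realized on a graph whose vertex set is a disjoint union. Only afterwards
    are the vertices numbered so as to obtain a strictly upper triangular matrix; this is why most
    statements concern graphs rather than twisted objects. *)

Section Signs.
Variable k : fieldType.

Lemma sgE z : sg k z = (-1) ^ z.
Proof.
case: z => n //; rewrite NegzE /sg abszN absz_nat -exprz_inv.
by rewrite invrN invr1.
Qed.

Lemma sgD x y : sg k (x + y) = sg k x * sg k y.
Proof. by rewrite !sgE expfzDr // oppr_eq0 oner_eq0. Qed.

Lemma sg0 : sg k 0 = 1. Proof. by []. Qed.
Lemma sg1 : sg k 1 = -1. Proof. by rewrite /sg expr1. Qed.
Lemma sgN1 : sg k (-1) = -1. Proof. exact: sg1. Qed.

Lemma sgK x : sg k x * sg k x = 1.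
Proof. by rewrite /sg -signr_odd mulr_sign; case: odd; rewrite ?opprK. Qed.

Lemma sg_mod2 x y z : x = y + (z + z) -> sg k x = sg k y.
Proof. by move=> ->; rewrite !sgD sgK mulr1. Qed.

End Signs.

Section PathLemmas.
Variables (O : Type) (V : O -> O -> int -> Type).
Implicit Types a b c : O.

Lemma plen_pcat a b c (P : mpath V b c) (Q : mpath V a b) :
  plen (pcat P Q) = (plen P + plen Q)%N.
Proof. by elim: P Q => [//|? ? ? ? ? P IH] Q /=; rewrite IH. Qed.

Lemma psusp_pcat a b c (P : mpath V b c) (Q : mpath V a b) :
  psusp (pcat P Q) = psusp P + (plen Q)%:Z * pdeg P + psusp Q.
Proof.
elim: P Q => [?|? ? ? ? ? P IH] Q /=; first by rewrite mulr0 !add0r.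
by rewrite IH plen_pcat PoszD; ring.
Qed.

Definition sdeg a b (P : mpath V a b) : int := pdeg P - (plen P)%:Z.

Lemma sdeg_pcons a b c d (x : V b c d) (P : mpath V a b) :
  sdeg (pcons x P) = d - 1 + sdeg P.
Proof. by rewrite /sdeg /= -addn1 PoszD; ring. Qed.

(** The two halves of every splitting recombine to [P]. Under a sum this allows [P] to be traded for
    a concatenation, on which [psusp] can be expanded. *)
Lemma sum_splits_pcat (U : zmodType) a c (P : mpath V a c)
  (h : mpath V a c -> splitting V a c -> U) :
  \sum_(s <- splits P) h (pcat (split_left s) (split_right s)) s =
  \sum_(s <- splits P) h P s.
Proof.
elim: P h => [b|b c0 d0 e x P IH] h /=; first by rewrite !big_seq1.
rewrite !big_cons /= !big_map; congr (_ + _).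
exact: (IH (fun Q s => h (pcons x Q)
  (Splitting (pcons x (split_left s)) (split_right s)))).
Qed.

(** In a dg category $m_l=0$ for $l\ge3$, so the functor equation keeps only decompositions into one
    or two blocks; the latter are the splittings into two nonempty paths. *)
Lemma sum_decompositions (U : zmodType) a c (P : mpath V a c)
  (h : blocks V a c -> U) :
  (forall D, (2 < nblocks D)%N -> h D = 0) -> (0 < plen P)%N ->
  \sum_(D <- decompositions P) h D =
  h (bcons P (bnil a)) +
  \sum_(s <- splits P | (0 < plen (split_left s))%N && (0 < plen (split_right s))%N)
    h (bcons (split_left s) (bcons (split_right s) (bnil a))).
Proof.
elim: P h => [//|b c0 d0 e x P IH] h h0 _ /=.
rewrite big_flatten big_map.
case: P x h h0 IH => [{}b|{}b c1 {}c0 e1 x1 P] x h h0 IH.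
  by rewrite /= big_seq1 !big_cons /= !big_nil.
under eq_bigr do rewrite big_cons.
rewrite IH //; last first.
  move=> D; case: D x h h0 {IH} => [//|b1 b2 b3 P' D] x h h0 /= D2.
  by rewrite big_seq1 !h0 ?addr0 //= ltnW.
rewrite /= big_seq1 !big_cons /=.
rewrite [in RHS]addrCA -[LHS]addrA; congr (_ + (_ + _)).
rewrite ![in RHS]big_map big_map; apply: eq_bigr => s _.
(* A new block in front of two others gives three blocks, killed by [h0]; only the enlargement of
   the first block survives. *)
by rewrite [X in X + _]h0 // add0r big_seq1.
Qed.

End PathLemmas.

Section Multilinear.
Variables (k : fieldType) (O O' : Type) (V : O -> O -> int -> lmodType k).
Variables (W : O' -> O' -> int -> lmodType k) (f : O -> O').

Section Bar.
Variable g : operations V W f.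

(* The operation on the suspended morphisms: its signs in the relations below
   depend only on the degrees [sdeg] of paths. *)
Definition bar a b (P : hpath V a b) e : W (f a) (f b) e := sg k (psusp P) *: g P e.

Hypothesis g_lin : multilinear g.

Lemma op0 a b b' c d (P : hpath V b' c) (Q : hpath V a b) e :
  g (pcat P (pcons (0 : V b b' d) Q)) e = 0.
Proof.
apply: (addIr (g (pcat P (pcons (0 : V b b' d) Q)) e)).
by rewrite add0r -[X in X + _]scale1r -g_lin scale1r addr0.
Qed.

Lemma bar_linear a b b' c d (P : hpath V b' c) (Q : hpath V a b) (l : k)
  (x y : V b b' d) e :
  bar (pcat P (pcons (l *: x + y) Q)) e =
  l *: bar (pcat P (pcons x Q)) e + bar (pcat P (pcons y Q)) e.
Proof.
rewrite /bar g_lin scalerDr !scalerA [sg _ _ * l]mulrC.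
by congr (_ * sg _ _ *: _ + sg _ _ *: _); apply: psusp_pcat_pcons.
Qed.

Lemma bar0 a b b' c d (P : hpath V b' c) (Q : hpath V a b) e :
  bar (pcat P (pcons (0 : V b b' d) Q)) e = 0.
Proof. by rewrite /bar op0 scaler0. Qed.

Lemma barZ a b b' c d (P : hpath V b' c) (Q : hpath V a b) (l : k)
  (x : V b b' d) e :
  bar (pcat P (pcons (l *: x) Q)) e = l *: bar (pcat P (pcons x Q)) e.
Proof. by rewrite -[l *: x]addr0 bar_linear bar0 addr0. Qed.

Lemma bar_sum a b b' c d (P : hpath V b' c) (Q : hpath V a b)
  (J : Type) (s : seq J) (p : pred J) (x : J -> V b b' d) e :
  bar (pcat P (pcons (\sum_(i <- s | p i) x i) Q)) e =
  \sum_(i <- s | p i) bar (pcat P (pcons (x i) Q)) e.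
Proof.
elim: s => [|i s IH]; first by rewrite !big_nil bar0.
rewrite !big_cons; case: (p i) => //.
by have := bar_linear P Q 1 (x i) (\sum_(j <- s | p j) x j) e; rewrite !scale1r IH.
Qed.

Lemma bar1 a b d (x : V a b d) e : bar (pcons x (pnil a)) e = g (pcons x (pnil a)) e.
Proof. by rewrite /bar /= mul0r addr0 sg0 scale1r. Qed.

End Bar.
End Multilinear.

Section BarRelation.
Variables (k : fieldType) (O O' : Type) (V : O -> O -> int -> lmodType k).
Variables (W : O' -> O' -> int -> lmodType k) (f : O -> O').
Variables (m : operations V V id) (g : operations V W f).
Hypothesis g_lin : multilinear g.

(** Suspension absorbs the signs $(-1)^{r+st}$ and the Koszul signs, except for the one of moving
    $b'$, of degree 1, past the suspended elements on its left. *)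
Lemma bar_insertion a c (P : hpath V a c) e :
  sg k (psusp P) *: insertion_sum g m P e =
  \sum_(S1 <- splits P)
    \sum_(S2 <- splits (split_right S1) | (0 < plen (split_left S2))%N)
      sg k (sdeg (split_left S1)) *:
      bar g (pcat (split_left S1)
        (pcons (bar m (split_left S2) (sdeg (split_left S2) + 2))
          (split_right S2))) e.
Proof.
rewrite /insertion_sum scaler_sumr.
pose H (Q : hpath V a c) (S1 : splitting _ a c)
    (S2 : splitting (fun a b d => V a b d : Type) a (split_mid S1)) :=
  sg k (psusp Q) *: (sg k ((plen (split_left S1))%:Z
     + (plen (split_left S2))%:Z * (plen (split_right S2))%:Z
     + (plen (split_left S2))%:Z * pdeg (split_left S1)) *:
  g (pcat (split_left S1)
    (pcons (m (split_left S2)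
       (pdeg (split_left S2) + 2 - (plen (split_left S2))%:Z))
     (split_right S2))) e).
transitivity (\sum_(S1 <- splits P) \sum_(S2 <- splits (split_right S1)
    | (0 < plen (split_left S2))%N) H P S1 S2).
  by apply: eq_bigr => S1 _; rewrite scaler_sumr.
rewrite -(sum_splits_pcat P (fun Q S1 => \sum_(S2 <- splits (split_right S1)
    | (0 < plen (split_left S2))%N) H Q S1 S2)).
apply: eq_bigr => S1 _; rewrite [LHS]big_mkcond [RHS]big_mkcond /=.
rewrite -(sum_splits_pcat (split_right S1) (fun R S2 =>
  if (0 < plen (split_left S2))%N then H (pcat (split_left S1) R) S1 S2 else 0)).
apply: eq_bigr => S2 _; case: ifP => // _; rewrite /H.
case: S1 => y L R1 /= in S2 *; case: S2 => x M R /=.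
have -> : sdeg M + 2 = pdeg M + 2 - (plen M)%:Z by rewrite /sdeg; ring.
rewrite [bar m M _]/bar barZ // /bar !scalerA -!sgD; congr (_ *: _).
rewrite !psusp_pcat /= plen_pcat.
(* The two exponents differ by an even number; this is half of the difference. *)
apply: (@sg_mod2 _ _ _ ((plen M)%:Z * (plen R)%:Z  + (plen M)%:Z * pdeg L + (plen L)%:Z - pdeg L
   - (plen R)%:Z)).
by rewrite /sdeg -[(plen R).+1]addn1 !PoszD; ring.
Qed.

End BarRelation.

(** * Chains in a graph and the $A_\infty$ relations summed over them *)

Section Chains.
Variables (k : fieldType) (O : Type) (V : O -> O -> int -> lmodType k).

(* A twisted object whose entries may have different degrees: [shift b - shift a]
   is the suspended degree of every path from [a] to [b]. *)
Record graph := Graph {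
  vertex :> finType;
  vobj : vertex -> O;
  vdeg : vertex -> vertex -> int;
  arrow : forall a b, V (vobj a) (vobj b) (vdeg a b);
  edge : rel vertex;
  rank : vertex -> nat;
  shift : vertex -> int;
  edge_rank : forall a b, edge a b -> (rank a < rank b)%N;
  edge_deg : forall a b, edge a b -> vdeg a b = 1 + shift b - shift a }.

Variable G : graph.
Implicit Types a b x y : G.

Definition trivial_chain a b : seq (hpath V (vobj a) (vobj b)) :=
  match a =P b with
  | ReflectT e => [:: eq_rect a (fun b => hpath V (vobj a) (vobj b)) (pnil _) b e]
  | ReflectF _ => [::]
  end.

Fixpoint chains_upto n a b : seq (hpath V (vobj a) (vobj b)) :=
  trivial_chain a b ++
  if n is n'.+1 then
    flatten [seq [seq pcons (arrow x b) P | P <- chains_upto n' a x]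
            | x <- enum G & edge x b]
  else [::].

(** Ranks grow strictly along edges, so a chain ending at [b] has at most [rank b] arrows and this
    bound loses nothing. *)
Definition chains a b := chains_upto (rank b) a b.

Lemma trivial_chain_refl a : trivial_chain a a = [:: pnil _].
Proof.
by rewrite /trivial_chain; case: eqP => // e; rewrite (eq_axiomK e).
Qed.

Lemma trivial_chain_neq a b : a != b -> trivial_chain a b = [::].
Proof. by rewrite /trivial_chain; case: eqP. Qed.

Lemma chains_upto_stable n a b : (rank b <= n)%N -> chains_upto n a b = chains a b.
Proof.
move=> bn; rewrite /chains -(subnKC bn); elim: (n - rank b)%N => {n bn}[|n].
  by rewrite addn0.
rewrite addnS => <-; move: (leq_addr n (rank b)); move: (_ + n)%N => N {n}.
elim: N a b => [|N IH] a b bN.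
  rewrite /= (eq_in_filter (a2 := pred0)) ?filter_pred0 // => x _ /=.
  by apply/negbTE/negP => /edge_rank; move: bN; rewrite leqn0 => /eqP ->.
rewrite [LHS]/= [RHS]/=; congr (_ ++ flatten _); apply/eq_in_map => x.
rewrite mem_filter => /andP[/edge_rank xb _].
by rewrite -IH // -ltnS (leq_trans xb).
Qed.

Section Sums.
Variable U : zmodType.

(** This recursion on the last arrow no longer mentions the bound on the length; later facts on
    chains follow from it by [rank_ind]. *)
Lemma sum_chains a b (h : hpath V (vobj a) (vobj b) -> U) :
  \sum_(P <- chains a b) h P = \sum_(P <- trivial_chain a b) h P +
  \sum_(x | edge x b) \sum_(P <- chains a x) h (pcons (arrow x b) P).
Proof.
rewrite -(chains_upto_stable a (leqnSn _)) /= big_cat; congr (_ + _).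
rewrite big_flatten big_map big_filter big_enum_cond /=.
apply: eq_bigr => x xb; rewrite big_map; congr bigop.
by rewrite chains_upto_stable // ltnW // edge_rank.
Qed.

Lemma rank_ind (T : G -> Prop) :
  (forall b, (forall x, edge x b -> T x) -> T b) -> forall b, T b.
Proof.
move=> H b; have [n] := ubnP (rank b); elim: n b => // n IH b bn.
by apply: H => x /edge_rank xb; apply: IH; apply: leq_trans xb _.
Qed.

Lemma sum_trivial_chain_l b (h : forall a, hpath V (vobj a) (vobj b) -> U) :
  \sum_a \sum_(P <- trivial_chain a b) h a P = h b (pnil _).
Proof.
rewrite (bigD1 b) //= trivial_chain_refl big_seq1 big1 ?addr0 // => a ab.
by rewrite trivial_chain_neq // big_nil.
Qed.

(** A chain cut at one of its vertices is a pair of chains meeting there. Cutting before and after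
    an inserted operation turns relations summed over chains into matrix products indexed by
    vertices. *)
Lemma sum_chains_splits a b (h : splitting (fun s t d => V s t d : Type) (vobj a) (vobj b) -> U) :
  \sum_(P <- chains a b) \sum_(s <- splits P) h s =
  \sum_x \sum_(R <- chains a x) \sum_(L <- chains x b) h (Splitting L R).
Proof.
elim/rank_ind: b h => b IH h.
transitivity (\sum_(R <- chains a b) h (Splitting (pnil _) R) +
  \sum_x \sum_(R <- chains a x) \sum_(y | edge y b) \sum_(L <- chains x y)
     h (Splitting (pcons (arrow y b) L) R)); last first.
  rewrite -(sum_trivial_chain_l (fun x L => \sum_(R <- chains a x) h (Splitting L R))).
  rewrite -big_split; apply: eq_bigr => x _ /=.
  rewrite exchange_big -big_split; apply: eq_bigr => R _ /=.
  by rewrite [RHS]sum_chains.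
rewrite [LHS]sum_chains [X in _ = X + _]sum_chains -addrA; congr (_ + _).
  rewrite /trivial_chain; case: eqP => [e|_]; rewrite ?big_nil // !big_seq1.
  by case: _ / e h => h; rewrite /= big_seq1.
under [X in _ = _ + X]eq_bigr do rewrite exchange_big.
rewrite [X in _ = _ + X]exchange_big -big_split; apply: eq_bigr => y yb /=.
under eq_bigr do rewrite big_cons big_map.
rewrite big_split /=; congr (_ + _).
exact: (IH _ yb (fun s => h (Splitting (pcons (arrow y b) (split_left s)) (split_right s)))).
Qed.

(** The suspended degrees of the arrows telescope by [edge_deg]. Signs and degrees that depend on a
    chain thus become constants that can leave the sum. *)
Lemma sum_chains_sdeg a b (h : hpath V (vobj a) (vobj b) -> int -> U) :
  \sum_(P <- chains a b) h P (sdeg P) =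
  \sum_(P <- chains a b) h P (shift b - shift a).
Proof.
elim/rank_ind: b h => b IH h; rewrite [LHS]sum_chains [RHS]sum_chains.
congr (_ + _).
  rewrite /trivial_chain; case: eqP => [e|_]; rewrite ?big_nil // !big_seq1.
  by case: _ / e h => h; rewrite /= /sdeg !subrr.
apply: eq_bigr => x xb.
under eq_bigr do rewrite sdeg_pcons.
rewrite (IH _ xb (fun P d => h (pcons (arrow x b) P) (vdeg x b - 1 + d))).
by apply: eq_bigr => P _; congr h; rewrite edge_deg //; ring.
Qed.

End Sums.
End Chains.

Section ChainSum.
Variables (k : fieldType) (O O' : Type) (V : O -> O -> int -> lmodType k).
Variables (W : O' -> O' -> int -> lmodType k) (f : O -> O').

(** For [g = m] these are, up to suspension, the entries of the Maurer-Cartan sum; for [g = F] they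
    form the matrix $\Phi$ that twists the differential of the total complex. The empty chain is
    left out, there being no $m_0$ or $F_0$. *)
Definition chain_sum (g : operations V W f) (G : graph V) (a b : G) e
  : W (f (vobj a)) (f (vobj b)) e :=
  \sum_(P <- chains a b | (0 < plen P)%N) bar g P e.

End ChainSum.

Section ChainRelation.
Variables (k : fieldType) (O O' : Type) (V : O -> O -> int -> lmodType k).
Variables (W : O' -> O' -> int -> lmodType k) (f : O -> O').
Variables (m : operations V V id) (g : operations V W f).
Hypothesis g_lin : multilinear g.

(** Each chain is cut at the ends [x] and [y] of the inner operation; the sign then depends on [y]
    and [b] only and leaves the sums over chains. *)
Lemma chain_insertion (G : graph V) (kd : G -> G -> int)
  (kdE : forall x y, kd x y = shift y - shift x + 2) (a b : G) e :
  \sum_(P <- chains a b) sg k (psusp P) *: insertion_sum g m P e =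
  \sum_x \sum_y sg k (shift b - shift y) *:
    \sum_(R <- chains a x) \sum_(L <- chains y b)
      bar g (pcat L (pcons (chain_sum m x y (kd x y)) R)) e.
Proof.
under eq_bigr do rewrite bar_insertion //.
rewrite sum_chains_splits [RHS]exchange_big; apply: eq_bigr => y _ /=.
rewrite exchange_big (sum_chains_sdeg (fun L d => \sum_(R <- chains a y)
  \sum_(S <- splits R | (0 < plen (split_left S))%N) sg k d *: bar g (pcat L
     (pcons (bar m (split_left S) (sdeg (split_left S) + 2)) (split_right S))) e)).
under [RHS]eq_bigr do rewrite exchange_big scaler_sumr.
rewrite [RHS]exchange_big; apply: eq_bigr => L _ /=.
under eq_bigr do rewrite big_mkcond.
rewrite (sum_chains_splits (fun S => if (0 < plen (split_left S))%N then
  sg k (shift b - shift y) *: bar g (pcat L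
     (pcons (bar m (split_left S) (sdeg (split_left S) + 2)) (split_right S))) e
  else 0)).
apply: eq_bigr => x _; rewrite scaler_sumr; apply: eq_bigr => R _ /=.
rewrite (sum_chains_sdeg (fun M d => if (0 < plen M)%N then
  sg k (shift b - shift y) *: bar g (pcat L (pcons (bar m M (d + 2)) R)) e else 0)).
by rewrite -big_mkcond /= kdE /chain_sum bar_sum // scaler_sumr.
Qed.

End ChainRelation.

Lemma insertion_sum_nil (k : fieldType) (O O' : Type) (V : O -> O -> int -> lmodType k)
  (W : O' -> O' -> int -> lmodType k) f (g : operations V W f)
  (m : operations V V id) a c (P : hpath V a c) e :
  plen P = 0%N -> insertion_sum g m P e = 0.
Proof.
by case: P => // b _; rewrite /insertion_sum /= big_seq1 big_mkcond big_seq1.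
Qed.

Lemma sum_splits_nil (U : zmodType) (O : Type) (V : O -> O -> int -> Type) a c
  (P : mpath V a c) (h : splitting V a c -> U) : plen P = 0%N ->
  \sum_(s <- splits P | (0 < plen (split_left s))%N && (0 < plen (split_right s))%N)
    h s = 0.
Proof. by case: P h => // b h _; rewrite big_mkcond big_seq1. Qed.

(** * The functor equation with values in the dg category of resolutions *)

Section HomEvaluation.
Variables (k : fieldType) (B : kAlgebra k).

Lemma homB_sumE (X Y : rmodType B) (T : Type) (s : seq T) (P : pred T)
  (h : T -> homB X Y) x : (\sum_(i <- s | P i) h i) x = \sum_(i <- s | P i) h i x.
Proof. exact: (big_morph (fun h : homB X Y => h x)). Qed.

Lemma homBZE (X Y : rmodType B) c (h : homB X Y) x :
  (c *: h) x = (alg_map B c : B^c) *: h x.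
Proof. by []. Qed.

Variables (M N L : rmodType B) (I : injective_resolution M).
Variables (J : injective_resolution N) (K : injective_resolution L).

Lemma ghom_comp_linear_l p' p r (f : ghom I J p) :
  linear (fun g : ghom J K p' => ghom_comp g f r).
Proof.
move=> c g g'; rewrite /ghom_comp -linearP; congr (ghom_proj _ _).
apply: functional_extensionality_dep => t; apply: linear_eq => x.
rewrite homB_sumE -[RHS]/((alg_map B c : B^c) *: (\sum_(_ < _) _ : homB _ _) x +
  (\sum_(_ < _) _ : homB _ _) x) !homB_sumE scaler_sumr -big_split.
by apply: eq_bigr.
Qed.

Lemma ghom_comp_linear_r p' p r (g : ghom J K p') :
  linear (fun f : ghom I J p => ghom_comp g f r).
Proof.
move=> c f f'; rewrite /ghom_comp -linearP; congr (ghom_proj _ _).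
apply: functional_extensionality_dep => t; apply: linear_eq => x.
rewrite homB_sumE -[RHS]/((alg_map B c : B^c) *: (\sum_(_ < _) _ : homB _ _) x +
  (\sum_(_ < _) _ : homB _ _) x) !homB_sumE scaler_sumr -big_split.
by apply: eq_bigr => s _; rewrite /= linearD linearZ.
Qed.

Definition ghom_compl p' p r (f : ghom I J p) (g : ghom J K p') := ghom_comp g f r.
HB.instance Definition _ p' p r f := GRing.isLinear.Build k _ _ _
  (@ghom_compl p' p r f) (@ghom_comp_linear_l p' p r f).
Definition ghom_compr p' p r (g : ghom J K p') (f : ghom I J p) := ghom_comp g f r.
HB.instance Definition _ p' p r g := GRing.isLinear.Build k _ _ _
  (@ghom_compr p' p r g) (@ghom_comp_linear_r p' p r g).

Lemma ghom_comp_suml p' p r (f : ghom I J p) (T : Type) (s : seq T) (P : pred T)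
  (g : T -> ghom J K p') :
  ghom_comp (\sum_(i <- s | P i) g i) f r = \sum_(i <- s | P i) ghom_comp (g i) f r.
Proof. exact: (linear_sum (ghom_compl r f)). Qed.

Lemma ghom_comp_sumr p' p r (g : ghom J K p') (T : Type) (s : seq T) (P : pred T)
  (f : T -> ghom I J p) :
  ghom_comp g (\sum_(i <- s | P i) f i) r = \sum_(i <- s | P i) ghom_comp g (f i) r.
Proof. exact: (linear_sum (ghom_compr r g)). Qed.

Lemma ghom_compZl p' p r c (f : ghom I J p) (g : ghom J K p') :
  ghom_comp (c *: g) f r = c *: ghom_comp g f r.
Proof. exact: (linearZ_LR (ghom_compl r f)). Qed.

Lemma ghom_compZr p' p r c (f : ghom I J p) (g : ghom J K p') :
  ghom_comp g (c *: f) r = c *: ghom_comp g f r.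
Proof. exact: (linearZ_LR (ghom_compr r g)). Qed.

End HomEvaluation.

Section FunctorRelation.
Variables (k : fieldType) (B : kAlgebra k) (n : nat) (M : 'I_n -> rmodType B).
Variable I : forall i, injective_resolution (M i).
Variable V : 'I_n -> 'I_n -> int -> lmodType k.
Variable m : operations V V id.
Variable F : operations V (dg_hom I) id.
Hypothesis F_functor : is_ainf_functor m (@dg_op _ _ _ _ I) F.

Lemma dg_op_blocks3 a c (D : blocks (fun a b d => V a b d : Type) a c) e :
  (2 < nblocks D)%N -> dg_op (apply_blocks F D) e = 0.
Proof.
case: D => [//|? ? ? P1 D]; case: D P1 => [//|? ? ? P2 D] P1.
by case: D P2 => [//|? ? ? P3 D] P2.
Qed.

(** After suspension the only remaining sign is the parity of the degree [sdeg + 1] of the left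
    factor. The target contributes $m_1$ and $m_2$ alone. *)
Lemma functor_bar a c (P : hpath V a c) e : (0 < plen P)%N ->
  sg k (psusp P) *: insertion_sum F m P e =
  ghom_diff e (bar F P (sdeg P + 1)) +
  \sum_(s <- splits P | (0 < plen (split_left s))%N && (0 < plen (split_right s))%N)
    sg k (sdeg (split_left s) + 1) *:
    ghom_comp (bar F (split_left s) (sdeg (split_left s) + 1))
      (bar F (split_right s) (sdeg (split_right s) + 1)) e.
Proof.
case: F_functor => F_lin F_deg F_rel P0.
rewrite F_rel // sum_decompositions //; last first.
  by move=> D D3; rewrite dg_op_blocks3 ?scaler0.
have E a' b' (Q : hpath V a' b') : pdeg Q + 1 - (plen Q)%:Z = sdeg Q + 1.
  by rewrite /sdeg; ring.
rewrite scalerDr; congr (_ + _).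
  by rewrite /= E mul0r mulr0 !addr0 sg0 scale1r /bar [RHS]linearZ.
rewrite scaler_sumr [LHS]big_mkcond [RHS]big_mkcond.
pose H (Q : hpath V a c) (s : splitting (fun a b d => V a b d : Type) a c) :=
 if (0 < plen (split_left s))%N && (0 < plen (split_right s))%N then
  sg k (psusp Q) *: (sg k (bsign (bcons (split_left s) (bcons (split_right s) (bnil a))))
   *: ghom_comp
        (F (split_left s) (pdeg (split_left s) + 1 - (plen (split_left s))%:Z))
        (F (split_right s) (pdeg (split_right s) + 1 - (plen (split_right s))%:Z)) e)
  else 0.
transitivity (\sum_(s <- splits P) H P s).
  by [].
rewrite -sum_splits_pcat; apply: eq_bigr => -[b Q R] _; rewrite /H /=.
case: ifP => // _; rewrite !E /bar.
rewrite ghom_compZl ghom_compZr !scalerA -!sgD; congr (_ *: _).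
(* Again half of the difference of the two exponents. *)
rewrite psusp_pcat; apply: (@sg_mod2 _ _ _ ((plen Q)%:Z - 1 - pdeg Q + (plen R)%:Z * pdeg Q)).
by rewrite /sdeg; ring.
Qed.

(** Up to signs the right side is $d\Phi+\Phi\Phi$ with $\Phi$ the matrix [chain_sum F]. The left
    side collects the insertions of Maurer-Cartan sums, hence vanishes for a graph that satisfies
    the Maurer-Cartan equation. *)
Lemma functor_chains (G : graph V) (kd pd : G -> G -> int)
  (kdE : forall x y, kd x y = shift y - shift x + 2)
  (pdE : forall x y, pd x y = shift y - shift x + 1) (a b : G) e :
  \sum_x \sum_y sg k (shift b - shift y) *:
    \sum_(R <- chains a x) \sum_(L <- chains y b)
      bar F (pcat L (pcons (chain_sum m x y (kd x y)) R)) e =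
  ghom_diff e (chain_sum F a b (pd a b)) +
  \sum_x sg k (pd x b) *:
    ghom_comp (chain_sum F x b (pd x b)) (chain_sum F a x (pd a x)) e.
Proof.
case: (F_functor) => F_lin F_deg F_rel.
rewrite -chain_insertion //.
pose H (s : splitting (fun a b d => V a b d : Type) (vobj a) (vobj b)) :=
  if (0 < plen (split_left s))%N && (0 < plen (split_right s))%N then
    sg k (sdeg (split_left s) + 1) *:
    ghom_comp (bar F (split_left s) (sdeg (split_left s) + 1))
      (bar F (split_right s) (sdeg (split_right s) + 1)) e else 0.
transitivity (\sum_(P <- chains a b) ((if (0 < plen P)%N then
   ghom_diff e (bar F P (sdeg P + 1)) else 0) + \sum_(s <- splits P) H s)).
  apply: eq_bigr => P _; case: ifP => [P0|/negbT]; first by rewrite functor_bar // [in LHS]big_mkcond.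
  rewrite -eqn0Ngt => /eqP P0; rewrite -big_mkcond /= add0r.
  by rewrite (insertion_sum_nil _ _ _ P0) scaler0 (sum_splits_nil _ P0).
rewrite big_split; congr (_ + _).
  rewrite (sum_chains_sdeg (fun P d => if (0 < plen P)%N then
    ghom_diff e (bar F P (d + 1)) else 0)) -big_mkcond.
  by rewrite /= -linear_sum -pdE.
rewrite (sum_chains_splits H); apply: eq_bigr => x _.
under eq_bigr do rewrite /H /= (sum_chains_sdeg (fun L d => if (0 < plen L)%N && _
  then sg k (d + 1) *: ghom_comp (bar F L (d + 1)) (bar F _ (sdeg _ + 1)) e else 0)) -pdE.
rewrite (sum_chains_sdeg (fun R d => \sum_(L <- chains x b)
  if (0 < plen L)%N && (0 < plen R)%N
  then sg k (pd x b) *: ghom_comp (bar F L (pd x b)) (bar F R (d + 1)) e else 0)) -pdE.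
rewrite exchange_big /chain_sum /= ghom_comp_suml scaler_sumr [RHS]big_mkcond.
apply: eq_bigr => L _; case: ifP => L0; last by rewrite big1.
by rewrite ghom_comp_sumr scaler_sumr [RHS]big_mkcond.
Qed.

End FunctorRelation.

(** * Twisted morphisms as graphs *)

Section SumGraph.
Variables (k : fieldType) (O : Type) (V : O -> O -> int -> lmodType k).
Variables (G1 G2 : graph V) (s : int) (ed : G1 -> G2 -> int).
Variable E : forall a b, V (vobj a) (vobj b) (ed a b).
Hypothesis edE : forall a b, ed a b = 1 + s + shift b - shift a.

Definition sum_vobj (a : G1 + G2) : O :=
  match a with inl a => vobj a | inr a => vobj a end.

Definition sum_vdeg (a b : G1 + G2) : int :=
  match a, b with
  | inl a, inl b => vdeg a b | inr a, inr b => vdeg a b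
  | inl a, inr b => ed a b | inr _, inl _ => 0 end.

Definition sum_arrow (a b : G1 + G2) : V (sum_vobj a) (sum_vobj b) (sum_vdeg a b) :=
  match a, b with
  | inl a, inl b => arrow a b | inr a, inr b => arrow a b
  | inl a, inr b => E a b | inr _, inl _ => 0 end.

Definition sum_edge (a b : G1 + G2) : bool :=
  match a, b with
  | inl a, inl b => edge a b | inr a, inr b => edge a b
  | inl _, inr _ => true | inr _, inl _ => false end.

(** All of [G2] is placed above [G1], so that crossing arrows raise the rank. *)
Definition sum_rank (a : G1 + G2) : nat :=
  match a with inl a => rank a | inr a => (\max_(x : G1) rank x).+1 + rank a end.

Definition sum_shift (a : G1 + G2) : int :=
  match a with inl a => shift a | inr a => s + shift a end.

Fact sum_edge_rank a b : sum_edge a b -> (sum_rank a < sum_rank b)%N.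
Proof.
case: a b => a [b|b] //=; try exact: edge_rank.
- by move=> _; rewrite addSn ltnS (leq_trans _ (leq_addr _ _)) // leq_bigmax.
- by move=> /edge_rank ab; rewrite ltn_add2l.
Qed.

Fact sum_edge_deg a b : sum_edge a b -> sum_vdeg a b = 1 + sum_shift b - sum_shift a.
Proof.
by case: a b => a [b|b] //= ab; rewrite ?edE ?(edge_deg ab) //; ring.
Qed.

(** The offset [s] on the shifts of [G2] absorbs the degree of the crossing arrows: for a family of
    constant degree $p$ between unshifted graphs it is $p-1$. *)
Definition sum_graph : graph V :=
  @Graph _ _ _ (G1 + G2)%type sum_vobj sum_vdeg sum_arrow sum_edge sum_rank
    sum_shift sum_edge_rank sum_edge_deg.

Let inG1 (a : G1) : sum_graph := inl a.
Let inG2 (a : G2) : sum_graph := inr a.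

Lemma sum_chains_ll (U : zmodType) (a b : G1) (h : hpath V (vobj a) (vobj b) -> U) :
  \sum_(P <- chains (inG1 a) (inG1 b)) h P = \sum_(P <- chains a b) h P.
Proof.
elim/rank_ind: b h => b IH h; rewrite [LHS]sum_chains [RHS]sum_chains.
congr (_ + _).
  congr bigop; have [e|ab] := eqVneq a b; last by rewrite !trivial_chain_neq.
  by case: _ / e {IH h}; rewrite !trivial_chain_refl.
rewrite big_sumType /= [X in _ + X]big_pred0 // addr0.
by apply: eq_bigr => x xb; rewrite -IH.
Qed.

Lemma chains_rl (a : G2) (b : G1) : chains (inG2 a) (inG1 b) = [::].
Proof.
(* An empty list is recognised by its sums: the constant 1 in [int] adds up to the length. *)
suff : forall U (h : _ -> U : zmodType), \sum_(P <- chains (inG2 a) (inG1 b)) h P = 0.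
  move=> /(_ int (fun=> 1)); case: (chains _ _) => // P Q; rewrite big_const_seq count_predT /=.
  by rewrite iter_addr_0 => /eqP; rewrite -mulrS pnatr_eq0.
move=> U; elim/rank_ind: b => b IH h; rewrite sum_chains trivial_chain_neq //.
rewrite big_nil add0r big_sumType /= [X in _ + X]big_pred0 // addr0.
by rewrite big1 // => x xb; apply: IH.
Qed.

Lemma sum_chains_rr (U : zmodType) (a b : G2) (h : hpath V (vobj a) (vobj b) -> U) :
  \sum_(P <- chains (inG2 a) (inG2 b)) h P = \sum_(P <- chains a b) h P.
Proof.
elim/rank_ind: b h => b IH h; rewrite [LHS]sum_chains [RHS]sum_chains.
congr (_ + _).
  congr bigop; have [e|ab] := eqVneq a b; last by rewrite !trivial_chain_neq.
  by case: _ / e {IH h}; rewrite !trivial_chain_refl.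
rewrite big_sumType /= [X in X + _]big1 ?add0r => [|x _].
  by apply: eq_bigr => x xb; rewrite -IH.
by rewrite chains_rl big_nil.
Qed.

(** No edge leads back from [G2] to [G1], so such a chain crosses exactly once, along some
    [E x y]. *)
Lemma sum_chains_lr (U : zmodType) (a : G1) (b : G2)
  (h : hpath V (vobj a) (vobj b) -> U) :
  \sum_(P <- chains (inG1 a) (inG2 b)) h P =
  \sum_x \sum_y \sum_(R <- chains a x) \sum_(L <- chains y b)
    h (pcat L (pcons (E x y) R)).
Proof.
elim/rank_ind: b h => b IH h; rewrite [LHS]sum_chains trivial_chain_neq // big_nil add0r.
rewrite big_sumType /=.
transitivity (\sum_x (\sum_(R <- chains a x) h (pcons (E x b) R) +
   \sum_(z | edge z b) \sum_y \sum_(R <- chains a x) \sum_(L <- chains y z)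
     h (pcons (arrow z b) (pcat L (pcons (E x y) R))))).
  rewrite [RHS]big_split /=; congr (_ + _).
    by apply: eq_bigr => x _; rewrite sum_chains_ll.
  rewrite [RHS]exchange_big; apply: eq_bigr => z zb /=.
  exact: (IH _ zb (fun P => h (pcons (arrow z b) P))).
apply: eq_bigr => x _; rewrite [RHS]exchange_big /=.
under [X in _ + X]eq_bigr do rewrite exchange_big.
rewrite [X in _ + X]exchange_big -big_split; apply: eq_bigr => R _ /=.
under [RHS]eq_bigr do rewrite sum_chains.
rewrite [RHS]big_split /= (sum_trivial_chain_l (fun y L => h (pcat L (pcons (E x y) R)))).
by congr (_ + _); rewrite exchange_big.
Qed.

End SumGraph.

Lemma bar_graded (k : fieldType) (O O' : Type) (V : O -> O -> int -> lmodType k)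
  (W : O' -> O' -> int -> lmodType k) f (g : operations V W f) d :
  graded_of_degree g d ->
  forall a b (P : hpath V a b) e, e != sdeg P + d -> bar g P e = 0.
Proof.
by move=> g_deg a b P e eP; rewrite /bar g_deg ?scaler0 // addrAC.
Qed.

Lemma chain_sum_graded (k : fieldType) (O O' : Type) (V : O -> O -> int -> lmodType k)
  (W : O' -> O' -> int -> lmodType k) f (g : operations V W f) d (G : graph V) :
  graded_of_degree g d ->
  forall (a b : G) e, e != shift b - shift a + d -> chain_sum g a b e = 0.
Proof.
move=> g_deg a b e eab; rewrite /chain_sum.
transitivity (\sum_(P <- chains a b)
    if (0 < plen P)%N && (e == sdeg P + d) then bar g P e else 0).
  rewrite big_mkcond; apply: eq_bigr => P _; case: ltnP => //= _.
  by case: eqVneq => // eP; rewrite (bar_graded g_deg).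
rewrite (sum_chains_sdeg (fun P c =>
  if (0 < plen P)%N && (e == c + d) then bar g P e else 0)).
by rewrite big1 // => P _; rewrite (negPf eab) andbF.
Qed.

Section Sandwich.
Variables (k : fieldType) (O O' : Type) (V : O -> O -> int -> lmodType k).
Variables (W : O' -> O' -> int -> lmodType k) (f : O -> O').

(* The sum of all insertions of [E] between chains of [G1] and of [G2]: the
   differential of twisted morphisms and the action of a functor on them. *)
Definition sandwich (g : operations V W f) (G1 G2 : graph V) (ed : G1 -> G2 -> int)
  (E : forall a b, V (vobj a) (vobj b) (ed a b)) (a : G1) (b : G2) e
  : W (f (vobj a)) (f (vobj b)) e :=
  \sum_x \sum_y \sum_(R <- chains a x) \sum_(L <- chains y b)
    bar g (pcat L (pcons (E x y) R)) e.

Variable g : operations V W f.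

Section Sum.
Variables (G1 G2 : graph V) (s : int) (ed : G1 -> G2 -> int).
Variable E : forall a b, V (vobj a) (vobj b) (ed a b).
Hypothesis edE : forall a b, ed a b = 1 + s + shift b - shift a.
Let G := sum_graph E edE.

Lemma chain_sum_ll (a b : G1) e :
  chain_sum g (inl a : G) (inl b : G) e = chain_sum g a b e.
Proof.
rewrite /chain_sum big_mkcond [RHS]big_mkcond.
pose h (P : hpath V (vobj a) (vobj b)) := if (0 < plen P)%N then bar g P e else 0.
exact: (sum_chains_ll E edE h).
Qed.

Lemma chain_sum_rl (a : G2) (b : G1) e :
  chain_sum g (inr a : G) (inl b : G) e = 0.
Proof. by rewrite /chain_sum chains_rl big_nil. Qed.

Lemma chain_sum_rr (a b : G2) e :
  chain_sum g (inr a : G) (inr b : G) e = chain_sum g a b e.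
Proof.
rewrite /chain_sum big_mkcond [RHS]big_mkcond.
pose h (P : hpath V (vobj a) (vobj b)) := if (0 < plen P)%N then bar g P e else 0.
exact: (sum_chains_rr E edE h).
Qed.

Lemma chain_sum_lr (a : G1) (b : G2) e :
  chain_sum g (inl a : G) (inr b : G) e = sandwich g E a b e.
Proof.
rewrite /chain_sum big_mkcond.
pose h (P : hpath V (vobj a) (vobj b)) := if (0 < plen P)%N then bar g P e else 0.
apply: etrans (sum_chains_lr E edE h) _; rewrite /h.
do 4 (apply: eq_bigr => ? _).
by rewrite plen_pcat /= addnS.
Qed.

Lemma sandwich_graded d : graded_of_degree g d ->
  forall (a : G1) (b : G2) e, e != s + shift b - shift a + d -> sandwich g E a b e = 0.
Proof.
move=> g_deg a b e eab; rewrite -chain_sum_lr.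
exact: (chain_sum_graded g_deg (G := G) (a := inl a) (b := inr b)).

Qed.

End Sum.

Hypothesis g_lin : multilinear g.

Lemma sandwich_linear (G1 G2 : graph V) (ed : G1 -> G2 -> int) (l : k)
  (E E' : forall a b, V (vobj a) (vobj b) (ed a b)) (a : G1) (b : G2) e :
  sandwich g (fun x y => l *: E x y + E' x y) a b e =
  l *: sandwich g E a b e + sandwich g E' a b e.
Proof.
rewrite /sandwich; do 4 (rewrite scaler_sumr -big_split; apply: eq_bigr => ? _ /=).
exact: bar_linear.
Qed.

Lemma eq_sandwich (G1 G2 : graph V) (ed : G1 -> G2 -> int)
  (E E' : forall a b, V (vobj a) (vobj b) (ed a b)) (a : G1) (b : G2) e :
  (forall x y, E x y = E' x y) -> sandwich g E a b e = sandwich g E' a b e.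
Proof. by move=> EE; do 4 (apply: eq_bigr => ? _); rewrite EE. Qed.

Lemma sandwich0 (G1 G2 : graph V) (ed : G1 -> G2 -> int)
  (E : forall a b, V (vobj a) (vobj b) (ed a b)) (a : G1) (b : G2) e :
  (forall x y, E x y = 0) -> sandwich g E a b e = 0.
Proof. by rewrite /sandwich => E0; do 4 (rewrite big1 // => ? _); rewrite E0 bar0. Qed.

End Sandwich.

Section SandwichRelation.
Variables (k : fieldType) (O O' : Type) (V : O -> O -> int -> lmodType k).
Variables (W : O' -> O' -> int -> lmodType k) (f : O -> O').
Variables (m : operations V V id) (g : operations V W f).
Hypothesis g_lin : multilinear g.

(** This is the Maurer-Cartan equation. Quantifying over all [e] costs nothing: for a graded [m] the
    sum vanishes outside the expected degree by [chain_sum_graded]. *)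
Definition flat (G : graph V) := forall (a b : G) e, chain_sum m a b e = 0.

(** An insertion of [m] into a chain from [G1] to [G2] either stays on one side, where flatness
    kills it, or swallows the crossing arrow. *)
Lemma sandwich_sum (G1 G2 : graph V) (s : int) (ed : G1 -> G2 -> int)
  (E : forall a b, V (vobj a) (vobj b) (ed a b))
  (edE : forall a b, ed a b = 1 + s + shift b - shift a)
  (kd : sum_graph E edE -> sum_graph E edE -> int) (a : G1) (b : G2) e :
  flat G1 -> flat G2 ->
  \sum_x \sum_y sg k (shift (inr b : sum_graph E edE) - shift y) *:
    \sum_(R <- chains (inl a : sum_graph E edE) x)
      \sum_(L <- chains y (inr b : sum_graph E edE))
      bar g (pcat L (pcons (chain_sum m x y (kd x y)) R)) e =
  \sum_y sg k (shift b - shift y) *: \sum_x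
    \sum_(R <- chains a x) \sum_(L <- chains y b)
      bar g (pcat L (pcons (sandwich m E x y (kd (inl x) (inr y))) R)) e.
Proof.
move=> flat1 flat2.
rewrite big_sumType /= [X in _ + X]big1 => [|x _]; last first.
  rewrite big_sumType /= !big1 ?addr0 // => y _; rewrite ?big1 ?scaler0 // => R _;
  rewrite big1 // => L _; rewrite (chain_sum_rl, chain_sum_rr) ?flat2 bar0 //.
rewrite addr0; under [RHS]eq_bigr do rewrite scaler_sumr.
rewrite [RHS]exchange_big; apply: eq_bigr => x _.
rewrite big_sumType /= [X in X + _]big1 ?add0r => [|y _].
  apply: eq_bigr => y _.
  have -> : s + shift b - (s + shift y) = shift b - shift y by ring.
  congr (_ *: _); rewrite sum_chains_ll.
  apply: eq_bigr => R _; rewrite sum_chains_rr.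
  by apply: eq_bigr => L _; rewrite chain_sum_lr.
rewrite ?big1 ?scaler0 // => R _; rewrite big1 // => L _.
by rewrite chain_sum_ll flat1 bar0.
Qed.

End SandwichRelation.

Section TwoObjects.
Variables (k : fieldType) (O : Type) (V : O -> O -> int -> lmodType k).
Variables (m : operations V V id).
Variables (G1 G2 : graph V) (s : int) (ed kd : G1 -> G2 -> int).
Variable E : forall a b, V (vobj a) (vobj b) (ed a b).
Hypothesis edE : forall a b, ed a b = 1 + s + shift b - shift a.
Hypothesis kdE : forall a b, kd a b = ed a b + 1.
Hypotheses (flat1 : flat m G1) (flat2 : flat m G2).
Let G := sum_graph E edE.

(** On crossing pairs the degree is the prescribed [kd], so that the inner sandwich can serve as a
    family of arrows for the outer one. *)
Definition sum_kd (x y : G) : int :=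
  match x, y with inl a, inr b => kd a b | _, _ => shift y - shift x + 2 end.

Fact sum_kdE x y : sum_kd x y = shift y - shift x + 2.
Proof. by case: x y => x [y|y] //=; rewrite kdE edE; ring. Qed.

(** The new entries of the Maurer-Cartan sum are the twisted differential of [E]. Gluing along a
    cocycle serves twice: for compositions of cocycles and for extensions of modules. *)
Lemma flat_sum_graph :
  (forall a b e, sandwich m E a b e = 0) -> flat m G.
Proof.
move=> E0 [a|a] [b|b] e; first by rewrite chain_sum_ll flat1.
- by rewrite chain_sum_lr E0.
- by rewrite chain_sum_rl.
- by rewrite chain_sum_rr flat2.
Qed.

Hypothesis shift2 : forall y : G2, shift y = 0.

Lemma sandwich_insertion (O' : Type) (W : O' -> O' -> int -> lmodType k)
  (f : O -> O') (g : operations V W f) (a : G1) (b : G2) e : multilinear g ->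
  \sum_(P <- chains (inl a : G) (inr b : G)) sg k (psusp P) *: insertion_sum g m P e =
  sandwich g (fun x y => sandwich m E x y (kd x y)) a b e.
Proof.
move=> g_lin; rewrite (chain_insertion _ g_lin sum_kdE) sandwich_sum //.
under eq_bigr => y _ do rewrite !shift2 subrr sg0 scale1r.
by rewrite exchange_big.
Qed.

(** This is $b_1b_1=0$ for twisted morphisms, read off from the $A_\infty$ relations of all chains
    that cross the sum graph. *)
Lemma sandwich_twice a b e : multilinear m ->
  (forall a c (P : hpath V a c) e, insertion_sum m m P e = 0) ->
  sandwich m (fun x y => sandwich m E x y (kd x y)) a b e = 0.
Proof.
move=> m_lin m_rel; rewrite -sandwich_insertion //.
by rewrite big1 // => P _; rewrite m_rel scaler0.
Qed.

End TwoObjects.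

Section FunctorOnGraphs.
Variables (k : fieldType) (B : kAlgebra k) (n : nat) (M : 'I_n -> rmodType B).
Variable I : forall i, injective_resolution (M i).
Variable V : 'I_n -> 'I_n -> int -> lmodType k.
Variable m : operations V V id.
Variable F : operations V (dg_hom I) id.
Hypothesis F_functor : is_ainf_functor m (@dg_op _ _ _ _ I) F.

(** Flatness removes the left side of [functor_chains]. What remains, $d\Phi=\Phi\Phi$ with $d$ the
    differential of the Hom complexes, is the reason why the total differential squares to zero. *)
Lemma chain_sum_diff (G : graph V) (a b : G) :
  flat m G -> (forall x : G, shift x = 0) ->
  ghom_diff 2 (chain_sum F a b 1) =
  \sum_x ghom_comp (chain_sum F x b 1) (chain_sum F a x 1) 2.
Proof.
move=> flatG shift0; have [F_lin _ _] := F_functor.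
have kdE (x y : G) : 2 = shift y - shift x + 2 by rewrite !shift0.
have pdE (x y : G) : 1 = shift y - shift x + 1 by rewrite !shift0.
have := functor_chains F_functor kdE pdE a b 2.
rewrite big1 => [|x _]; last first.
  rewrite big1 // => y _; rewrite big1 ?scaler0 // => R _.
  by rewrite big1 // => L _; rewrite flatG bar0.
move/esym/eqP; rewrite addr_eq0 => /eqP ->; rewrite -sumrN.
by apply: eq_bigr => x _; rewrite sg1 scaleN1r opprK.
Qed.

Section Two.
Variables (G1 G2 : graph V) (s : int) (ed kd : G1 -> G2 -> int).
Variable pd : G1 -> G1 -> int.
Variable E : forall a b, V (vobj a) (vobj b) (ed a b).
Hypothesis edE : forall a b, ed a b = 1 + s + shift b - shift a.
Hypothesis kdE : forall a b, kd a b = ed a b + 1.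
Hypothesis pdE : forall x y, pd x y = shift y - shift x + 1.
Hypotheses (flat1 : flat m G1) (flat2 : flat m G2).
Hypothesis shift2 : forall y : G2, shift y = 0.

(** The functor equation across the sum graph. Its right side has the shape of [entry_diff], the
    differential of the Hom complex between total complexes, so this is the chain map property
    written entry by entry. *)
Lemma functor_sandwich (a : G1) (b : G2) e :
  sandwich F (fun x y => sandwich m E x y (kd x y)) a b e =
  ghom_diff e (sandwich F E a b (ed a b)) +
  (\sum_x sg k (ed x b) *:
     ghom_comp (sandwich F E x b (ed x b)) (chain_sum F a x (pd a x)) e -
   \sum_x ghom_comp (chain_sum F x b 1) (sandwich F E a x (ed a x)) e).
Proof.
have [F_lin _ _] := F_functor.
pose G := sum_graph E edE.
pose spd (x y : G) : int := match x, y with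
  | inl a, inl b => pd a b | inl a, inr b => ed a b | inr _, inr _ => 1
  | _, _ => shift y - shift x + 1 end.
have spdE x y : spd x y = shift y - shift x + 1.
  by case: x y => x [y|y] //=; rewrite ?edE ?shift2 //; ring.
rewrite -(sandwich_insertion E edE kdE flat1 flat2 shift2) //.
rewrite (chain_insertion _ F_lin (sum_kdE kdE)).
rewrite (functor_chains F_functor (sum_kdE kdE) spdE).
rewrite /= chain_sum_lr; congr (_ + _).
rewrite big_sumType /=; congr (_ + _).
  by apply: eq_bigr => x _; rewrite chain_sum_lr chain_sum_ll.
rewrite -sumrN; apply: eq_bigr => x _.
by rewrite sg1 scaleN1r chain_sum_lr chain_sum_rr.
Qed.

End Two.
End FunctorOnGraphs.

(** * Three twisted objects and the composition of cocycles *)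

Section SumGraphEnds.
Variables (k : fieldType) (O O' : Type) (V : O -> O -> int -> lmodType k).
Variables (W : O' -> O' -> int -> lmodType k) (f : O -> O').
Variables (g : operations V W f) (g_lin : multilinear g).
Variables (G1 G2 G3 : graph V) (s : int) (ed : G1 -> G2 -> int).
Variable E : forall a b, V (vobj a) (vobj b) (ed a b).
Hypothesis edE : forall a b, ed a b = 1 + s + shift b - shift a.
Let G := sum_graph E edE.
Variables (kd : G -> G3 -> int) (K : forall x c, V (vobj x) (vobj c) (kd x c)).

Lemma sandwich_inl (a : G1) (c : G3) e : (forall x c, K (inr x) c = 0) ->
  sandwich g K (inl a : G) c e = sandwich g (fun x c => K (inl x) c) a c e.
Proof.
move=> K0; rewrite /sandwich big_sumType /= [X in _ + X]big1 ?addr0 => [|x _].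
  apply: eq_bigr => x _; apply: eq_bigr => y _.
  by rewrite sum_chains_ll.
by do 3 (rewrite big1 // => ? _); rewrite K0 bar0.
Qed.

Lemma sandwich_inr (b : G2) (c : G3) e :
  sandwich g K (inr b : G) c e = sandwich g (fun x c => K (inr x) c) b c e.
Proof.
rewrite /sandwich big_sumType /= [X in X + _]big1 ?add0r => [|x _].
  apply: eq_bigr => x _; apply: eq_bigr => y _.
  by rewrite sum_chains_rr.
by rewrite big1 // => y _; rewrite chains_rl big_nil.
Qed.

End SumGraphEnds.

Section ThreeObjects.
Variables (k : fieldType) (O : Type) (V : O -> O -> int -> lmodType k).
Variables (m : operations V V id).
Hypotheses (m_lin : multilinear m) (m_deg : graded_of_degree m 2).
Variables (G1 G2 G3 : graph V).
Hypotheses (flat1 : flat m G1) (flat2 : flat m G2) (flat3 : flat m G3).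
Hypotheses (shift1 : forall a : G1, shift a = 0) (shift2 : forall a : G2, shift a = 0).
Hypothesis shift3 : forall a : G3, shift a = 0.
Variables (y : forall (a : G1) (b : G2), V (vobj a) (vobj b) 0).
Variables (z : forall (b : G2) (c : G3), V (vobj b) (vobj c) 0).
Hypotheses (y_cocycle : forall a b, sandwich m y a b 1 = 0).
Hypotheses (z_cocycle : forall b c, sandwich m z b c 1 = 0).

Fact pair_deg (a : G1) (b : G2) : 0 = 1 + (-1) + shift b - shift a.
Proof. by rewrite shift1 shift2. Qed.

Definition pair_graph := sum_graph y pair_deg.

(** No arrows from [G1] to [G3] are wanted, but the offsets $-1$ of [G2] and $-2$ of [G3] force
    their degree $1-2=-1$; [pair_arrow] fills in zeros there. *)
Definition pair_ed (x : pair_graph) (c : G3) : int :=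
  match x with inl _ => -1 | inr _ => 0 end.

Definition pair_arrow (x : pair_graph) (c : G3) : V (vobj x) (vobj c) (pair_ed x c) :=
  match x with inl _ => 0 | inr b => z b c end.

Fact pair_edE x c : pair_ed x c = 1 + (-2%:Z) + shift c - shift x.
Proof. by case: x => x /=; rewrite ?shift1 ?shift2 shift3. Qed.

(** For [g = m] this is the twisted composition of [z] and [y]; for [g = F] it is the homotopy
    between the image of the composite and the composite of the images. *)
Definition pair_sandwich (O' : Type) (W : O' -> O' -> int -> lmodType k)
  (f : O -> O') (g : operations V W f) (a : G1) (c : G3) e
  : W (f (vobj a)) (f (vobj c)) e :=
  sandwich g pair_arrow (inl a : pair_graph) c e.

Lemma pair_sandwichE (O' : Type) (W : O' -> O' -> int -> lmodType k)
  (f : O -> O') (g : operations V W f) (a : G1) (c : G3) e : multilinear g ->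
  pair_sandwich g a c e =
  \sum_b \sum_c' \sum_x \sum_b' \sum_(R <- chains a x) \sum_(Q <- chains b' b)
    \sum_(L <- chains c' c)
      bar g (pcat L (pcons (z b c') (pcat Q (pcons (y x b') R)))) e.
Proof.
move=> g_lin; rewrite /pair_sandwich /sandwich big_sumType /=.
rewrite [X in X + _]big1 ?add0r => [|x _]; last first.
  by do 3 (rewrite big1 // => ? _); rewrite bar0.
apply: eq_bigr => b _; apply: eq_bigr => c' _.
by rewrite sum_chains_lr.
Qed.

Lemma flat_pair_graph : flat m pair_graph.
Proof.
apply: flat_sum_graph => // a b e.
have [->|e1] := eqVneq e 1; first exact: y_cocycle.
by apply: (sandwich_graded _ pair_deg m_deg); rewrite shift1 shift2.
Qed.

Definition pair_kd (x : pair_graph) (c : G3) : int :=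
  match x with inl _ => 0 | inr _ => 1 end.

Fact pair_kdE x c : pair_kd x c = pair_ed x c + 1.
Proof. by case: x. Qed.

Let K (x : pair_graph) (c : G3) := sandwich m pair_arrow x c (pair_kd x c).

Let sandwich_pair_inl (O' : Type) (W : O' -> O' -> int -> lmodType k)
  (f : O -> O') (g : operations V W f) (a : G1) (c : G3) e : multilinear g ->
  sandwich g K (inl a : pair_graph) c e =
  sandwich g (fun a c => pair_sandwich m a c 0) a c e.
Proof.
by move=> g_lin; apply: sandwich_inl => // b c'; rewrite /K sandwich_inr z_cocycle.
Qed.

(** Apply $b_1b_1=0$ to [pair_arrow] on the graph glued along [y]. As [z] is a cocycle, the inner
    differential lives only between [G1] and [G3], where it is the composite. *)
Lemma pair_sandwich_cocycle a c e :
  (forall a c (P : hpath V a c) e, insertion_sum m m P e = 0) ->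
  sandwich m (fun a c => pair_sandwich m a c 0) a c e = 0.
Proof.
move=> m_rel; rewrite -sandwich_pair_inl //.
exact: (sandwich_twice pair_arrow pair_edE pair_kdE flat_pair_graph flat3 shift3 (inl a) c e m_lin m_rel).
Qed.

End ThreeObjects.

Section FunctorThree.
Variables (k : fieldType) (B : kAlgebra k) (n : nat) (M : 'I_n -> rmodType B).
Variable I : forall i, injective_resolution (M i).
Variable V : 'I_n -> 'I_n -> int -> lmodType k.
Variable m : operations V V id.
Hypotheses (m_lin : multilinear m) (m_deg : graded_of_degree m 2).
Variable F : operations V (dg_hom I) id.
Hypothesis F_functor : is_ainf_functor m (@dg_op _ _ _ _ I) F.
Variables (G1 G2 G3 : graph V).
Hypotheses (flat1 : flat m G1) (flat2 : flat m G2) (flat3 : flat m G3).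
Hypotheses (shift1 : forall a : G1, shift a = 0) (shift2 : forall a : G2, shift a = 0).
Hypothesis shift3 : forall a : G3, shift a = 0.
Variables (y : forall (a : G1) (b : G2), V (vobj a) (vobj b) 0).
Variables (z : forall (b : G2) (c : G3), V (vobj b) (vobj c) 0).
Hypotheses (y_cocycle : forall a b, sandwich m y a b 1 = 0).
Hypotheses (z_cocycle : forall b c, sandwich m z b c 1 = 0).

Let pair := pair_sandwich shift1 shift2 y z.

(** This is the chain map property of [pair_arrow] on the glued graph. The product of the images of
    [z] and [y] appears because the part of $\Phi$ that crosses from [G1] to [G2] is the image of
    [y]. *)
Lemma functor_pair_sandwich (a : G1) (c : G3) :
  sandwich F (fun a c => pair m a c 0) a c 0 =
  ghom_diff 0 (pair F a c (-1)) -
  \sum_x ghom_comp (pair F x c (-1)) (chain_sum F a x 1) 0 +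
  \sum_x ghom_comp (sandwich F z x c 0) (sandwich F y a x 0) 0 -
  \sum_x ghom_comp (chain_sum F x c 1) (pair F a x (-1)) 0.
Proof.
have [F_lin _ _] := F_functor.
pose G := pair_graph shift1 shift2 y.
pose pd (x x' : G) : int := match x, x' with
  inl _, inl _ => 1 | inl _, inr _ => 0 | inr _, inr _ => 1 | inr _, inl _ => 2 end.
have pdE x x' : pd x x' = shift x' - shift x + 1.
  by case: x x' => x [x'|x'] /=; rewrite ?shift1 ?shift2.
have flatG : flat m G by apply: flat_pair_graph.
have := functor_sandwich F_functor (pair_arrow (y := y) z)
  (@pair_edE _ _ _ G1 G2 G3 shift1 shift2 shift3 y)
  (@pair_kdE _ _ _ G1 G2 G3 shift1 shift2 y) pdE flatG flat3 shift3 (inl a) c 0.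
rewrite sandwich_inl // => [->|b c']; last by rewrite sandwich_inr z_cocycle.
rewrite /= big_sumType /= -!addrA; congr (_ + (_ + (_ + _))).
  by rewrite -sumrN; apply: eq_bigr => x _; rewrite sgN1 scaleN1r chain_sum_ll.
by apply: eq_bigr => x _; rewrite sg0 scale1r chain_sum_lr sandwich_inr.
Qed.

End FunctorThree.

(** * Graphs of twisted objects *)

Section Entries.
Variables (k : fieldType) (O : Type) (V : O -> O -> int -> lmodType k).
Variable U : zmodType.

(** Matrix products run over all sequences of indices, chains only over edges. Both sums agree for
    summands that vanish as soon as one entry is zero. *)
Definition vanishing a b (h : hpath V a b -> U) :=
  forall x y d (L : hpath V y b) (R : hpath V a x),
    h (pcat L (pcons (0 : V x y d) R)) = 0.

Lemma vanishing_pcons a b c d (x : V b c d) (h : hpath V a c -> U) :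
  vanishing h -> vanishing (fun P : hpath V a b => h (pcons x P)).
Proof. by move=> h0 y z e L R; apply: (h0 _ _ _ (pcons x L)). Qed.

Lemma sum_entries_pcat (X Y Z : objseq O) (P : hpath (mat V) Y Z)
  (Q : hpath (mat V) X Y) i j (h : hpath V (X i) (Z j) -> U) :
  \sum_(q <- entries (pcat P Q) i j) h q =
  \sum_x \sum_(R <- entries Q i x) \sum_(L <- entries P x j) h (pcat L R).
Proof.
elim: P Q i j h => [Y'|X' Y' Z' d x P IH] Q i j h /=.
  rewrite (bigD1 j) //= [X in _ + X]big1 ?addr0 => [|x xj].
    apply: eq_bigr => q _; case: eqP => // e.
    by rewrite (eq_axiomK e) big_seq1.
  by rewrite big1 // => q _; case: eqP xj => // _ _; rewrite big_nil.
rewrite big_flatten big_map big_enum /=.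
under eq_bigr do rewrite big_map IH.
rewrite exchange_big; apply: eq_bigr => y _ /=.
rewrite exchange_big; apply: eq_bigr => R _ /=.
rewrite big_flatten big_map big_enum /=.
by apply: eq_bigr => z _; rewrite big_map.
Qed.

(** All entries of a path of matrices share its length and degrees, hence its sign. *)
Lemma sum_entries_susp (X Y : objseq O) (Q : hpath (mat V) X Y) i j
  (h : hpath V (X i) (Y j) -> nat -> int -> U) :
  \sum_(q <- entries Q i j) h q (plen q) (psusp q) =
  \sum_(q <- entries Q i j) h q (plen Q) (psusp Q).
Proof.
elim: Q i j h => [X'|X' Y' Z' d x P IH] i j h /=.
  by case: eqP => [e|_]; rewrite ?big_nil // !big_seq1; case: _ / e h.
rewrite !big_flatten !big_map; apply: eq_bigr => y _; rewrite !big_map /=.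
exact: (IH _ _ (fun q l s => h (pcons (x (y, j) : V _ _ d) q) l.+1 (l%:Z * d + s))).
Qed.

Variables (X : objseq O) (delta : mat V X X 1).
Hypothesis delta_triangular :
  forall i j : 'I_(objseq_len X), (j <= i)%N -> delta (j, i) = 0.

(** [delta (a, b)] goes from the [a]-th to the [b]-th object and can be nonzero only for [b < a].
    Hence the rank falls with the index; it takes the values from 1 to [objseq_len X]. *)
Definition delta_edge (a b : 'I_(objseq_len X)) : bool := (b < a)%N.
Definition delta_rank (a : 'I_(objseq_len X)) : nat := (objseq_len X - a)%N.

Fact delta_edge_rank a b : delta_edge a b -> (delta_rank a < delta_rank b)%N.
Proof. by move=> ab; apply: ltn_sub2l. Qed.

Fact delta_edge_deg (a b : 'I_(objseq_len X)) : delta_edge a b -> 1 = 1 + 0 - 0 :> int.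
Proof. by []. Qed.

Definition delta_graph : graph V :=
  @Graph _ _ V 'I_(objseq_len X) X (fun _ _ => 1) (fun a b => delta (a, b))
    delta_edge delta_rank (fun=> 0) delta_edge_rank delta_edge_deg.

Lemma sum_mat_pow_upto N (i j : delta_graph) (h : hpath V (X i) (X j) -> U) :
  vanishing h ->
  \sum_(t <- iota 0 N.+1) \sum_(q <- entries (mat_pow delta t) i j) h q =
  \sum_(q <- chains_upto N i j) h q.
Proof.
elim: N j h => [|N IH] j h h0.
  by rewrite big_seq1 /= cats0.
rewrite -[iota 0 N.+2]/(0%N :: iota (1 + 0) N.+1) big_cons (iotaDl 1 0) big_map.
rewrite [RHS]big_cat; congr (_ + _).
rewrite big_flatten big_map big_filter big_enum_cond.
under eq_bigr do rewrite add1n /= big_flatten big_map big_enum.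
rewrite exchange_big [RHS]big_mkcond; apply: eq_bigr => x _ /=.
under eq_bigr do rewrite big_map.
case: ifP => [xj|].
  by rewrite big_map -IH //; apply: vanishing_pcons.
rewrite /delta_edge => /negbT; rewrite -leqNgt => xj.
rewrite big1 // => t _; rewrite big1 // => q _.
by rewrite delta_triangular //; apply: (h0 _ _ _ (pnil _)).
Qed.

Lemma sum_mat_pow (i j : delta_graph) (h : hpath V (X i) (X j) -> U) :
  vanishing h ->
  \sum_(t <- iota 0 (objseq_len X).+1) \sum_(q <- entries (mat_pow delta t) i j) h q =
  \sum_(q <- chains i j) h q.
Proof.
by move=> h0; rewrite sum_mat_pow_upto // chains_upto_stable // leq_subr.
Qed.

End Entries.

Section MaurerCartan.
Variables (k : fieldType) (O : Type) (V : O -> O -> int -> lmodType k).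
Variable m : ainf_category V.
Notation mop := (m : operations V V id).

Lemma dprod_sumE (T : Type) (Y : T -> lmodType k) (J : Type) (s : seq J) (P : pred J)
  (h : J -> dprod Y) t : (\sum_(i <- s | P i) h i) t = \sum_(i <- s | P i) h i t.
Proof. exact: (big_morph (fun h : dprod Y => h t)). Qed.

Lemma mat_susp_opE (X Y : objseq O) (Q : hpath (mat V) X Y) r i j :
  mat_susp_op m Q r (i, j) = \sum_(q <- entries Q i j) bar mop q r.
Proof.
rewrite -[LHS]/(sg k (psusp Q) *: mat_op m Q r (i, j)) /mat_op scaler_sumr.
by rewrite -(sum_entries_susp Q (fun q _ c => sg k c *: mop _ _ q r)).
Qed.

Variables (X : objseq O) (delta : mat V X X 1).
Hypothesis delta_triangular :
  forall i j : 'I_(objseq_len X), (j <= i)%N -> delta (j, i) = 0.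

Lemma plen_mat_pow t : plen (mat_pow delta t) = t.
Proof. by elim: t => //= t ->. Qed.

Lemma psusp_mat_pow t : psusp (mat_pow delta t) = ((t * t.-1)./2)%:Z.
Proof.
rewrite -bin2; elim: t => //= t ->.
by rewrite plen_mat_pow mulr1 binS bin1 addnC PoszD.
Qed.

(** The sign $(-1)^{t(t-1)/2}$ is the suspension sign of $t$ morphisms of degree 1, by
    [psusp_mat_pow]; starting at $t=1$ matches the exclusion of the empty chain. *)
Lemma maurer_cartan_chain_sum (i j : delta_graph delta) :
  (\sum_(1 <= t < (objseq_len X).+1)
    (-1) ^+ ((t * t.-1)./2)%N *: mat_op m (mat_pow delta t) 2) (i, j) =
  chain_sum mop i j 2.
Proof.
pose h (q : hpath V (X i) (X j)) := if (0 < plen q)%N then bar mop q 2 else 0.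
have h0 : vanishing h.
  move=> x y d L R; rewrite /h plen_pcat addnS /=; apply: bar0.
  exact: ainf_multilinear.
have -> : chain_sum mop i j 2 = \sum_(q <- chains i j) h q by rewrite /chain_sum big_mkcond.
rewrite dprod_sumE -(sum_mat_pow delta_triangular h0).
have E t : \sum_(q <- entries (mat_pow delta t) i j) h q =
    if (0 < t)%N then mat_susp_op m (mat_pow delta t) 2 (i, j) else 0.
  rewrite /h (sum_entries_susp (mat_pow delta t) (fun q l _ => if (0 < l)%N then bar mop q 2 else 0)).
  rewrite plen_mat_pow; case: ifP => t0; first by rewrite mat_susp_opE.
  by rewrite big1.
rewrite [RHS](eq_bigr _ (fun t _ => E t)) big_cons /= add0r /index_iota subSS subn0.
rewrite big_seq [RHS]big_seq; apply: eq_bigr => t; rewrite mem_iota => /andP[-> _].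
by rewrite /mat_susp_op psusp_mat_pow.
Qed.

End MaurerCartan.

Section TwistedGraphs.
Variables (k : fieldType) (O : Type) (V : O -> O -> int -> lmodType k).
Variable m : ainf_category V.
Notation mop := (m : operations V V id).
Implicit Types X Y Z : tw_object m.

Definition tw_graph X : graph V := delta_graph (@tw_delta _ _ _ _ X).

Fact tw_shift X (a : tw_graph X) : shift a = 0.
Proof. by []. Qed.

Lemma tw_graph_flat X : flat mop (tw_graph X).
Proof.
move=> a b e; have [->|e2] := eqVneq e 2; last first.
  exact: (chain_sum_graded (@ainf_graded _ _ _ m)).
rewrite -maurer_cartan_chain_sum; last exact: tw_triangular.
by rewrite tw_maurer_cartan.
Qed.

Lemma sum_insertions_nil (U : zmodType) X i j (h : hpath V (X i) (X j) -> U) :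
  vanishing h ->
  \sum_(Q <- insertions (pnil X)) \sum_(q <- entries Q i j) h q =
  \sum_(q <- chains (i : tw_graph X) (j : tw_graph X)) h q.
Proof.
by move=> h0; rewrite big_map sum_mat_pow //; apply: tw_triangular.
Qed.

Notation twcons y P :=
  (@pcons (tw_object m) (fun X Y p => tw_hom X Y p : Type) _ _ _ _ y P).

Lemma sum_insertions_cons (U : zmodType) X Y Z d (y : tw_hom Y Z d)
  (P : hpath (@tw_hom _ _ _ m) X Y) i j (h : hpath V (X i) (Z j) -> U) :
  vanishing h ->
  \sum_(Q <- insertions (twcons y P)) \sum_(q <- entries Q i j) h q =
  \sum_x \sum_z \sum_(Q <- insertions P) \sum_(R <- entries Q i x)
    \sum_(L <- chains (z : tw_graph Z) (j : tw_graph Z))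
      h (pcat L (pcons (y (x, z)) R)).
Proof.
move=> h0.
rewrite big_flatten big_map.
transitivity (\sum_(t <- iota 0 (objseq_len Z).+1) \sum_(Q <- insertions P)
   \sum_x \sum_z \sum_(R <- entries Q i x)
      \sum_(L <- entries (mat_pow (@tw_delta _ _ _ _ Z) t) z j) h (pcat L (pcons (y (x, z)) R))).
  apply: eq_bigr => t _; rewrite big_map; apply: eq_bigr => Q _.
  rewrite sum_entries_pcat exchange_big; apply: eq_bigr => z _ /=.
  rewrite big_flatten big_map big_enum /=; apply: eq_bigr => x _.
  by rewrite big_map.
rewrite exchange_big; under eq_bigr do rewrite exchange_big.
rewrite exchange_big; apply: eq_bigr => x _ /=.
under eq_bigr do rewrite exchange_big; rewrite exchange_big; apply: eq_bigr => z _ /=.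
apply: eq_bigr => Q _; rewrite exchange_big; apply: eq_bigr => R _ /=.
apply: (@sum_mat_pow _ _ _ _ _ _ (@tw_triangular _ _ _ _ Z) z j
  (fun L => h (pcat L (pcons (y (x, z)) R)))).
by move=> u v e L L'; rewrite pcatA; apply: h0.
Qed.

Lemma tw_opE X Y (P : hpath (@tw_hom _ _ _ m) X Y) r i j :
  tw_op P r (i, j) =
  sg k (psusp P) *: \sum_(Q <- insertions P) \sum_(q <- entries Q i j) bar mop q r.
Proof.
rewrite -[LHS]/(sg k (psusp P) *: (\sum_(Q <- insertions P) mat_susp_op m Q r) (i, j)).
by rewrite dprod_sumE; congr (_ *: _); apply: eq_bigr => Q _; rewrite mat_susp_opE.
Qed.

Lemma bar_vanishing a b r : vanishing (fun q : hpath V a b => bar mop q r).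
Proof. by move=> x y d L R; apply: bar0; apply: ainf_multilinear. Qed.

Lemma tw_diff_sandwich X Y p r (y : tw_hom X Y p) i j :
  tw_diff r y (i, j) =
  sandwich mop (fun (a : tw_graph X) (b : tw_graph Y) => y (a, b)) i j r.
Proof.
rewrite /tw_diff tw_opE (_ : sg k _ = 1) ?scale1r; last by rewrite /= mul0r addr0.
rewrite sum_insertions_cons; last exact: bar_vanishing.
apply: eq_bigr => x _; apply: eq_bigr => z _.
rewrite (sum_insertions_nil (h := fun R => \sum_(L <- _) bar mop (pcat L (pcons _ R)) r)) //.
move=> u v e L L'; rewrite big1 // => Q _.
rewrite -[pcons _ (pcat _ _)]/(pcat (pcons _ L) _) -pcatA; exact: bar_vanishing.
Qed.

(** The outer suspension sign is trivial because [z] and [y] have degree 0, so the graph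
    construction agrees with the given composition on the nose. *)
Lemma tw_op_pair_sandwich X Y Z (z : tw_hom Y Z 0) (y : tw_hom X Y 0) i j r :
  tw_op (twcons z (twcons y (pnil X))) r (i, j) =
  pair_sandwich (G1 := tw_graph X) (G2 := tw_graph Y) (G3 := tw_graph Z)
    (@tw_shift X) (@tw_shift Y) (fun a b => y (a, b)) (fun b c => z (b, c)) mop i j r.
Proof.
rewrite tw_opE pair_sandwichE; last exact: ainf_multilinear.
rewrite (_ : sg k _ = 1) ?scale1r; last by rewrite /= !mulr0 !addr0.
rewrite sum_insertions_cons; last exact: bar_vanishing.
apply: eq_bigr => b _; apply: eq_bigr => c _.
rewrite (@sum_insertions_cons _ _ _ _ _ _ _ _ _ (fun Q =>
  \sum_(L <- _) bar mop (pcat L (pcons _ Q)) r)); last first.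
  move=> u v e L L'; rewrite big1 // => Q _.
  rewrite -[pcons _ (pcat _ _)]/(pcat (pcons _ L) _) -pcatA; exact: bar_vanishing.
apply: eq_bigr => x _; apply: eq_bigr => b' _.
rewrite (sum_insertions_nil (h := fun R => \sum_(Q <- _) \sum_(L <- _)
  bar mop (pcat L (pcons _ (pcat Q (pcons _ R)))) r)) //.
move=> u v e L L'; rewrite big1 // => Q _; rewrite big1 // => Q' _.
rewrite -[pcons (y _) (pcat _ _)]/(pcat (pcons _ L) _) -pcatA.
rewrite -[pcons _ (pcat _ _)]/(pcat (pcons _ _) _) -pcatA; exact: bar_vanishing.
Qed.

End TwistedGraphs.

(** * Total complexes *)

Section GhomEvaluation.
Variables (k : fieldType) (B : kAlgebra k).

Section Values.
Variables (I J : nat -> rmodType B) (p : int).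
Implicit Types f g : ghom I J p.

Lemma ghom_out f q r : r%:Z != q%:Z + p -> val f (q, r) = 0.
Proof. by case: f => f /= fP; move: fP; rewrite inE => /asboolP /(_ (q, r)). Qed.

Lemma ghom_eq f g :
  (forall q r (x : I q), r%:Z = q%:Z + p -> val f (q, r) x = val g (q, r) x) -> f = g.
Proof.
move=> E; apply/val_inj/functional_extensionality_dep => -[q r].
have [qr|qr] := eqVneq r%:Z (q%:Z + p); last by rewrite !ghom_out.
by apply: linear_eq => x; apply: E.
Qed.

Lemma ghomDE f g q r (x : I q) : val (f + g) (q, r) x = val f (q, r) x + val g (q, r) x.
Proof. by []. Qed.

Lemma ghomNE f q r (x : I q) : val (- f) (q, r) x = - val f (q, r) x.
Proof. by []. Qed.

Lemma ghomZE c f q r (x : I q) :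
  val (c *: f) (q, r) x = (alg_map B c : B^c) *: val f (q, r) x.
Proof. by []. Qed.

Lemma ghom_sumE (T : Type) (s : seq T) (P : pred T) (f : T -> ghom I J p) q r (x : I q) :
  val (\sum_(i <- s | P i) f i) (q, r) x = \sum_(i <- s | P i) val (f i) (q, r) x.
Proof. exact: (big_morph (fun f : ghom I J p => val f (q, r) x)). Qed.

Lemma ghom_projE (f : raw_hom I J) q r (x : I q) :
  val (ghom_proj p f) (q, r) x = if r%:Z == q%:Z + p then f (q, r) x else 0.
Proof. by rewrite /= /ghom_proj_raw /=; case: eqP. Qed.

End Values.

Variables (M N L : rmodType B) (I : injective_resolution M).
Variables (J : injective_resolution N) (K : injective_resolution L).

Lemma ghom_diffE p c (f : ghom I J p) q r (x : I q) : c = p + 1 ->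
  val (ghom_diff c f) (q, r) x =
  match r return J r with 0%N => 0 | r'.+1 => res_diff J r' (val f (q, r') x) end
  - (alg_map B (sg k p) : B^c) *: val f (q.+1, r) (res_diff I q x).
Proof.
move=> ->; rewrite ghom_projE; case: eqP => [_|/eqP qr]; first by case: r.
rewrite [val f (q.+1, r)]ghom_out ?scaler0 ?subr0; last by lia.
case: r qr => // r qr; rewrite ghom_out ?linear0 //; by lia.
Qed.

Lemma ghom_compE p' p c (g : ghom J K p') (f : ghom I J p) q (s : nat) r (x : I q) :
  c = p' + p -> s%:Z = q%:Z + p ->
  val (ghom_comp g f c) (q, r) x = val g (s, r) (val f (q, s) x).
Proof.
move=> -> sq; rewrite ghom_projE; case: eqP => [_|/eqP qr]; last first.
  by rewrite [val g _]ghom_out //; lia.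
have sB : (s < (q + `|p|%N).+1)%N by lia.
rewrite homB_sumE (bigD1 (Ordinal sB)) //= big1 ?addr0 // => u us.
rewrite [val f (q, _)]ghom_out ?linear0 //; apply: contra us => /eqP uq.
by apply/eqP/val_inj => /=; lia.
Qed.

Lemma ghom_comp_out p' p c (g : ghom J K p') (f : ghom I J p) q r (x : I q) :
  q%:Z + p < 0 -> val (ghom_comp g f c) (q, r) x = 0.
Proof.
move=> sq; rewrite ghom_projE; case: eqP => // _.
rewrite homB_sumE big1 // => u _.
by rewrite /= [val f (q, _)]ghom_out ?linear0 //; lia.
Qed.

Lemma ghom_comp1lE p c (g : ghom J K 1) (f : ghom I J p) q r (x : I q) : c = p + 1 ->
  val (ghom_comp g f c) (q, r) x =
  match r return K r with
  | 0%N => 0 | r'.+1 => val g (r', r'.+1) (val f (q, r') x) end.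
Proof.
move=> c1; case: r => [|r].
  have [qp|qp] := ltrP (q%:Z + p) 0; first by rewrite ghom_comp_out.
  by rewrite ghom_out //; lia.
have [qr|qr] := eqVneq r%:Z (q%:Z + p); first by rewrite (ghom_compE _ _ _ _ _ qr) // addrC.
by rewrite [val f _]ghom_out // linear0 ghom_out //; lia.
Qed.

Lemma ghom_comp1rE p c (g : ghom J K p) (f : ghom I J 1) q r (x : I q) : c = p + 1 ->
  val (ghom_comp g f c) (q, r) x = val g (q.+1, r) (val f (q, q.+1) x).
Proof. by move=> c1; apply: ghom_compE => //; lia. Qed.

Lemma ghom_diffB p c (f g : ghom I J p) :
  ghom_diff c (f - g) = ghom_diff c f - ghom_diff c g.
Proof. exact: (linearB (@ghom_diff _ _ _ _ I J p c)). Qed.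

Lemma ghom_diff_diff p c c' (f : ghom I J p) : c = p + 1 -> c' = c + 1 ->
  ghom_diff c' (ghom_diff c f) = 0.
Proof.
move=> cE c'E; apply: ghom_eq => q r x _.
have dd (N' : rmodType B) (R : injective_resolution N') s (y : R s) :
  res_diff R s.+1 (res_diff R s y) = 0 by apply/res_diff_exact; exists y.
rewrite c'E cE -[RHS]/(0 : J r) ghom_diffE // sgD sg1 mulrN1 rmorphN /=.
case: r => [|r]; rewrite !ghom_diffE //= dd linear0 scaler0 subr0.
  by rewrite scaler0 subrr.
rewrite linearB linearZ scaleNr opprK.
by case: r => [|r]; rewrite ?dd ?linear0 sub0r addNr.
Qed.

End GhomEvaluation.

Lemma sum_chains_le (k : fieldType) (O : Type) (V : O -> O -> int -> lmodType k)
  (G : graph V) (a b : G) (U : zmodType) (h : hpath V (vobj a) (vobj b) -> U) :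
  (rank b <= rank a)%N ->
  \sum_(P <- chains a b) h P = \sum_(P <- trivial_chain a b) h P.
Proof.
have gt (x : G) (h' : hpath V (vobj a) (vobj x) -> U) : (rank x < rank a)%N ->
    \sum_(P <- chains a x) h' P = 0.
  elim/rank_ind: x h' => x IH h' xa; rewrite sum_chains trivial_chain_neq.
    rewrite big_nil add0r big1 // => y yx; apply: IH => //.
    exact: ltn_trans (edge_rank yx) xa.
  by apply: contraTneq xa => ->; rewrite ltnn.
move=> ba; rewrite sum_chains [X in _ + X]big1 ?addr0 // => x xb.
by rewrite gt // (leq_trans (edge_rank xb)).
Qed.

Lemma sum_trivial_chain_nonempty (k : fieldType) (O : Type)
  (V : O -> O -> int -> lmodType k) (G : graph V) (a b : G) (U : zmodType)
  (h : hpath V (vobj a) (vobj b) -> U) :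
  \sum_(P <- trivial_chain a b | (0 < plen P)%N) h P = 0.
Proof.
rewrite big_mkcond /trivial_chain; case: eqP => [ab|_]; rewrite ?big_nil // big_seq1.
by case: _ / ab h.
Qed.

Lemma chain_sum_rank (k : fieldType) (O O' : Type) (V : O -> O -> int -> lmodType k)
  (W : O' -> O' -> int -> lmodType k) f (g : operations V W f) (G : graph V)
  (a b : G) e : (rank b <= rank a)%N -> chain_sum g a b e = 0.
Proof.
move=> ba; rewrite /chain_sum big_mkcond sum_chains_le // -big_mkcond.
exact: sum_trivial_chain_nonempty.
Qed.

Lemma linear_pack (R : pzRingType) (X Y : lmodType R) (f : X -> Y) :
  linear f -> exists g : {linear X -> Y}, g =1 f.
Proof.
move=> f_lin; pose H := GRing.isLinear.Build R X Y *:%R f f_lin.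
pose g : {linear X -> Y} := HB.pack f H.
by exists g.
Qed.

Section TotalComplex.
Variables (k : fieldType) (B : kAlgebra k) (n : nat) (M : 'I_n -> rmodType B).
Variable I : forall i, injective_resolution (M i).
Variable V : 'I_n -> 'I_n -> int -> lmodType k.
Variables (m : operations V V id) (F : operations V (dg_hom I) id).

Section Complex.
Variable G : graph V.

Definition total (q : nat) : rmodType B := dprod (fun a : G => I (vobj a) q : rmodType B).

Definition total_diff q (x : total q) : total q.+1 :=
  fun b => res_diff (I (vobj b)) q (x b) -
    \sum_a val (chain_sum F a b 1) (q, q.+1) (x a).

Fact total_diff_linear q : linear (@total_diff q).
Proof.
move=> c x y; apply: functional_extensionality_dep => b.
rewrite -[RHS]/(c *: total_diff x b + total_diff y b) /total_diff.
rewrite linearP scalerBr addrACA -opprD; congr (_ + - _).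
rewrite scaler_sumr -big_split; apply: eq_bigr => a _.
exact: linearP.
Qed.
HB.instance Definition _ q := GRing.isLinear.Build _ (total q) (total q.+1) _
  (@total_diff q) (@total_diff_linear q).

Lemma total_diffD q (x y : total q) : total_diff (x + y) = total_diff x + total_diff y.
Proof. exact: (linearD (@total_diff q)). Qed.

Lemma total_diffB q (x y : total q) : total_diff (x - y) = total_diff x - total_diff y.
Proof. exact: (linearB (@total_diff q)). Qed.

Definition total_inj a q (x : I (vobj a) q) : total q :=
  fun b => match a =P b with
    | ReflectT e => eq_rect a (fun b => I (vobj b) q) x b e
    | ReflectF _ => 0 end.

Lemma total_injE a q (x : I (vobj a) q) : total_inj x a = x.
Proof. by rewrite /total_inj; case: eqP => // e; rewrite (eq_axiomK e). Qed.

Lemma total_inj_neq a b q (x : I (vobj a) q) : a != b -> total_inj x b = 0.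
Proof. by rewrite /total_inj; case: eqP. Qed.

Fact total_inj_linear a q : linear (@total_inj a q).
Proof.
move=> c x y; apply: functional_extensionality_dep => b.
rewrite -[RHS]/(c *: total_inj x b + total_inj y b).
have [ab|ab] := eqVneq a b; last by rewrite !total_inj_neq // scaler0 addr0.
by case: _ / ab; rewrite !total_injE.
Qed.
HB.instance Definition _ a q := GRing.isLinear.Build _ (I (vobj a) q) (total q) _
  (@total_inj a q) (@total_inj_linear a q).

Lemma total_sum_inj q (x : total q) : x = \sum_a total_inj (x a).
Proof.
apply: functional_extensionality_dep => b.
rewrite (big_morph (fun y : total q => y b) (id1 := 0) (op1 := +%R)) //.
rewrite (bigD1 b) //= total_injE big1 ?addr0 // => a ab.
exact: total_inj_neq.
Qed.

Lemma sum_total_inj (U : zmodType) a q (x : I (vobj a) q)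
  (h : forall c : G, I (vobj c) q -> U) : (forall c, h c 0 = 0) ->
  \sum_c h c (total_inj x c) = h a x.
Proof.
move=> h0; rewrite (bigD1 a) //= total_injE big1 ?addr0 // => c ca.
by rewrite total_inj_neq // eq_sym.
Qed.

Lemma total_diff_inj a q (x : I (vobj a) q) b :
  total_diff (total_inj x) b = total_inj (res_diff (I (vobj a)) q x) b -
    val (chain_sum F a b 1) (q, q.+1) x.
Proof.
rewrite /total_diff (sum_total_inj x (h := fun c => val (chain_sum F c b 1) (q, q.+1))).
  congr (_ - _); have [ab|ab] := eqVneq a b; last by rewrite !total_inj_neq // linear0.
  by case: _ / ab; rewrite !total_injE.
by move=> c; rewrite linear0.
Qed.

Lemma total_injective q : injective_module (total q).
Proof.
move=> X Y i f i_inj.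
have H (a : G) : exists g : {linear Y -> I (vobj a) q}, forall x, g (i x) = f x a.
  have fa_lin : linear (fun x => f x a) by move=> c x y; rewrite linearP.
  have [fa faE] := linear_pack fa_lin.
  have [g gE] := @res_injective _ _ (I (vobj a)) q X Y i fa i_inj.
  by exists g => x; rewrite gE faE.
pose g (a : G) := projT1 (cid (H a)).
have gE a x : g a (i x) = f x a by rewrite /g; case: cid.
have g_lin : linear (fun y : Y => (fun a => g a y) : total q).
  by move=> c x y; apply: functional_extensionality_dep => a; apply: linearP.
have [h hE] := linear_pack g_lin.
by exists h => x; rewrite hE; apply: functional_extensionality_dep => a; apply: gE.
Qed.

Hypothesis F_functor : is_ainf_functor m (@dg_op _ _ _ _ I) F.
Hypotheses (flatG : flat m G) (shiftG : forall a : G, shift a = 0).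

Lemma total_diff_diff q (x : total q) : total_diff (total_diff x) = 0.
Proof.
apply: functional_extensionality_dep => b.
rewrite (total_sum_inj x) !linear_sum.
rewrite (big_morph (fun y : total q.+2 => y b) (id1 := 0) (op1 := +%R)) //.
rewrite big1 // => a _; move: (x a) => {}x.
have : val (ghom_diff 2 (chain_sum F a b 1)) (q, q.+2) x =
    \sum_c val (ghom_comp (chain_sum F c b 1) (chain_sum F a c 1) 2) (q, q.+2) x.
  by rewrite (chain_sum_diff F_functor a b flatG shiftG) ghom_sumE.
rewrite ghom_diffE // sg1 rmorphN1 scaleN1r opprK.
under eq_bigr do rewrite ghom_comp1lE //.
move=> E; rewrite -[LHS]/(res_diff (I (vobj b)) q.+1 (total_diff (total_inj x) b) -
  \sum_c val (chain_sum F c b 1) (q.+1, q.+2) (total_diff (total_inj x) c)).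
rewrite total_diff_inj linearB.
under [X in _ - X]eq_bigr do rewrite total_diff_inj linearB.
rewrite sumrB -E (sum_total_inj _ (h := fun c => val (chain_sum F c b 1) (q.+1, q.+2))).
  have -> : res_diff (I (vobj b)) q.+1 (total_inj (res_diff (I (vobj a)) q x) b) = 0.
    have [ab|ab] := eqVneq a b; last by rewrite total_inj_neq // linear0.
    by case: _ / ab; rewrite total_injE; apply/res_diff_exact; exists x.
  by rewrite sub0r opprB addrK addNr.
by move=> c; rewrite linear0.
Qed.

(** The twist strictly raises the rank, so the entries of lowest rank of a cocycle are cocycles in
    the resolutions [I], hence boundaries there; subtracting pushes the cocycle to higher rank. The
    bound on the support of [y] is recorded for the filtration of the kernel. *)
Lemma total_exact q w (x : total q.+1) : total_diff x = 0 ->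
  (forall a : G, (rank a < w)%N -> x a = 0) ->
  exists2 y : total q, total_diff y = x & forall a : G, (rank a < w)%N -> y a = 0.
Proof.
have [N] := ubnP ((\max_(a : G) rank a).+1 - w)%N.
elim: N w x => // N IH w x wN dx xw.
have [wmax|wmax] := ltnP (\max_(a : G) rank a) w.
  exists 0; rewrite ?linear0 //; apply: functional_extensionality_dep => a.
  by rewrite xw // (leq_ltn_trans _ wmax) // leq_bigmax.
have H (a : G) : exists z : I (vobj a) q,
    if rank a == w then res_diff (I (vobj a)) q z = x a else z = 0.
  case: eqP => aw; last by exists 0.
  apply/res_diff_exact; have := congr1 (fun y : total q.+2 => y a) dx.
  rewrite /total_diff big1 ?subr0 // => b _.
  have [ba|ba] := leqP (rank a) (rank b); first by rewrite chain_sum_rank.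
  by rewrite xw ?linear0 // -aw.
pose z (a : G) := projT1 (cid (H a)).
have zE a : if rank a == w then res_diff (I (vobj a)) q (z a) = x a else z a = 0.
  by rewrite /z; case: cid.
have xzE (a : G) : (rank a < w.+1)%N -> (x - total_diff (z : total q)) a = 0.
  move=> aw; rewrite -[LHS]/(x a - (res_diff (I (vobj a)) q (z a) - \sum_b _)).
  rewrite big1 ?subr0 => [|b _]; last first.
    have [ab|ba] := leqP (rank a) (rank b); first by rewrite chain_sum_rank.
    have := zE b; rewrite ltn_eqF ?(leq_trans ba) // => ->.
    exact: linear0.
  have := zE a; case: eqP => [_ ->|/eqP aw']; first exact: subrr.
  move=> ->; rewrite linear0 subr0 xw //.
  by rewrite ltn_neqAle aw' -ltnS.
have [||y yE yw] := IH w.+1 _ _ _ xzE.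
- by rewrite subnS -ltnS (leq_trans _ wN) // ltnS prednK // subn_gt0.
- by rewrite total_diffB dx total_diff_diff subrr.
exists (y + (z : total q)); first by rewrite total_diffD yE subrK.
move=> a aw; rewrite -[LHS]/(y a + z a) yw ?add0r; last exact: ltnW.
by have := zE a; rewrite ltn_eqF.
Qed.

End Complex.
End TotalComplex.

(** * Homomorphisms of total complexes as matrices *)

Section TotalHom.
Variables (k : fieldType) (B : kAlgebra k) (n : nat) (M : 'I_n -> rmodType B).
Variable I : forall i, injective_resolution (M i).
Variable V : 'I_n -> 'I_n -> int -> lmodType k.
Variables (m : operations V V id) (F : operations V (dg_hom I) id).

Record flat_graph := FlatGraph {
  flat_graph_sort :> graph V;
  flat_graph_flat : flat m flat_graph_sort;
  flat_graph_shift : forall a : flat_graph_sort, shift a = 0 }.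

(** [N] is identified with the kernel only up to isomorphism, so that an arbitrary module can be
    presented by a graph, as essential surjectivity requires. *)
Record augmentation (G : flat_graph) (N : rmodType B) := Augmentation {
  aug_map : {linear N -> total I G 0};
  aug_map_inj : injective aug_map;
  aug_map_exact : forall y, total_diff F y = 0 <-> exists x, aug_map x = y }.

Hypothesis F_functor : is_ainf_functor m (@dg_op _ _ _ _ I) F.

Fact total_diff_exact (G : flat_graph) q (y : total I G q.+1) :
  total_diff F y = 0 <-> exists x, total_diff F x = y.
Proof.
split=> [dy|[x <-]]; last first.
  exact: (total_diff_diff F_functor (@flat_graph_flat G) (@flat_graph_shift G)).
have [x xy _] := total_exact (w := 0) F_functor (@flat_graph_flat G)
  (@flat_graph_shift G) dy (fun _ => ltac:(by [])).
by exists x.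
Qed.

Definition total_res (G : flat_graph) N (A : augmentation G N) : injective_resolution N :=
  @InjectiveResolution _ N (total I G) (fun q => @total_diff _ _ _ _ _ _ F G q)
    (aug_map A) (@aug_map_inj _ _ A) (@aug_map_exact _ _ A)
    (@total_diff_exact G) (@total_injective _ _ _ _ _ _ G).

Section Entries.
Variables (G1 G2 : flat_graph) (p : int).

Section Assemble.
Variable h : forall (a : G1) (b : G2), ghom (I (vobj a)) (I (vobj b)) p.

Definition assemble_fun (t : nat * nat) (x : total I G1 t.1) : total I G2 t.2 :=
  fun b => \sum_a val (h a b) t (x a).

Fact assemble_fun_linear t : linear (@assemble_fun t).
Proof.
move=> c x y; apply: functional_extensionality_dep => b.
rewrite -[RHS]/(c *: assemble_fun x b + assemble_fun y b) /assemble_fun.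
rewrite scaler_sumr -big_split; apply: eq_bigr => a _; exact: linearP.
Qed.
HB.instance Definition _ t := GRing.isLinear.Build _ _ _ _ (@assemble_fun t)
  (@assemble_fun_linear t).

Definition assemble : ghom (total I G1) (total I G2) p :=
  ghom_proj p (fun t => (@assemble_fun t : homB _ _)).

Lemma assembleE q r (x : total I G1 q) b :
  val assemble (q, r) x b = \sum_a val (h a b) (q, r) (x a).
Proof.
rewrite ghom_projE; case: eqP => [//|/eqP qr].
by rewrite big1 // => a _; rewrite ghom_out.
Qed.

End Assemble.

Section Entry.
Variables (f : ghom (total I G1) (total I G2) p) (a : G1) (b : G2).

Definition entry_fun (t : nat * nat) (x : I (vobj a) t.1) : I (vobj b) t.2 :=
  val f t (total_inj x) b.

Fact entry_fun_linear t : linear (@entry_fun t).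
Proof. by move=> c x y; rewrite /entry_fun !linearP. Qed.
HB.instance Definition _ t := GRing.isLinear.Build _ _ _ _ (@entry_fun t)
  (@entry_fun_linear t).

Definition entry : ghom (I (vobj a)) (I (vobj b)) p :=
  ghom_proj p (fun t => (@entry_fun t : homB _ _)).

Lemma entryE q r (x : I (vobj a) q) :
  val entry (q, r) x = val f (q, r) (total_inj x) b.
Proof. by rewrite ghom_projE; case: eqP => [//|/eqP qr]; rewrite ghom_out. Qed.

End Entry.

Lemma assembleK h a b : entry (assemble h) a b = h a b.
Proof.
apply: ghom_eq => q r x _; rewrite entryE assembleE.
rewrite (sum_total_inj x (h := fun c => val (h c b) (q, r))) // => c.
exact: linear0.
Qed.

Lemma entry_eq f g : (forall a b, entry f a b = entry g a b) -> f = g.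
Proof.
move=> E; apply: ghom_eq => q r x _; rewrite (total_sum_inj x) !linear_sum.
apply: eq_bigr => a _; apply: functional_extensionality_dep => b.
by rewrite -!entryE E.
Qed.

Lemma entry_linear c f g a b : entry (c *: f + g) a b = c *: entry f a b + entry g a b.
Proof. by apply: ghom_eq => q r x _; rewrite ghomDE ghomZE !entryE. Qed.

Lemma entry0 a b : entry 0 a b = 0.
Proof. by apply: ghom_eq => q r x _; rewrite entryE. Qed.

Lemma entryB f g a b : entry (f - g) a b = entry f a b - entry g a b.
Proof. by apply: ghom_eq => q r x _; rewrite ghomDE ghomNE !entryE. Qed.

Lemma entryD f g a b : entry (f + g) a b = entry f a b + entry g a b.
Proof. by apply: ghom_eq => q r x _; rewrite ghomDE !entryE. Qed.

End Entries.

Lemma entry_comp (G1 G2 G3 : flat_graph) N1 N2 N3 (A1 : augmentation G1 N1)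
  (A2 : augmentation G2 N2) (A3 : augmentation G3 N3) p' p c
  (g : ghom (total_res A2) (total_res A3) p')
  (f : ghom (total_res A1) (total_res A2) p) a b : c = p' + p ->
  entry (ghom_comp g f c) a b = \sum_x ghom_comp (entry g x b) (entry f a x) c.
Proof.
move=> cE; apply: ghom_eq => q r x _; rewrite ghom_sumE.
transitivity ((val (ghom_comp g f c) (q, r) (total_inj x : total_res A1 q)) b).
  exact: entryE.
have [qp|qp] := ltrP (q%:Z + p) 0.
  by rewrite ghom_comp_out // big1 // => y _; rewrite ghom_comp_out.
have qs : Posz (absz (q%:Z + p)) = q%:Z + p by lia.
rewrite (ghom_compE _ _ _ _ cE qs) [val f _ _]total_sum_inj linear_sum.
rewrite (big_morph (fun y : total I G3 r => y b) (id1 := 0) (op1 := +%R)) //.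
by apply: eq_bigr => y _; rewrite (ghom_compE _ _ _ _ cE qs) !entryE.
Qed.

Lemma entry_diff (G1 G2 : flat_graph) N1 N2 (A1 : augmentation G1 N1)
  (A2 : augmentation G2 N2) p c
  (f : ghom (total_res A1) (total_res A2) p) a b : c = p + 1 ->
  entry (ghom_diff c f) a b = ghom_diff c (entry f a b) -
    \sum_x ghom_comp (chain_sum F x b 1) (entry f a x) c +
    sg k p *: \sum_x ghom_comp (entry f x b) (chain_sum F a x 1) c.
Proof.
move=> cE; apply: ghom_eq => q r x _.
transitivity ((val (ghom_diff c f) (q, r) (total_inj x : total_res A1 q)) b).
  exact: entryE.
rewrite !(ghomDE, ghomNE, ghomZE, ghom_sumE) !ghom_diffE //.
under [X in _ = _ - X + _]eq_bigr do rewrite ghom_comp1lE //.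
under [X in _ = _ + _ *: X]eq_bigr do rewrite ghom_comp1rE // entryE.
have Dx : res_diff (total_res A1) q (total_inj x : total_res A1 q) =
    total_inj (res_diff (I (vobj a)) q x) -
    \sum_y total_inj (val (chain_sum F a y 1) (q, q.+1) x).
  apply: functional_extensionality_dep => y.
  rewrite -[LHS]/(total_diff F (total_inj x) y) total_diff_inj.
  congr (_ - _); have := congr1 (fun u : total I G1 q.+1 => u y) (total_sum_inj
    (fun y => val (chain_sum F a y 1) (q, q.+1) x : I (vobj y) q.+1)).
  by move=> /= ->.
pose c' := (alg_map B (sg k p) : B^c).
rewrite Dx linearB linear_sum -[LHS]/(_ b - c' *: (_ b - _ b)).
rewrite (big_morph (fun y : total I G2 r => y b) (id1 := 0) (op1 := +%R)) //.
rewrite scalerBr opprB -/c' [c' *: _ - _]addrC addrA.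
rewrite [val (entry f a b) _ _]entryE [RHS]addrC [LHS]addrC; congr (_ + _).
rewrite -!addrA [- (c' *: _) - _]addrC addrA; congr (_ - _).
case: r => [|r]; first by rewrite big1 ?subrr.
rewrite -[LHS]/(total_diff F (val f (q, r) (total_inj x)) b) /total_diff entryE.
by congr (_ - _); apply: eq_bigr => y _; rewrite entryE.
Qed.

End TotalHom.

(** * Lifting to injective resolutions *)

(** The kernel condition lets [u] descend to the image of [d], a submodule of [Y], from which
    injectivity of [E] extends it. *)
Lemma injective_factor (R : pzRingType) (X Y E : lmodType R) (d : {linear X -> Y})
  (u : {linear X -> E}) : injective_module E -> (forall x, d x = 0 -> u x = 0) ->
  exists v : {linear Y -> E}, forall x, v (d x) = u x.
Proof.
move=> E_inj du0; pose im := submod (coboundary d).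
have im_ex (y : im) : exists x, d x = val y by have /asboolP := valP y.
pose f (y : im) := u (projT1 (cid (im_ex y))).
have fE (y : im) x : d x = val y -> f y = u x.
  rewrite /f; case: cid => x' /= dx' dx.
  by apply/eqP; rewrite -subr_eq0 -linearB du0 // linearB dx dx' subrr.
have f_lin : linear f.
  move=> c y z; have [x xy] := im_ex y; have [x' xz] := im_ex z.
  rewrite (fE y x) // (fE z x') // -linearP; apply: fE.
  by rewrite !linearP xy xz.
have val_lin : linear (val : im -> Y) by move=> c y z; rewrite linearP.
have [g gE] := linear_pack f_lin; have [i iE] := linear_pack val_lin.
have i_inj : injective i by move=> y z; rewrite !iE => /val_inj.
have [v vE] := E_inj _ _ i g i_inj.
exists v => x; have dx_im : d x \in coboundary d by rewrite inE; apply/asboolP; exists x.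
by have := vE (exist _ (d x) dx_im); rewrite iE gE => ->; apply: fE.
Qed.

Section Lifting.
Variables (k : fieldType) (B : kAlgebra k) (M N : rmodType B).
Variables (I : injective_resolution M) (J : injective_resolution N).

Lemma res_diff_diff q (y : J q) : res_diff J q.+1 (res_diff J q y) = 0.
Proof. by apply/res_diff_exact; exists y. Qed.

Section Lift.
Variables (p : nat) (g : {linear M -> J p}).
Hypothesis g_cocycle : forall x, res_diff J p (g x) = 0.

(** What the component at [q] must satisfy for the next one to exist. The order [q + p] makes
    [q.+1 + p] reduce to [(q + p).+1], which avoids transports in the recursion. *)
Let liftable q (f : homB (I q) (J (q + p)%N)) :=
  forall x, res_diff I q x = 0 -> res_diff J (q + p) (f x) = 0.

Let lift0 : exists f : homB (I 0%N) (J p), liftable f /\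
  forall x, f (res_aug I x) = g x.
Proof.
have [|f fE] := injective_factor (d := res_aug I) (u := g) (@res_injective _ _ J p).
  by move=> x x0; rewrite (res_aug_inj (etrans x0 (esym (linear0 _)))) linear0.
by exists f; split=> // x /res_aug_exact[y <-]; rewrite fE.
Qed.

(** The sign comes from $df=(-1)^pfd$, the condition on a cocycle of degree $p$. *)
Let liftS q (f : homB (I q) (J (q + p)%N)) : liftable f ->
  exists f' : homB (I q.+1) (J (q.+1 + p)%N), liftable f' /\
    forall x, f' (res_diff I q x) = (alg_map B (sg k p) : B^c) *: res_diff J (q + p) (f x).
Proof.
move=> fP; pose u : homB (I q) (J (q.+1 + p)%N) :=
  sg k p *: (homB_comp (res_diff J (q + p) : homB _ _) f).
have [x dx0|f' f'E] := injective_factor (d := res_diff I q) (u := u)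
    (@res_injective _ _ J (q.+1 + p)).
  by rewrite homBZE /= (fP _ dx0) scaler0.
exists f'; split=> // x /res_diff_exact[y <-].
by rewrite f'E linearZ /= res_diff_diff scaler0.
Qed.

Let Fixpoint lift q : {f : homB (I q) (J (q + p)%N) | liftable f} :=
  match q with
  | 0%N => let: exist f fP := cid lift0 in exist _ f (proj1 fP)
  | q'.+1 => let: exist f fP := lift q' in
             let: exist f' fP' := cid (liftS fP) in exist _ f' (proj1 fP')
  end.

Lemma cocycle_lift : exists f : ghom I J p, ghom_diff (p%:Z + 1) f = 0 /\
  forall x, val f (0%N, p) (res_aug I x) = g x.
Proof.
pose raw (t : nat * nat) : homB (I t.1) (J t.2) := match (t.1 + p)%N =P t.2 with
  | ReflectT e => eq_rect _ (fun r => homB (I t.1) (J r)) (proj1_sig (lift t.1)) _ e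
  | ReflectF _ => 0 end.
pose f : ghom I J p := ghom_proj p (raw : raw_hom I J).
have fE q : val f (q, (q + p)%N) = proj1_sig (lift q).
  rewrite /= /ghom_proj_raw /= PoszD eqxx /raw /=.
  by case: eqP => // e; rewrite (eq_axiomK e).
exists f; split=> [|x]; last first.
  have -> : val f (0%N, p) = proj1_sig (lift 0) := fE 0%N.
  by rewrite /=; case: cid => f0 [].
apply: ghom_eq => q r x qr; have {qr} -> : r = (q + p).+1 by lia.
rewrite ghom_diffE // fE -[(q + p).+1]/(q.+1 + p)%N fE /=.
case: (lift q) => fq fqP; case: cid => f' [_ /= f'E].
have algZ a b (y : J (q + p).+1) : (alg_map B a : B^c) *: ((alg_map B b : B^c) *: y) =
    (alg_map B (a * b) : B^c) *: y by rewrite scalerA [a * b]mulrC rmorphM.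
by rewrite f'E algZ sgK rmorph1 scale1r subrr.
Qed.

End Lift.

Section Null.
Variable f : ghom I J 0.
Hypothesis f_cocycle : ghom_diff 1 f = 0.
Hypothesis f_aug : forall x, val f (0%N, 0%N) (res_aug I x) = 0.

(** The aim is $dh+hd=f$. Under this condition $f-dh$ kills the image of $d$, so it factors through
    the next differential and yields the next component. *)
Let partial q (h : homB (I q.+1) (J q)) :=
  forall x, res_diff J q (h (res_diff I q x)) = res_diff J q (val f (q, q) x).

Let fd q x : val f (q.+1, q.+1) (res_diff I q x) = res_diff J q (val f (q, q) x).
Proof.
have : val (ghom_diff 1 f) (q, q.+1) x = 0 by rewrite f_cocycle.
rewrite ghom_diffE // sg0 rmorph1 scale1r => /eqP.
by rewrite subr_eq0 => /eqP.
Qed.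

Let null0 : exists h : homB (I 1%N) (J 0%N), partial h /\
  forall x, h (res_diff I 0 x) = val f (0%N, 0%N) x.
Proof.
have [|h hE] := injective_factor (d := res_diff I 0) (u := val f (0%N, 0%N))
    (@res_injective _ _ J 0%N).
  by move=> x /res_aug_exact[y <-].
by exists h; split=> // x; rewrite hE.
Qed.

Let nullS q (h : homB (I q.+1) (J q)) : partial h ->
  exists h' : homB (I q.+2) (J q.+1), partial h' /\
    forall x, h' (res_diff I q.+1 x) = val f (q.+1, q.+1) x - res_diff J q (h x).
Proof.
move=> hP; pose u : homB (I q.+1) (J q.+1) :=
  val f (q.+1, q.+1) - homB_comp (res_diff J q : homB _ _) h.
have [|h' h'E] := injective_factor (d := res_diff I q.+1) (u := u)
    (@res_injective _ _ J q.+1).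
  move=> x /res_diff_exact[y <-].
  by rewrite -[LHS]/(val f (q.+1, q.+1) _ - res_diff J q (h _)) fd hP subrr.
exists h'; split=> // x.
rewrite h'E -[u x]/(val f (q.+1, q.+1) _ - res_diff J q (h _)).
by rewrite linearB /= res_diff_diff subr0.
Qed.

Let Fixpoint null q : {h : homB (I q.+1) (J q) | partial h} :=
  match q with
  | 0%N => let: exist f fP := cid null0 in exist _ f (proj1 fP)
  | q'.+1 => let: exist f fP := null q' in
             let: exist f' fP' := cid (nullS fP) in exist _ f' (proj1 fP')
  end.

Lemma nullhomotopy : exists h : ghom I J (-1), ghom_diff 0 h = f.
Proof.
pose raw (t : nat * nat) : homB (I t.1) (J t.2) := match t.2.+1 =P t.1 with
  | ReflectT e => eq_rect _ (fun r => homB (I r) (J t.2)) (proj1_sig (null t.2)) _ e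
  | ReflectF _ => 0 end.
pose h : ghom I J (-1) := ghom_proj (-1) (raw : raw_hom I J).
have hE q : val h (q.+1, q) = proj1_sig (null q).
  rewrite /= /ghom_proj_raw /= ifT /raw /=; last by apply/eqP; lia.
  by case: eqP => // e; rewrite (eq_axiomK e).
exists h; clearbody h; apply: ghom_eq => q r x qr; have {qr} -> : r = q by lia.
rewrite ghom_diffE // sgN1 rmorphN1 scaleN1r opprK hE.
case: q x => [|q] x; rewrite ?hE /=; first by rewrite add0r; case: cid => h0 [].

case: (null q) => hq hqP; case: cid => h' [_ /= h'E].
by rewrite h'E addrC subrK.
Qed.

End Null.
End Lifting.

(** * The action of the functor on twisted morphisms *)

Section Leading.
Variables (k : fieldType) (O O' : Type) (V : O -> O -> int -> lmodType k).
Variables (W : O' -> O' -> int -> lmodType k) (f : O -> O').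
Variables (g : operations V W f) (g_lin : multilinear g) (G1 G2 : graph V).

(** A nonempty chain before or after [E x y] makes $\mathrm{rank}\,y-\mathrm{rank}\,x$ smaller than
    $\mathrm{rank}\,b-\mathrm{rank}\,a$, where [E] is assumed to vanish; only the bare arrow [E a b]
    remains. *)
Lemma sandwich_leading (ed : G1 -> G2 -> int)
  (E : forall a b, V (vobj a) (vobj b) (ed a b)) a b e :
  (forall x y, (rank y + rank a < rank b + rank x)%N -> E x y = 0) ->
  sandwich g E a b e = g (pcons (E a b) (pnil _)) e.
Proof.
move=> E0.
have Z x y : (x, y) != (a, b) -> \sum_(R <- chains a x) \sum_(L <- chains y b)
    bar g (pcat L (pcons (E x y) R)) e = 0.
  move=> xy; have [lt|le] := ltnP (rank y + rank a) (rank b + rank x).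
    by rewrite big1 // => R _; rewrite big1 // => L _; rewrite E0 // bar0.
  have [xa|ax] := leqP (rank x) (rank a).
    rewrite sum_chains_le //; have [ax|ax] := eqVneq a x; last first.
      by rewrite trivial_chain_neq // big_nil.
    rewrite big1 // => R _; rewrite sum_chains_le; last by rewrite -ax in le; lia.
    by rewrite trivial_chain_neq ?big_nil //; apply: contraNneq xy => ->; rewrite ax.
  rewrite big1 // => R _; rewrite sum_chains_le; last by lia.
  rewrite trivial_chain_neq ?big_nil //; apply: contraTneq le => ->.
  by rewrite -ltnNge ltn_add2l.
rewrite /sandwich (bigD1 a) //= [X in _ + X]big1 ?addr0 => [|x xa]; last first.
  by rewrite big1 // => y _; apply: Z; apply: contraNneq xa => -[->].
rewrite (bigD1 b) //= [X in _ + X]big1 ?addr0 => [|y yb]; last first.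
  by apply: Z; apply: contraNneq yb => -[->].
by do 2 (rewrite sum_chains_le // trivial_chain_refl big_seq1); apply: bar1.
Qed.

End Leading.

Section Realization.
Variables (k : fieldType) (B : kAlgebra k) (n : nat) (M : 'I_n -> rmodType B).
Variable I : forall i, injective_resolution (M i).
Variable V : 'I_n -> 'I_n -> int -> lmodType k.
Variables (m : ainf_category V) (F : operations V (dg_hom I) id).
Notation mop := (m : operations V V id).
Hypothesis F_functor : is_ainf_functor mop (@dg_op _ _ _ _ I) F.
Notation flat_graph := (flat_graph mop).
Notation res := (total_res F_functor).

Let F_lin : multilinear F. Proof. by case: F_functor. Qed.
Let m_lin : multilinear mop. Proof. exact: ainf_multilinear. Qed.

Definition arrows (G1 G2 : flat_graph) p :=
  forall (a : G1) (b : G2), V (vobj a) (vobj b) p.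

Definition realize (G1 G2 : flat_graph) p (y : arrows G1 G2 p) :
  ghom (total I G1) (total I G2) p := assemble (fun a b => sandwich F y a b p).

Lemma realizeE (G1 G2 : flat_graph) p (y : arrows G1 G2 p) a b :
  entry (realize y) a b = sandwich F y a b p.
Proof. exact: assembleK. Qed.

Lemma realize_linear (G1 G2 : flat_graph) p c (y y' : arrows G1 G2 p) :
  realize (fun a b => c *: y a b + y' a b) = c *: realize y + realize y'.
Proof.
apply: entry_eq => a b; rewrite entry_linear !realizeE.
by rewrite sandwich_linear.
Qed.

Lemma eq_realize (G1 G2 : flat_graph) p (y y' : arrows G1 G2 p) :
  (forall a b, y a b = y' a b) -> realize y = realize y'.
Proof.
by move=> yy; apply: entry_eq => a b; rewrite !realizeE; apply: eq_sandwich.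
Qed.

Definition arrow_diff (G1 G2 : flat_graph) p (y : arrows G1 G2 p) c : arrows G1 G2 c :=
  fun a b => sandwich mop y a b c.

Fact arrows_deg (G1 G2 : flat_graph) p (a : G1) (b : G2) : p = 1 + (p - 1) + shift b - shift a.
Proof. by rewrite !flat_graph_shift; ring. Qed.

Lemma arrow_diff_diff (G1 G2 : flat_graph) p (y : arrows G1 G2 p) c c' a b :
  c = p + 1 -> arrow_diff (arrow_diff y c) c' a b = 0.
Proof.
move=> cE; apply: (@sandwich_twice _ _ _ _ G1 G2 (p - 1) (fun _ _ => p) (fun _ _ => c)) => //.
- exact: arrows_deg.
- exact: flat_graph_flat.
- exact: flat_graph_flat.
- exact: flat_graph_shift.
- exact: ainf_relation.
Qed.

Lemma realize_diff (G1 G2 : flat_graph) N1 N2 (A1 : augmentation F G1 N1)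
  (A2 : augmentation F G2 N2) p c (y : arrows G1 G2 p) : c = p + 1 ->
  ghom_diff c (realize y : ghom (res A1) (res A2) p) = realize (arrow_diff y c).
Proof.
move=> cE; apply: entry_eq => a b; rewrite entry_diff // !realizeE.
rewrite (@functor_sandwich _ _ _ _ _ _ _ _ F_functor G1 G2 (p - 1) (fun _ _ => p)
  (fun _ _ => c) (fun _ _ => 1)) //; last 1 first.
- exact: flat_graph_shift.
- rewrite -addrA; congr (_ + _); rewrite addrC scaler_sumr.
  congr (_ - _); first by apply: eq_bigr => x _; rewrite realizeE.
  by apply: eq_bigr => x _; rewrite realizeE.
- exact: arrows_deg.
- by move=> x x'; rewrite !flat_graph_shift.
- exact: flat_graph_flat.
- exact: flat_graph_flat.
Qed.

(** Both twist terms of [entry_diff] meet only entries of strictly smaller weight, which vanish. *)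
Lemma entry_diff_leading (G1 G2 : flat_graph) N1 N2 (A1 : augmentation F G1 N1)
  (A2 : augmentation F G2 N2) p c (h : ghom (res A1) (res A2) p) a b : c = p + 1 ->
  (forall x y, (rank y + rank a < rank b + rank x)%N -> entry h x y = 0) ->
  entry (ghom_diff c h) a b = ghom_diff c (entry h a b).
Proof.
move=> cE h0; rewrite entry_diff // !big1 ?scaler0 ?subr0 ?addr0 // => x _.
  have [ax|xa] := ltnP (rank a) (rank x).
    by rewrite h0 ?ltn_add2l // -[LHS]/(ghom_compl _ _ _) linear0.
  by rewrite chain_sum_rank // -[LHS]/(ghom_compr _ _ _) linear0.
have [xb|bx] := ltnP (rank x) (rank b).
  by rewrite h0 ?ltn_add2r // -[LHS]/(ghom_compr _ _ _) linear0.
by rewrite chain_sum_rank // -[LHS]/(ghom_compl _ _ _) linear0.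
Qed.

Notation F1 x := (F (pcons x (pnil _))).
Let F1_0 i j p r : F1 (0 : V i j p) r = 0.
Proof. exact: (@op0 _ _ _ _ _ id F F_lin i i j j p (pnil j) (pnil i) r). Qed.

Hypothesis m1_0 : forall i j p (x : V i j p) r, mop i j (pcons x (pnil i)) r = 0.
(** Since [m1_0] makes every morphism of [V] a cocycle, this hypothesis and the next say that $F_1$
    is bijective on cohomology. The variable [p] with [c = p + 1] avoids a subtraction inside a
    type. *)
Hypothesis F1_inj : forall i j p c (x : V i j c) (h : ghom (I i) (I j) p),
  c = p + 1 -> ghom_diff c h = F1 x c -> x = 0.
Hypothesis F1_surj : forall i j p c (h : ghom (I i) (I j) c), c = p + 1 ->
  ghom_diff (c + 1) h = 0 ->
  exists x : V i j c, exists h' : ghom (I i) (I j) p, h = F1 x c + ghom_diff c h'.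

(* The cone of [realize] is acyclic, as one sees by killing a cocycle entry by
   entry, in the order of the weight [rank b - rank a] of the entry [(a, b)]:
   only [m_1 = 0], [F_1] and the differentials of the [I i] preserve weights. *)
Lemma cone_exact (G1 G2 : flat_graph) N1 N2 (A1 : augmentation F G1 N1)
  (A2 : augmentation F G2 N2) p0 p c (y : arrows G1 G2 c)
  (h : ghom (res A1) (res A2) p) :
  p = p0 + 1 -> c = p + 1 ->
  (forall a b, arrow_diff y (c + 1) a b = 0) -> ghom_diff c h = realize y ->
  exists (y' : arrows G1 G2 p) (h' : ghom (res A1) (res A2) p0),
    (forall a b, y a b = arrow_diff y' c a b) /\ h = realize y' + ghom_diff p h'.
Proof.
move=> pE cE.
(* Adding the constant [R] keeps the weight in [nat]; the truncated subtraction is harmless by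
   [rankR]. *)
pose R := (\max_(x : G1) rank x)%N; pose wt (a : G1) (b : G2) := (rank b + (R - rank a))%N.
have rankR (a : G1) : (rank a <= R)%N by apply: leq_bigmax.
have wtP x y' a b : (rank y' + rank a < rank b + rank x)%N = (wt x y' < wt a b)%N.
  by have := rankR a; have := rankR x; rewrite /wt; lia.
have wt_max a b : (wt a b <= \max_(x : G2) rank x + R)%N.
  by rewrite leq_add ?leq_subr // leq_bigmax.
suff H w : (forall a b, (wt a b < w)%N -> y a b = 0 /\ entry h a b = 0) ->
    (forall a b, arrow_diff y (c + 1) a b = 0) -> ghom_diff c h = realize y ->
    exists (y' : arrows G1 G2 p) (h' : ghom (res A1) (res A2) p0),
    (forall a b, y a b = arrow_diff y' c a b) /\ h = realize y' + ghom_diff p h'.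
  by apply: (H 0%N).
have [K] := ubnP ((\max_(x : G2) rank x + R).+1 - w)%N.
elim: K w y h => // K IH w y h wK yh0 dy dh.
have [wmax|wmax] := ltnP (\max_(x : G2) rank x + R) w.
  exists (fun _ _ => 0), 0; split=> [a b|].
    rewrite (proj1 (yh0 a b _)) ?(leq_ltn_trans (wt_max a b)) //.
    by rewrite [RHS]sandwich0.
  apply: entry_eq => a b; rewrite linear0 addr0 realizeE sandwich0 //.
  by rewrite (proj2 (yh0 a b _)) ?(leq_ltn_trans (wt_max a b)).
(* In the lowest weight the equation reduces to $d(h_{ab})=F_1(y_{ab})$. Injectivity gives
   $y_{ab}=0$, so that $h_{ab}$ is a cocycle to which surjectivity applies. *)
have dh_lead a b : (wt a b <= w)%N -> ghom_diff c (entry h a b) = F1 (y a b) c.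
  move=> ab; rewrite -(entry_diff_leading cE) => [|x z]; last first.
    by rewrite wtP => xz; apply: (proj2 (yh0 _ _ _)); apply: leq_trans xz ab.
  rewrite dh realizeE sandwich_leading // => x z; rewrite wtP => xz.
  by apply: (proj1 (yh0 _ _ _)); apply: leq_trans xz ab.
have y_w a b : (wt a b <= w)%N -> y a b = 0 by move=> ab; apply: F1_inj cE (dh_lead a b ab).
have Hxz a b : exists xz : V (vobj a) (vobj b) p * ghom (I (vobj a)) (I (vobj b)) p0,
    if wt a b == w then entry h a b = F1 xz.1 p + ghom_diff p xz.2 else xz = (0, 0).
  case: eqP => [ab|_]; last by exists (0, 0).
  have [|x [z E]] := F1_surj (h := entry h a b) pE; last by exists (x, z).
  rewrite -cE dh_lead ?ab // y_w ?ab //.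
  exact: F1_0.
pose xz a b := projT1 (cid (Hxz a b)).
have xzP a b : if wt a b == w then entry h a b = F1 (xz a b).1 p + ghom_diff p (xz a b).2
    else xz a b = (0, 0) by rewrite /xz; case: cid.
pose y0 : arrows G1 G2 p := fun a b => (xz a b).1.
pose h0 : ghom (res A1) (res A2) p0 := assemble (fun a b => (xz a b).2).
have low a b : (wt a b < w)%N -> xz a b = (0, 0).
  by move=> ab; have := xzP a b; rewrite ltn_eqF.
(* Subtracting the boundary of [(y0, h0)] in the cone clears weight [w]; the induction continues
   with [w.+1]. *)
pose y1 : arrows G1 G2 c := fun a b => - 1 *: arrow_diff y0 c a b + y a b.
pose h1 : ghom (res A1) (res A2) p := h - realize y0 - ghom_diff p h0.
have [||||y' [h' [yE hE]]] := IH w.+1 y1 h1.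
- by rewrite subnS -ltnS (leq_trans _ wK) // ltnS prednK // subn_gt0.
- move=> a b; rewrite ltnS => ab.
  have low0 x z : (rank z + rank a < rank b + rank x)%N -> xz x z = (0, 0).
    by rewrite wtP => xzab; apply: low; apply: leq_trans xzab ab.
  split.
    rewrite /y1 (y_w _ _ ab) addr0 [arrow_diff _ _ _ _]sandwich_leading ?m1_0 ?scaler0 //.
    by move=> x z /low0; rewrite /y0 => ->.
  rewrite !entryB realizeE sandwich_leading // => [|x z /low0]; last by rewrite /y0 => ->.
  rewrite (entry_diff_leading pE) => [|x z /low0]; last by rewrite assembleK => ->.
  rewrite assembleK /y0; have := xzP a b; case: eqP => [_ ->|/eqP ab' E].
    by rewrite addrAC addrK subrr.
  rewrite E (proj2 (yh0 _ _ _)) ?ltn_neqAle ?ab' //.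
  by rewrite /= F1_0 [ghom_diff _ _]linear0 !subr0.
- move=> a b; rewrite [LHS](sandwich_linear m_lin).
  by rewrite [X in _ *: X + _](arrow_diff_diff _ _ _ _ cE) // scaler0 add0r; apply: dy.
- rewrite !ghom_diffB (ghom_diff_diff _ pE cE) subr0 dh realize_diff //.
  by rewrite realize_linear scaleN1r addrC.
exists (fun a b => 1 *: y0 a b + y' a b), (h0 + h'); split=> [a b|].
  rewrite [RHS](sandwich_linear m_lin) -[X in _ = _ + X]/(arrow_diff y' c a b) -yE /y1.
  by rewrite scale1r scaleN1r addrA subrr add0r.
rewrite realize_linear scale1r linearD addrACA [X in _ = _ + X]addrC addrA -addrA.
rewrite [ghom_diff _ _ + _ in RHS]addrC -hE /h1 /=.
by rewrite addrC -[h - _ - _]addrA -opprD subrK.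
Qed.

End Realization.

(** * Module maps induced by twisted cocycles *)

Section InducedMaps.
Variables (k : fieldType) (B : kAlgebra k) (n : nat) (M : 'I_n -> rmodType B).
Variable I : forall i, injective_resolution (M i).
Variable V : 'I_n -> 'I_n -> int -> lmodType k.
Variables (m : ainf_category V) (F : operations V (dg_hom I) id).
Notation mop := (m : operations V V id).
Hypothesis F_functor : is_ainf_functor mop (@dg_op _ _ _ _ I) F.
Notation flat_graph := (flat_graph mop).
Notation res := (total_res F_functor).

Let F_lin : multilinear F. Proof. by case: F_functor. Qed.
Let m_lin : multilinear mop. Proof. exact: ainf_multilinear. Qed.

Definition arrow_cocycle (G1 G2 : flat_graph) p (y : arrows G1 G2 p) :=
  forall a b, arrow_diff y (p + 1) a b = 0.

Definition arrow_comp (G1 G2 G3 : flat_graph) (z : arrows G2 G3 0)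
  (y : arrows G1 G2 0) : arrows G1 G3 0 :=
  fun a c => pair_sandwich (@flat_graph_shift _ _ _ _ G1) (@flat_graph_shift _ _ _ _ G2)
    y z mop a c 0.

Lemma arrow_comp_cocycle (G1 G2 G3 : flat_graph) (z : arrows G2 G3 0)
  (y : arrows G1 G2 0) :
  arrow_cocycle y -> arrow_cocycle z -> arrow_cocycle (arrow_comp z y).
Proof.
move=> dy dz a c; apply: pair_sandwich_cocycle => //.
- exact: ainf_graded.
- exact: flat_graph_flat.
- exact: flat_graph_flat.
- exact: flat_graph_flat.
- exact: flat_graph_shift.
- exact: ainf_relation.
Qed.

Lemma realize_comp (G1 G2 G3 : flat_graph) N1 N2 N3 (A1 : augmentation F G1 N1)
  (A2 : augmentation F G2 N2) (A3 : augmentation F G3 N3)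
  (z : arrows G2 G3 0) (y : arrows G1 G2 0) :
  arrow_cocycle y -> arrow_cocycle z ->
  exists h : ghom (res A1) (res A3) (-1), realize F (arrow_comp z y) =
    ghom_comp (realize F z : ghom (res A2) (res A3) 0)
      (realize F y : ghom (res A1) (res A2) 0) 0 + ghom_diff 0 h.
Proof.
move=> dy dz.
exists (assemble (fun a c => pair_sandwich (@flat_graph_shift _ _ _ _ G1)
  (@flat_graph_shift _ _ _ _ G2) y z F a c (-1))).
apply: entry_eq => a c; rewrite entryD entry_comp // entry_diff // realizeE.
rewrite (@functor_pair_sandwich _ _ _ _ _ _ mop) //; last 1 first.
- exact: flat_graph_shift.
- rewrite sgN1 scaleN1r assembleK.
  under [X in _ = X + _]eq_bigr do rewrite !realizeE.
  under [X in _ = _ + (_ - X + _)]eq_bigr do rewrite assembleK.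
  under [X in _ = _ + (_ - _ - X)]eq_bigr do rewrite assembleK.
  by rewrite [RHS]addrC -!addrA; congr (_ + _); rewrite [RHS]addrC -addrA.
- exact: ainf_graded.
- exact: flat_graph_flat.
- exact: flat_graph_flat.
- exact: flat_graph_flat.
Qed.

Notation F1 x := (F (pcons x (pnil _))).
Hypothesis m1_0 : forall i j p (x : V i j p) r, mop i j (pcons x (pnil i)) r = 0.
Hypothesis F1_inj : forall i j p c (x : V i j c) (h : ghom (I i) (I j) p),
  c = p + 1 -> ghom_diff c h = F1 x c -> x = 0.
Hypothesis F1_surj : forall i j p c (h : ghom (I i) (I j) c), c = p + 1 ->
  ghom_diff (c + 1) h = 0 ->
  exists x : V i j c, exists h' : ghom (I i) (I j) p, h = F1 x c + ghom_diff c h'.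

Lemma realize_surj (G1 G2 : flat_graph) N1 N2 (A1 : augmentation F G1 N1)
  (A2 : augmentation F G2 N2) p0 p (h : ghom (res A1) (res A2) p) :
  p = p0 + 1 -> ghom_diff (p + 1) h = 0 ->
  exists (y : arrows G1 G2 p) (h' : ghom (res A1) (res A2) p0),
    arrow_cocycle y /\ h = realize F y + ghom_diff p h'.
Proof.
move=> pE dh; have [||y [h' [yE hE]]] := cone_exact (F_functor := F_functor) m1_0 F1_inj F1_surj
  (y := fun _ _ => 0) (h := h) pE erefl.
- by move=> a b; apply: sandwich0.
- by rewrite dh; apply: entry_eq => a b; rewrite entry0 realizeE sandwich0.
by exists y, h'; split=> // a b; rewrite -yE.
Qed.

Section Two.
Variables (G1 G2 : flat_graph) (N1 N2 : rmodType B).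
Variables (A1 : augmentation F G1 N1) (A2 : augmentation F G2 N2).

Definition induces (y : arrows G1 G2 0) (g : N1 -> N2) :=
  forall x, val (realize F y) (0%N, 0%N) (aug_map A1 x) = aug_map A2 (g x).

Lemma induces_uniq y g g' : induces y g -> induces y g' -> g =1 g'.
Proof. by move=> yg yg' x; apply: (@aug_map_inj _ _ _ _ _ _ _ _ _ _ A2); rewrite -yg. Qed.

(** In position $(0,0)$ a boundary is $hd$, the term $dh$ having no source, and $d$ kills the
    augmentation. Hence homotopic chain maps induce the same map of kernels. *)
Lemma boundary_aug (h : ghom (res A1) (res A2) (-1)) x :
  val (ghom_diff 0 h) (0%N, 0%N) (aug_map A1 x) = 0.
Proof.
rewrite ghom_diffE // sub0r.
have -> : res_diff (res A1) 0 (aug_map A1 x) = 0.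
  by apply/(aug_map_exact A1); exists x.
by rewrite linear0 scaler0 oppr0.
Qed.

Lemma cocycle_induces y : arrow_cocycle y -> exists g : {linear N1 -> N2}, induces y g.
Proof.
move=> dy.
have H x : exists z, aug_map A2 z = val (realize F y) (0%N, 0%N) (aug_map A1 x).
  apply/(aug_map_exact A2).
  have : val (ghom_diff 1 (realize F y : ghom (res A1) (res A2) 0)) (0%N, 1%N)
      (aug_map A1 x) = 0.
    rewrite realize_diff //.
    have -> : realize F (arrow_diff y 1) = 0.
      by apply: entry_eq => a b; rewrite entry0 realizeE sandwich0.
    by [].
  rewrite ghom_diffE // sg0 rmorph1 scale1r => /eqP; rewrite subr_eq0 => /eqP.
  have -> : res_diff (res A1) 0 (aug_map A1 x) = 0.
    by apply/(aug_map_exact A1); exists x.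
  by rewrite linear0.
pose g x := projT1 (cid (H x)).
have gE x : aug_map A2 (g x) = val (realize F y) (0%N, 0%N) (aug_map A1 x).
  by rewrite /g; case: cid.
have g_lin : linear g.
  move=> c x x'; apply: (@aug_map_inj _ _ _ _ _ _ _ _ _ _ A2).
  by rewrite linearP !gE linearP linearP.
by have [g' g'E] := linear_pack g_lin; exists g' => x; rewrite g'E gE.
Qed.

(** Lift [g] to a chain map between the resolutions; it differs from some [realize F y] by a
    boundary, which is invisible on the augmentation. *)
Lemma induces_surj (g : {linear N1 -> N2}) :
  exists2 y : arrows G1 G2 0, arrow_cocycle y & induces y g.
Proof.
pose u : {linear N1 -> total I G2 0} := aug_map A2 \o g.
have [x|f [df fE]] := @cocycle_lift _ _ _ _ (res A1) (res A2) 0 u.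
  by apply/(aug_map_exact A2); exists (g x).
have [y [h [dy fyh]]] := realize_surj (p0 := -1) (p := 0) (h := f) erefl df.
exists y => // x; rewrite -[RHS]fE fyh ghomDE.
by rewrite [X in _ + X]boundary_aug addr0.
Qed.

(** The difference [z] induces zero, so its realization is nullhomotopic by some [h]. The pair
    [(z, h)] is then a cocycle of the cone, and acyclicity returns a twisted homotopy [w]. *)
Lemma induces_inj y y' g : arrow_cocycle y -> arrow_cocycle y' ->
  induces y g -> induces y' g ->
  exists w : arrows G1 G2 (-1), forall a b, y a b - y' a b = arrow_diff w 0 a b.
Proof.
move=> dy dy' yg y'g; pose z : arrows G1 G2 0 := fun a b => -1 *: y' a b + y a b.
have dz : arrow_cocycle z.
  by move=> a b; rewrite [LHS](sandwich_linear m_lin) [X in _ *: X + _]dy' scaler0 [LHS]add0r; apply: dy.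
have zE : realize F z = realize F y - realize F y'.
  by rewrite (realize_linear F_functor) scaleN1r addrC.
have [||h hE] := @nullhomotopy _ _ _ _ (res A1) (res A2) (realize F z).
- rewrite realize_diff //; apply: entry_eq => a b.
  by rewrite entry0 realizeE sandwich0.
- by move=> x; rewrite zE ghomDE ghomNE [X in X - _]yg [X in _ - X]y'g subrr.
have [||w [h' [wE _]]] := cone_exact (F_functor := F_functor) m1_0 F1_inj F1_surj
  (p0 := -2%:Z) (p := -1) (c := 0) (y := z) (h := h) erefl erefl.
- exact: dz.
- exact: hE.
by exists w => a b; rewrite -wE /z scaleN1r addrC.
Qed.

Lemma induces_boundary y y' g (w : arrows G1 G2 (-1)) :
  (forall a b, y a b - y' a b = arrow_diff w 0 a b) -> induces y g -> induces y' g.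
Proof.
move=> yw yg x; rewrite -yg.
have -> : realize F y = realize F y' + ghom_diff 0 (realize F w : ghom (res A1) (res A2) (-1)).
  rewrite realize_diff //.
  have -> : realize F y = realize F (fun a b => 1 *: y' a b + arrow_diff w 0 a b).
    by apply: eq_realize => a b; rewrite scale1r -yw addrC subrK.
  by rewrite (realize_linear F_functor) scale1r.
by rewrite ghomDE [X in _ + X]boundary_aug addr0.
Qed.

End Two.

Lemma induces_comp (G1 G2 G3 : flat_graph) N1 N2 N3 (A1 : augmentation F G1 N1)
  (A2 : augmentation F G2 N2) (A3 : augmentation F G3 N3)
  (z : arrows G2 G3 0) (y : arrows G1 G2 0) g h :
  arrow_cocycle y -> arrow_cocycle z -> induces A1 A2 y g -> induces A2 A3 z h ->
  induces A1 A3 (arrow_comp z y) (h \o g).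
Proof.
move=> dy dz yg zh x; have [u ->] := realize_comp A1 A2 A3 dy dz.
rewrite ghomDE [X in _ + X]boundary_aug addr0.
rewrite [LHS](@ghom_compE _ _ _ _ _ (res A1) (res A2) (res A3) 0 0 0 (realize F z)
  (realize F y) 0%N 0%N 0%N (aug_map A1 x) erefl erefl).
by rewrite -[RHS]zh; congr (val (realize F z) (0%N, 0%N) _); apply: yg.
Qed.

End InducedMaps.

(** * Filtered modules *)

Lemma subquot_pi0 (R : pzRingType) (V : lmodType R) (Z W : submodClosed V) :
  subquot_pi W (0 : submod Z) = 0.
Proof. by apply: (addrI (subquot_pi W (0 : submod Z))); rewrite -subquot_piD !addr0. Qed.

Lemma subquot_bij (R : pzRingType) (V : lmodType R) (Z W : submodClosed V)
  (E : lmodType R) (psi : {linear submod Z -> E}) :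
  (forall z, psi z = 0 <-> val z \in W) -> (forall e, exists z, psi z = e) ->
  exists phi : {linear subquot Z W -> E}, bijective phi.
Proof.
move=> psi0 psi_surj; pose f (x : subquot Z W) := psi (repr x).
have fE z : f (subquot_pi W z) = psi z.
  apply/eqP; rewrite -subr_eq0 -linearB; apply/eqP/psi0.
  by rewrite linearB; apply/subquot_pi_eq; rewrite subquot_reprK.
have f_lin : linear f.
  move=> c x y; rewrite -(subquot_reprK x) -(subquot_reprK y).
  rewrite -[c *: _]/(subquot_scale c _) -subquot_piZ -subquot_piD !fE.
  exact: linearP.
have [phi phiE] := linear_pack f_lin.
exists phi; pose g e := subquot_pi W (projT1 (cid (psi_surj e))).
exists g => [x|e]; rewrite phiE; last by rewrite fE; case: cid.
rewrite -[x in RHS]subquot_reprK; apply/subquot_pi_eq; rewrite -linearB; apply/psi0.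
by rewrite linearB; case: cid => z /= ->; rewrite /f subrr.
Qed.

Section Kernel.
Variables (k : fieldType) (B : kAlgebra k) (n : nat) (M : 'I_n -> rmodType B).
Variable I : forall i, injective_resolution (M i).
Variable V : 'I_n -> 'I_n -> int -> lmodType k.
Variables (m : operations V V id) (F : operations V (dg_hom I) id).
Hypothesis F_functor : is_ainf_functor m (@dg_op _ _ _ _ I) F.
Variable G : flat_graph m.

Definition kernel : rmodType B := submod (cocycle (@total_diff _ _ _ _ _ _ F G 0)).

Fact kernel_val_linear : linear (val : kernel -> total I G 0).
Proof. by move=> c x y; rewrite linearP. Qed.

Fact kernel_augmentation : exists A : augmentation F G kernel,
  forall x, aug_map A x = val x.
Proof.
have [i iE] := linear_pack kernel_val_linear.
have i_inj : injective i by move=> x y; rewrite !iE => /val_inj.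
have i_ex (y : total I G 0) : total_diff F y = 0 <-> exists x, i x = y.
  split=> [dy|[x <-]]; last by rewrite iE; apply/eqP; have := valP x.
  have yP : y \in cocycle (@total_diff _ _ _ _ _ _ F G 0) by rewrite inE; apply/eqP.
  by exists (exist _ y yP); rewrite iE.
by exists (Augmentation i_inj i_ex).
Qed.

Definition rank_filtration w : {pred kernel} :=
  [pred x : kernel | `[< forall a : G, (rank a < w)%N -> (val x : total I G 0) a = 0 >]].

Lemma rank_filtrationP w (x : kernel) :
  reflect (forall a : G, (rank a < w)%N -> (val x : total I G 0) a = 0)
    (x \in rank_filtration w).
Proof. exact: asboolP. Qed.

Fact rank_filtration_closed w : submod_closed (rank_filtration w).
Proof.
split=> [|c x y]; rewrite !inE; first by apply/asboolP.
move=> /asboolP x0 /asboolP y0; apply/asboolP => a aw.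
rewrite linearP -[LHS]/(c *: (val x : total I G 0) a + (val y : total I G 0) a).
by rewrite x0 // y0 // scaler0 addr0.
Qed.
HB.instance Definition _ w := GRing.isSubmodClosed.Build _ kernel (rank_filtration w)
  (rank_filtration_closed w).

(** On elements that vanish below rank [w], the entry at [a] is a cocycle of the resolution, hence
    comes from the module it resolves. As [a] is the only vertex of rank [w], this entry vanishes
    exactly on the next step of the filtration. *)
Lemma rank_filtration_quotient w (a : G) :
  rank a = w -> (forall b : G, rank b = w -> b = a) ->
  exists phi : {linear subquot (rank_filtration w) (rank_filtration w.+1) -> M (vobj a)},
    bijective phi.
Proof.
move=> aw wa.
pose v (x : submod (rank_filtration w)) : total I G 0 := val (val x).
have v_lin : linear v by move=> c x y; rewrite /v !linearP.
have vw x b : (rank b < w)%N -> v x b = 0.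
  exact: (elimT (rank_filtrationP w (val x)) (valP x) b).
have H x : exists z, res_aug (I (vobj a)) z = v x a.
  apply/res_aug_exact; have /eqP dx : total_diff F (v x) == 0 by have := valP (val x).
  have := congr1 (fun y : total I G 1 => y a) dx; rewrite /total_diff big1 ?subr0 //.
  move=> b _; have [ba|ba] := leqP (rank a) (rank b); first by rewrite chain_sum_rank.
  by rewrite vw -?aw // linear0.
pose f x := projT1 (cid (H x)).
have fE x : res_aug (I (vobj a)) (f x) = v x a by rewrite /f; case: cid.
have f_lin : linear f.
  move=> c x y; apply: (@res_aug_inj _ _ (I (vobj a))).
  by rewrite linearP !fE v_lin.
have [psi psiE] := linear_pack f_lin.
apply: (subquot_bij (psi := psi)) => [x|e].
  rewrite psiE; split=> [fx|].
    apply/rank_filtrationP => b; rewrite ltnS leq_eqVlt => /orP[/eqP /wa ->|bw]; last exact: vw.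
    by rewrite -[LHS]fE fx linear0.
  move=> /rank_filtrationP /(_ a); rewrite aw => /(_ (ltnSn _)) xa.
  by apply: (@res_aug_inj _ _ (I (vobj a))); rewrite fE linear0.
(* For surjectivity, [e] is placed at [a]. The differential of [x0] is supported in ranks above [w],
   and so is the correction [y], which leaves the entry at [a] intact. *)
pose x0 : total I G 0 := total_inj (res_aug (I (vobj a)) e).
have [||y dy yw] := @total_exact _ _ _ _ _ _ _ _ G F_functor (@flat_graph_flat _ _ _ _ G)
  (@flat_graph_shift _ _ _ _ G) 0 w.+1 (total_diff F x0).
- exact: (total_diff_diff F_functor (@flat_graph_flat _ _ _ _ G) (@flat_graph_shift _ _ _ _ G)).
- move=> b; rewrite ltnS -aw => ba; rewrite total_diff_inj chain_sum_rank // subr0.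
  have -> : res_diff (I (vobj a)) 0 (res_aug (I (vobj a)) e) = 0.
    by apply/res_aug_exact; exists e.
  by rewrite linear0.
have xK : x0 - y \in cocycle (@total_diff _ _ _ _ _ _ F G 0).
  by rewrite inE linearB /= -[X in X - _]dy subrr.
have xF : (exist _ (x0 - y) xK : kernel) \in rank_filtration w.
  apply/rank_filtrationP => b bw.
  rewrite -[LHS]/(x0 b - y b) yw ?ltnS 1?ltnW // /x0 total_inj_neq ?subrr //.
  by apply: contraTneq bw => <-; rewrite aw ltnn.
exists (exist _ (exist _ (x0 - y) xK : kernel) xF : submod (rank_filtration w)).
rewrite psiE; apply: (@res_aug_inj _ _ (I (vobj a))).
by rewrite fE /v /= -[LHS]/(x0 a - y a) yw ?aw // subr0 /x0 total_injE.
Qed.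

End Kernel.

Section TwistedModules.
Variables (k : fieldType) (B : kAlgebra k) (n : nat) (M : 'I_n -> rmodType B).
Variable I : forall i, injective_resolution (M i).
Variable V : 'I_n -> 'I_n -> int -> lmodType k.
Variables (m : ainf_category V) (F : operations V (dg_hom I) id).
Notation mop := (m : operations V V id).
Hypothesis F_functor : is_ainf_functor mop (@dg_op _ _ _ _ I) F.

Definition tw_flat_graph (X : tw_object m) : flat_graph mop :=
  @FlatGraph _ _ _ mop (tw_graph X) (@tw_graph_flat _ _ _ _ X) (@tw_shift _ _ _ _ X).

Definition tw_module (X : tw_object m) : rmodType B := kernel F (tw_flat_graph X).

Lemma tw_module_filtered (X : tw_object m) : filtered M (tw_module X).
Proof.
pose N := objseq_len X.
(* Ranks run from 1 to [N], so [N.+1 - j] gives zero at [j = 0] and everything at [j = N]; the step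
   from [q] to [q.+1] adds the vertex [q], of rank [N - q]. *)
exists N, (fun j =>
  rank_filtration (F := F) (G := tw_flat_graph X) (N.+1 - j)
    : submodClosed (kernel F (tw_flat_graph X))); split=> [x|x|q qN].
- rewrite subn0; apply/rank_filtrationP/eqP => [x0|->] //.
  apply/val_inj/functional_extensionality_dep => a.
  by apply: x0; rewrite /= /delta_rank ltnS leq_subr.
- apply/rank_filtrationP => a; rewrite subSn // subnn ltnS leqn0 /= /delta_rank.
  by rewrite subn_eq0 leqNgt ltn_ord.
split=> [x|].
  move=> /rank_filtrationP x0; apply/rank_filtrationP => a aq; apply: x0.
  by apply: leq_trans aq _; rewrite leq_sub2l.
exists (X (Ordinal qN)); rewrite subSS subSn ?(ltnW qN) //.
apply: (rank_filtration_quotient F_functor (a := (Ordinal qN : tw_flat_graph X))) => // b bq.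
by apply: val_inj; move: bq; rewrite /= /delta_rank /N; have := ltn_ord b; lia.
Qed.

End TwistedModules.

(** * Turning glued graphs back into twisted objects *)

Section SortedGraphs.
Variables (k : fieldType) (n : nat) (V : 'I_n -> 'I_n -> int -> lmodType k).
Variables (m : ainf_category V).
Notation mop := (m : operations V V id).
Variables (S : flat_graph mop) (N : nat) (c : 'I_N -> S) (c' : S -> 'I_N).
Hypotheses (cK : cancel c c') (c'K : cancel c' c).
Hypothesis c_sorted : forall a b, edge (c a) (c b) -> (b < a)%N.

Fact flat_edge_deg (s t : S) : edge s t -> vdeg s t = 1.
Proof. by move=> st; rewrite edge_deg // !flat_graph_shift. Qed.

Definition sorted_objseq : objseq 'I_n := ObjSeq (fun a => vobj (c a)).

(** The degree [vdeg] is known to be 1 only along edges; there the arrow is transported, elsewhere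
    it is replaced by 0. *)
Definition sorted_delta : mat V sorted_objseq sorted_objseq 1 := fun t =>
  match edge (c t.1) (c t.2) =P true with
  | ReflectT e => eq_rect _ (V _ _) (arrow (c t.1) (c t.2)) 1 (flat_edge_deg e)
  | ReflectF _ => 0 end.

Fact sorted_triangular (i j : 'I_N) : (j <= i)%N -> sorted_delta (j, i) = 0.
Proof.
rewrite /sorted_delta; case: eqP => //= ji.
by rewrite leqNgt (c_sorted ji).
Qed.

Let G := delta_graph sorted_delta.

(** [G] has an edge whenever [b < a], while [S] may have fewer; on the surplus edges [sorted_delta]
    is zero and [vanishing] discards the chain. *)
Lemma sum_sorted_chains (U : zmodType) (a b : G)
  (h : hpath V (vobj (c a)) (vobj (c b)) -> U) : vanishing h ->
  \sum_(P <- chains a b) h P = \sum_(P <- chains (c a) (c b)) h P.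
Proof.
elim/rank_ind: b h => b IH h h0; rewrite [LHS]sum_chains [RHS]sum_chains.
congr (_ + _).
  congr bigop; have [e|ab] := eqVneq a b; last first.
    by rewrite !trivial_chain_neq // (can_eq cK).
  by case: _ / e {IH h h0}; rewrite !trivial_chain_refl.
rewrite [RHS](reindex c) /=; last by exists c' => s _; [apply: cK|apply: c'K].
rewrite big_mkcond [RHS]big_mkcond; apply: eq_bigr => x _.
case: ifP => [xb|/negbT xb]; last first.
  by case: ifP => // /c_sorted bx; rewrite /= /delta_edge bx in xb.
transitivity (\sum_(P <- chains (c a) (c x)) h (pcons (sorted_delta (x, b)) P)).
  by apply: IH => //; apply: vanishing_pcons.
rewrite /sorted_delta; case: eqP => /= [e|/negP/negPf ->]; last first.
  by rewrite big1 // => P _; apply: (h0 _ _ _ (pnil _)).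
rewrite e; apply: eq_bigr => P _; congr h.
by case: _ / (flat_edge_deg e).
Qed.

Lemma sorted_chain_sum (O' : Type) (W : O' -> O' -> int -> lmodType k) (f : 'I_n -> O')
  (g : operations V W f) (a b : G) e : multilinear g ->
  chain_sum g a b e = chain_sum g (c a) (c b) e.
Proof.
move=> g_lin; rewrite /chain_sum big_mkcond [RHS]big_mkcond.
pose h (P : hpath V (vobj (c a)) (vobj (c b))) := if (0 < plen P)%N then bar g P e else 0.
apply: (@sum_sorted_chains _ a b h) => x y d L R.
by rewrite /h plen_pcat addnS /= bar0.
Qed.

Fact sorted_maurer_cartan :
  \sum_(1 <= t < (objseq_len sorted_objseq).+1)
      (-1) ^+ ((t * t.-1)./2)%N *: mat_op m (mat_pow sorted_delta t) 2 = 0.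
Proof.
apply: functional_extensionality_dep => -[i j].
rewrite (@maurer_cartan_chain_sum _ _ _ m sorted_objseq sorted_delta sorted_triangular i j).
rewrite sorted_chain_sum.
  exact: flat_graph_flat.
exact: ainf_multilinear.
Qed.

Definition sorted_tw : tw_object m :=
  @TwObject _ _ _ m sorted_objseq sorted_delta sorted_triangular sorted_maurer_cartan.

End SortedGraphs.

Section Representable.
Variables (k : fieldType) (B : kAlgebra k) (n : nat) (M : 'I_n -> rmodType B).
Variable I : forall i, injective_resolution (M i).
Variable V : 'I_n -> 'I_n -> int -> lmodType k.
Variables (m : ainf_category V) (F : operations V (dg_hom I) id).
Notation mop := (m : operations V V id).
Hypothesis F_functor : is_ainf_functor mop (@dg_op _ _ _ _ I) F.
Notation res := (total_res F_functor).
Notation flat_graph := (flat_graph mop).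

Let F_lin : multilinear F. Proof. by case: F_functor. Qed.

Definition representable (N : rmodType B) :=
  exists X : tw_object m, inhabited (augmentation F (tw_flat_graph X) N).

Section Sorted.
Variables (S : flat_graph) (N : nat) (c : 'I_N -> S) (c' : S -> 'I_N).
Hypotheses (cK : cancel c c') (c'K : cancel c' c).
Hypothesis c_sorted : forall a b, edge (c a) (c b) -> (b < a)%N.
Let X := sorted_tw cK c'K c_sorted.

Definition sorted_total q (z : total I S q) : total I (tw_flat_graph X) q :=
  fun a : 'I_N => z (c a).

Lemma sorted_total_diff q (z : total I S q) :
  total_diff F (sorted_total z) = sorted_total (total_diff F z).
Proof.
apply: functional_extensionality_dep => b; rewrite /total_diff /sorted_total.
congr (_ - _); rewrite [RHS](reindex c) /=; last by exists c' => s _; [apply: cK|apply: c'K].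
apply: eq_bigr => a _.
by rewrite -(sorted_chain_sum cK c'K c_sorted a b 1 F_lin).
Qed.

Lemma sorted_total_inj q : injective (@sorted_total q).
Proof.
move=> z z' zz; apply: functional_extensionality_dep => s.
rewrite -[s]c'K; exact: (congr1 (fun u : total I (tw_flat_graph X) q => u (c' s)) zz).
Qed.

Lemma sorted_total_surj q (y : total I (tw_flat_graph X) q) :
  exists z, sorted_total z = y.
Proof.
exists (fun s => @eq_rect S (c (c' s)) (fun s => I (vobj s) q) (y (c' s)) s (c'K s)).
apply: functional_extensionality_dep => a; rewrite /sorted_total.
move: (c'K (c a)) (cK a); move: (c' (c a)) => a' e aa; case: _ / aa in e *.
by rewrite (eq_axiomK e).
Qed.

Lemma sorted_representable P (A : augmentation F S P) : representable P.
Proof.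
have i_lin : linear (fun x => sorted_total (aug_map A x)).
  by move=> d x y; rewrite linearP.
have [i iE] := linear_pack i_lin.
have i_inj : injective i.
  by move=> x y; rewrite !iE => /sorted_total_inj; apply: aug_map_inj.
have i_ex (y : total I (tw_flat_graph X) 0) : total_diff F y = 0 <-> exists x, i x = y.
  have [z <-] := sorted_total_surj y; rewrite sorted_total_diff; split=> [|[x xz]].
    rewrite -[0]/(sorted_total 0) => /sorted_total_inj /(aug_map_exact A)[x xz].
    by exists x; rewrite iE xz.
  rewrite -[0]/(sorted_total 0); congr sorted_total; apply/(aug_map_exact A).
  by exists x; apply: sorted_total_inj; rewrite -iE.
by exists X; split; exact: (Augmentation i_inj i_ex).
Qed.

End Sorted.

Section SumFlat.
Variables (G1 G2 : flat_graph) (y : arrows G1 G2 1).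
Hypothesis dy : arrow_cocycle y.

Fact sum_flat_deg (a : G1) (b : G2) : 1 = 1 + 0 + shift b - shift a.
Proof. by rewrite !flat_graph_shift. Qed.

Fact sum_flat_flat : flat mop (sum_graph y sum_flat_deg).
Proof.
apply: flat_sum_graph; [exact: flat_graph_flat|exact: flat_graph_flat|move=> a b e].
have [->|e2] := eqVneq e 2; first exact: dy.
apply: (sandwich_graded _ sum_flat_deg (@ainf_graded _ _ _ m)).
by rewrite !flat_graph_shift.
Qed.

Fact sum_flat_shift (s : sum_graph y sum_flat_deg) : shift s = 0.
Proof. by case: s => s /=; rewrite flat_graph_shift. Qed.

(** Crossing arrows of degree 1 need no offset, so the glued graph is again unshifted, as a twisted
    object must be. *)
Definition sum_flat : flat_graph := FlatGraph sum_flat_flat sum_flat_shift.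

Lemma sum_total_diff_inl q (z : total I sum_flat q) (a : G1) :
  total_diff F z (inl a) = total_diff F (fun a => z (inl a) : I (vobj a) q) a.
Proof.
rewrite /total_diff big_sumType /= [X in _ - (_ + X)]big1 ?addr0 => [|x _]; last first.
  by rewrite chain_sum_rl.
by congr (_ - _); apply: eq_bigr => x _; rewrite chain_sum_ll.
Qed.

Lemma sum_total_diff_inr q (z : total I sum_flat q) (b : G2) :
  total_diff F z (inr b) = total_diff F (fun b => z (inr b) : I (vobj b) q) b -
    val (realize F y) (q, q.+1) (fun a => z (inl a) : I (vobj a) q) b.
Proof.
rewrite assembleE /total_diff big_sumType /= opprD addrA addrAC.
congr (_ - _ - _); apply: eq_bigr => x _; first by rewrite chain_sum_rr.
by rewrite chain_sum_lr.
Qed.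

End SumFlat.

Notation F1 x := (F (pcons x (pnil _))).
Hypothesis m1_0 : forall i j p (x : V i j p) r, mop i j (pcons x (pnil i)) r = 0.
Hypothesis F1_inj : forall i j p c (x : V i j c) (h : ghom (I i) (I j) p),
  c = p + 1 -> ghom_diff c h = F1 x c -> x = 0.
Hypothesis F1_surj : forall i j p c (h : ghom (I i) (I j) c), c = p + 1 ->
  ghom_diff (c + 1) h = 0 ->
  exists x : V i j c, exists h' : ghom (I i) (I j) p, h = F1 x c + ghom_diff c h'.

(* The class of the extension in [Ext^1(N1, N2)] is represented by a cocycle of
   twisted morphisms, which glues [G1] to [G2]. *)
Lemma augmentation_extension (G1 G2 : flat_graph) (N1 N2 N : rmodType B)
  (A1 : augmentation F G1 N1) (A2 : augmentation F G2 N2)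
  (j : {linear N2 -> N}) (pi : {linear N -> N1}) :
  injective j -> (forall x, exists y, pi y = x) ->
  (forall x, pi x = 0 <-> exists y, j y = x) ->
  exists (y : arrows G1 G2 1) (dy : arrow_cocycle y),
    inhabited (augmentation F (sum_flat dy) N).
Proof.
move=> j_inj pi_surj pi_exact.
(* [e] extends the augmentation of [N2] to [N]. Its coboundary kills [N2] and descends to [v] on
   [N1], the classifying cocycle of the extension. *)
have [e eE] := @res_injective _ _ (res A2) 0%N _ _ j (aug_map A2) j_inj.
pose u : {linear N -> res A2 1%N} := res_diff (res A2) 0 \o e.
have daug x : res_diff (res A2) 0 (aug_map A2 x) = 0.
  by apply/(aug_map_exact A2); exists x.
have daug1 x : res_diff (res A1) 0 (aug_map A1 x) = 0.
  by apply/(aug_map_exact A1); exists x.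
have [|v vE] := injective_factor (d := pi) (u := u) (@res_injective _ _ (res A2) 1%N).
  by move=> x /pi_exact[y <-]; rewrite /= eE daug.
have [x|f [df fE]] := @cocycle_lift _ _ _ _ (res A1) (res A2) 1 v.
  by have [y <-] := pi_surj x; rewrite vE; exact: (@res_diff_diff _ _ _ (res A2) 0%N (e y)).
have [y [h [dy fyh]]] := realize_surj m1_0 F1_inj F1_surj (p0 := 0) (p := 1) (h := f) erefl df.
exists y, dy; pose S := sum_flat dy.
pose h0 := val h (0%N, 0%N) : homB (total I G1 0) (total I G2 0).
(* By [fyh] the coboundary of [e x] is [realize F y] applied to [pi x] plus the coboundary of [h0]
   applied to [pi x]; subtracting [h0] makes [z x] a cocycle of the glued complex. *)
pose z x : total I S 0 := fun s => match s with
  | inl a => aug_map A1 (pi x) a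
  | inr b => (e x : total I G2 0) b - h0 (aug_map A1 (pi x)) b end.
have z_lin : linear z.
  move=> c x x'; apply: functional_extensionality_dep => -[a|b].
    by rewrite /z !linearP.
  rewrite -[RHS]/(c *: ((e x : total I G2 0) b - h0 (aug_map A1 (pi x)) b) +
    ((e x' : total I G2 0) b - h0 (aug_map A1 (pi x')) b)).
  rewrite /z (linearP e) (linearP pi) (linearP (aug_map A1)) (linearP h0).
  rewrite -[LHS]/((c *: (e x : total I G2 0) b + (e x' : total I G2 0) b) -
    (c *: h0 (aug_map A1 (pi x)) b + h0 (aug_map A1 (pi x')) b)).
  by rewrite scalerBr addrACA -opprD.
have [i iE] := linear_pack z_lin.
have dz x : total_diff F (z x) = 0.
  apply: functional_extensionality_dep => -[a|b].
    rewrite sum_total_diff_inl.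
    exact: (congr1 (fun t : total I G1 1 => t a) (daug1 (pi x))).
  rewrite sum_total_diff_inr.
  have E : total_diff F (e x : total I G2 0) = val f (0%N, 1%N) (aug_map A1 (pi x)).
    by rewrite [RHS]fE vE.
  have H : val (ghom_diff 1 h) (0%N, 1%N) (aug_map A1 (pi x)) =
      total_diff F (h0 (aug_map A1 (pi x))).
    by rewrite ghom_diffE // daug1 linear0 scaler0 subr0.
  rewrite -[X in total_diff F X]/(e x - h0 (aug_map A1 (pi x)) : total I G2 0) total_diffB.
  rewrite E fyh ghomDE H.
  by rewrite -[LHS]/((_ + _ - _ - _ : total I G2 1) b) addrK subrr.
have zj w : z (j w) = fun s => match s with inl a => 0 | inr b => aug_map A2 w b end.
  have pj : pi (j w) = 0 by apply/pi_exact; exists w.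
  apply: functional_extensionality_dep => -[a|b]; rewrite /z pj linear0 //.
  by rewrite linear0 eE subr0.
have i0 x : i x = 0 -> x = 0.
  rewrite iE => zx; have /pi_exact[w wx] : pi x = 0.
    apply: (@aug_map_inj _ _ _ _ _ _ _ _ _ _ A1); rewrite linear0.
    apply: functional_extensionality_dep => a.
    exact: (congr1 (fun t : total I S 0 => t (inl a)) zx).
  rewrite -wx; suff -> : w = 0 by rewrite linear0.
  apply: (@aug_map_inj _ _ _ _ _ _ _ _ _ _ A2); rewrite linear0.
  apply: functional_extensionality_dep => b.
  by have := congr1 (fun t : total I S 0 => t (inr b)) zx; rewrite -wx zj.
have i_inj : injective i.
  by move=> x x' xx'; apply/eqP; rewrite -subr_eq0; apply/eqP/i0; rewrite linearB xx' subrr.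
have i_ex (t : total I S 0) : total_diff F t = 0 <-> exists x, i x = t.
  split=> [dt|[x <-]]; last by rewrite iE dz.
  have : total_diff F (fun a => t (inl a) : I (vobj a) 0) = 0.
    apply: functional_extensionality_dep => a; rewrite -sum_total_diff_inl.
    exact: (congr1 (fun t : total I S 1 => t (inl a)) dt).
  move=> /(aug_map_exact A1)[x1]; have [x <-] := pi_surj x1 => xt.
  (* The left half of [t'] is zero, so its right half is a cocycle and comes from [N2]. *)
  pose t' := t - z x : total I S 0.
  have t'1 a : t' (inl a) = 0.
    rewrite -[LHS]/(t (inl a) - aug_map A1 (pi x) a) xt; exact: subrr.
  have dt' : total_diff F t' = 0 by rewrite total_diffB dt dz subrr.
  have : total_diff F (fun b => t' (inr b) : I (vobj b) 0) = 0.
    apply: functional_extensionality_dep => b.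
    have := congr1 (fun t : total I S 1 => t (inr b)) dt'; rewrite sum_total_diff_inr.
    have -> : (fun a => t' (inl a) : I (vobj a) 0) = 0 :> total I G1 0.
      exact: functional_extensionality_dep.
    rewrite linear0 => E; apply: etrans E; exact: (esym (subr0 _)).
  move=> /(aug_map_exact A2)[w wt]; exists (x + j w).
  rewrite linearD !iE zj; apply: functional_extensionality_dep => -[a|b].
    rewrite -[LHS]/(z x (inl a) + 0) addr0 /z xt //.
  rewrite -[LHS]/(z x (inr b) + aug_map A2 w b) wt.
  by rewrite -[X in _ + X]/(t (inr b) - z x (inr b)) addrC subrK.
by split; exact: (Augmentation i_inj i_ex).
Qed.

End Representable.

(** * Essential surjectivity *)

Section EssentialSurjectivity.
Variables (k : fieldType) (B : kAlgebra k) (n : nat) (M : 'I_n -> rmodType B).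
Variable I : forall i, injective_resolution (M i).
Variable V : 'I_n -> 'I_n -> int -> lmodType k.
Variables (m : ainf_category V) (F : operations V (dg_hom I) id).
Notation mop := (m : operations V V id).
Hypothesis F_functor : is_ainf_functor mop (@dg_op _ _ _ _ I) F.
Notation flat_graph := (flat_graph mop).
Notation representable := (representable m F).

Section Point.
Variable i : 'I_n.

Definition point_graph : graph V :=
  @Graph _ _ V unit (fun=> i) (fun _ _ => 0) (fun _ _ => 0) (fun _ _ => false)
    (fun=> 0%N) (fun=> 0) (fun _ _ => ltac:(by [])) (fun _ _ => ltac:(by [])).

Fact point_graph_flat : flat mop point_graph.
Proof. by move=> a b e; apply: chain_sum_rank. Qed.

Definition point_flat : flat_graph :=
  @FlatGraph _ _ _ mop point_graph point_graph_flat (fun=> erefl).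

Lemma point_augmentation : inhabited (augmentation F point_flat (M i)).
Proof.
have a_lin : linear (fun x => (fun=> res_aug (I i) x) : total I point_flat 0).
  by move=> c x y; apply: functional_extensionality_dep => -[]; apply: linearP.
have [a aE] := linear_pack a_lin.
have a_inj : injective a.
  move=> x y; rewrite !aE => xy; apply: (@res_aug_inj _ _ (I i)).
  exact: (congr1 (fun t : total I point_flat 0 => t tt) xy).
have dE (t : total I point_flat 0) : total_diff F t tt = res_diff (I i) 0 (t tt).
  by rewrite /total_diff big1 ?subr0 // => x _; rewrite chain_sum_rank.
have a_ex (t : total I point_flat 0) : total_diff F t = 0 <-> exists x, a x = t.
  split=> [dt|[x <-]]; last first.
    apply: functional_extensionality_dep => -[]; rewrite dE aE.
    by apply/res_aug_exact; exists x.
  have /res_aug_exact[x xt] : res_diff (I i) 0 (t tt) = 0 by rewrite -dE dt.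
  by exists x; rewrite aE; apply: functional_extensionality_dep => -[].
by split; exact: (Augmentation a_inj a_ex).
Qed.

End Point.

Lemma representable0 (N : rmodType B) : (forall x : N, x = 0) -> representable N.
Proof.
move=> N0; have o : 'I_0 -> 'I_n by case.
pose X0 : objseq 'I_n := ObjSeq o.
have t0 (j i : 'I_(objseq_len X0)) : (i <= j)%N -> (0 : mat V X0 X0 1) (i, j) = 0.
  by case: i.
have mc0 : \sum_(1 <= t < (objseq_len X0).+1) (-1) ^+ ((t * t.-1)./2)%N *:
    mat_op m (mat_pow (0 : mat V X0 X0 1) t) 2 = 0.
  by apply: functional_extensionality_dep => -[[]].
pose X := @TwObject _ _ _ m X0 0 t0 mc0.
have eq0 q (t t' : total I (tw_flat_graph X) q) : t = t'.
  by apply: functional_extensionality_dep => -[].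
exists X; split.
apply: (@Augmentation _ _ _ _ _ _ _ _ _ N (\0 : {linear N -> total I (tw_flat_graph X) 0})).
  by move=> x y _; rewrite (N0 x) (N0 y).
by move=> t; split=> _; [exists 0; apply: eq0|apply: eq0].
Qed.

Lemma representable_inj (N P : rmodType B) (f : {linear N -> P}) :
  bijective f -> representable P -> representable N.
Proof.
move=> [f' fK f'K] [X [A]]; exists X; split.
apply: (@Augmentation _ _ _ _ _ _ _ _ _ N (aug_map A \o f : {linear N -> total I (tw_flat_graph X) 0})).
  exact: inj_comp (@aug_map_inj _ _ _ _ _ _ _ _ _ _ A) (can_inj fK).
move=> t; rewrite (aug_map_exact A); split=> -[x <-]; last by exists (f x).
by exists (f' x); rewrite /= f'K.
Qed.

Notation F1 x := (F (pcons x (pnil _))).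
Hypothesis m1_0 : forall i j p (x : V i j p) r, mop i j (pcons x (pnil i)) r = 0.
Hypothesis F1_inj : forall i j p c (x : V i j c) (h : ghom (I i) (I j) p),
  c = p + 1 -> ghom_diff c h = F1 x c -> x = 0.
Hypothesis F1_surj : forall i j p c (h : ghom (I i) (I j) c), c = p + 1 ->
  ghom_diff (c + 1) h = 0 ->
  exists x : V i j c, exists h' : ghom (I i) (I j) p, h = F1 x c + ghom_diff c h'.

Lemma representable_extension (i : 'I_n) (N2 N : rmodType B)
  (j : {linear N2 -> N}) (pi : {linear N -> M i}) :
  injective j -> (forall x, exists y, pi y = x) ->
  (forall x, pi x = 0 <-> exists y, j y = x) ->
  representable N2 -> representable N.
Proof.
move=> j_inj pi_surj pi_exact [X [A2]]; have [A1] := point_augmentation i.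
have [y [dy [A]]] := augmentation_extension F_functor m1_0 F1_inj F1_surj A1 A2
  j_inj pi_surj pi_exact.
pose S := sum_flat dy; pose l := objseq_len X.
(* The new vertex gets the last index: its arrows lead into [X], and edges must lead to smaller
   indices. *)
pose c (a : 'I_(l + 1)) : S := match split a with inl b => inr b | inr _ => inl tt end.
pose c' (s : S) : 'I_(l + 1) := match s with inl _ => rshift l ord0 | inr b => lshift 1 b end.
have cK : cancel c c'.
  move=> a; rewrite -[RHS](splitK a) /c; case: (split a) => b //=.
  by rewrite (ord1 b).
have c'K : cancel c' c.
  case=> [[]|b]; rewrite /c /c'.
    by rewrite -[rshift _ _]/(unsplit (inr _)) unsplitK.
  by rewrite -[lshift _ _]/(unsplit (inl _)) unsplitK.
apply: (sorted_representable F_functor cK c'K _ A) => a b.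
rewrite /c; case: splitP => a' aE; case: splitP => b' bE //=.
- by rewrite aE bE.
- by move=> _; rewrite aE bE ltn_addr.
Qed.

Lemma filtered_representable (N : rmodType B) : filtered M N -> representable N.
Proof.
move=> [l [U [U0 Ul UM]]].
have H q : (q <= l)%N -> representable (submod (U q)).
  elim: q => [_|q IH ql].
    by apply: representable0 => x; apply: val_inj; apply/eqP; rewrite -U0; apply: valP.
  have [U_sub [i [phi [phi' phiK phi'K]]]] := UM q ql.
  have j_lin : linear (fun x : submod (U q) => exist _ (val x) (U_sub _ (valP x)) : submod (U q.+1)).
    by move=> c x y; apply: val_inj; rewrite [RHS]linearP; apply: (linearP (val : submod (U q) -> N)).
  have [j jE] := linear_pack j_lin.
  have pi0 : subquot_pi (U q) (0 : submod (U q.+1)) = 0 := subquot_pi0 _ _.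
  have pi_lin : linear (fun x : submod (U q.+1) => phi (subquot_pi (U q) x)).
    move=> c x y; rewrite subquot_piD subquot_piZ; exact: (linearP phi).
  have [pi piE] := linear_pack pi_lin.
  apply: (representable_extension (i := i) (j := j) (pi := pi)); last exact: IH (ltnW ql).
  - by move=> x y; rewrite !jE => /(congr1 val) /= xy; apply: val_inj.
  - by move=> e; exists (repr (phi' e)); rewrite piE subquot_reprK phi'K.
  move=> x; rewrite piE; split=> [phi0|[y <-]].
    have : subquot_pi (U q) x = subquot_pi (U q) 0.
      by apply: (can_inj phiK); rewrite phi0 pi0 linear0.
    move/subquot_pi_eq; rewrite -[val (0 : submod (U q.+1))]/(0 : N) subr0 => xU.
    by exists (exist _ (val x) xU); rewrite jE; apply: val_inj.
  have -> : subquot_pi (U q) (j y) = 0; last exact: linear0.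
  rewrite -pi0; apply/subquot_pi_eq.
  by rewrite -[val (0 : submod (U q.+1))]/(0 : N) subr0 jE; apply: (valP y).
have f_lin : linear (fun x : N => exist _ x (Ul x) : submod (U l)).
  by move=> c x y; apply: val_inj; rewrite [RHS]linearP.
have [f fE] := linear_pack f_lin.
apply: (representable_inj (f := f)); last exact: H (leqnn l).
exists val => x; first by rewrite fE.
by apply: val_inj; rewrite fE.
Qed.

End EssentialSurjectivity.

(** * The equivalence *)

(** Choice picks an object [ob Y] with an isomorphism [u], [v] for each [Y]; the quasi-inverse sends
    [f] to the unique preimage of $v f u$. *)
Lemma fully_faithful_equivalent (C D : category) (Phi : functor C D) :
  (forall X Y : C, bijective (@fun_hom C D Phi X Y)) ->
  (forall Y : D, exists (X : C) (u : cat_hom (Phi X) Y) (v : cat_hom Y (Phi X)),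
     cat_comp D u v = cat_id D Y /\ cat_comp D v u = cat_id D (Phi X)) ->
  equivalent C D.
Proof.
move=> ff es.
have psi_ex (X Y : C) : exists psi : cat_hom (Phi X) (Phi Y) -> cat_hom X Y,
    cancel (@fun_hom C D Phi X Y) psi /\ cancel psi (@fun_hom C D Phi X Y).
  by case: (ff X Y) => psi K K'; exists psi.
pose psi X Y := projT1 (cid (psi_ex X Y)).
have psiK X Y (g : cat_hom (Phi X) (Phi Y)) : fun_hom Phi (psi X Y g) = g.
  by rewrite /psi; case: cid => ? [].
have Phi_inj X Y : injective (@fun_hom C D Phi X Y) by apply: bij_inj; apply: ff.
pose ob Y := projT1 (cid (es Y)).
have uv_ex Y : exists uv : cat_hom (Phi (ob Y)) Y * cat_hom Y (Phi (ob Y)),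
    cat_comp D uv.1 uv.2 = cat_id D Y /\ cat_comp D uv.2 uv.1 = cat_id D (Phi (ob Y)).
  by rewrite /ob; case: cid => X [u [v uv]]; exists (u, v).
pose u Y := (projT1 (cid (uv_ex Y))).1; pose v Y := (projT1 (cid (uv_ex Y))).2.
have uvK Y : cat_comp D (u Y) (v Y) = cat_id D Y by rewrite /u /v; case: cid => ? [].
have vuK Y : cat_comp D (v Y) (u Y) = cat_id D _ by rewrite /u /v; case: cid => ? [].
pose G_hom (Y Z : D) (f : cat_hom Y Z) : cat_hom (ob Y) (ob Z) :=
  psi _ _ (cat_comp D (v Z) (cat_comp D f (u Y))).
have G_id Y : G_hom Y Y (cat_id D Y) = cat_id C (ob Y).
  by apply: Phi_inj; rewrite psiK cat_comp1m vuK fun_id.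
have uG (Y Z : D) (f : cat_hom Y Z) :
    cat_comp D (u Z) (fun_hom Phi (G_hom _ _ f)) = cat_comp D f (u Y).
  by rewrite psiK cat_compA uvK cat_comp1m.
have G_comp (X Y Z : D) (g : cat_hom Y Z) (f : cat_hom X Y) :
    G_hom _ _ (cat_comp D g f) = cat_comp C (G_hom _ _ g) (G_hom _ _ f).
  apply: Phi_inj; rewrite fun_comp [in RHS]psiK -!cat_compA uG.
  by rewrite psiK !cat_compA.
pose G := Functor G_id G_comp.
exists Phi, G; split; last by exists u, v; split=> // X Y f; apply: uG.
exists (fun X => psi _ _ (u (Phi X))), (fun X => psi _ _ (v (Phi X))); split=> [X Y f|X|X].
- apply: Phi_inj; rewrite [LHS]fun_comp [RHS]fun_comp.
  rewrite (psiK _ _ (u (Phi Y))) (psiK _ _ (u (Phi X))); exact: (uG _ _ (fun_hom Phi f)).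
- by apply: Phi_inj; rewrite fun_comp !psiK vuK fun_id.
- by apply: Phi_inj; rewrite fun_comp !psiK uvK fun_id.
Qed.

Section FiltEquivalence.
Variables (k : fieldType) (B : kAlgebra k) (n : nat) (M : 'I_n -> rmodType B).
Variable I : forall i, injective_resolution (M i).
Variable V : 'I_n -> 'I_n -> int -> lmodType k.
Variables (m : ainf_category V) (F : operations V (dg_hom I) id).
Notation mop := (m : operations V V id).
Hypothesis F_functor : is_ainf_functor mop (@dg_op _ _ _ _ I) F.
Notation F1 x := (F (pcons x (pnil _))).
Hypothesis m1_0 : forall i j p (x : V i j p) r, mop i j (pcons x (pnil i)) r = 0.
Hypothesis F1_inj : forall i j p c (x : V i j c) (h : ghom (I i) (I j) p),
  c = p + 1 -> ghom_diff c h = F1 x c -> x = 0.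
Hypothesis F1_surj : forall i j p c (h : ghom (I i) (I j) c), c = p + 1 ->
  ghom_diff (c + 1) h = 0 ->
  exists x : V i j c, exists h' : ghom (I i) (I j) p, h = F1 x c + ghom_diff c h'.

Implicit Types X Y Z : tw_object m.
Notation N X := (tw_module F X).
Notation twcocycle X Y := (submod (cocycle (@tw_diff _ _ _ m X Y 0 1))).

Definition tw_aug X : augmentation F (tw_flat_graph X) (N X) :=
  projT1 (cid (kernel_augmentation F (tw_flat_graph X))).

Definition tw_arrows X Y p (y : tw_hom X Y p) :
  arrows (tw_flat_graph X) (tw_flat_graph Y) p := fun a b => y (a, b).

Definition arrows_tw X Y p (y : arrows (tw_flat_graph X) (tw_flat_graph Y) p) :
  tw_hom X Y p := fun t => y t.1 t.2.

Lemma tw_diffP X Y p r (y : tw_hom X Y p) i j :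
  tw_diff r y (i, j) = arrow_diff (tw_arrows y) r i j.
Proof. exact: tw_diff_sandwich. Qed.

Lemma tw_cocycleP X Y (z : twcocycle X Y) : arrow_cocycle (tw_arrows (val z)).
Proof.
move=> a b; have /eqP dz : tw_diff 1 (val z) == 0 by have := valP z.
by rewrite -[LHS]tw_diffP dz.
Qed.

Lemma arrows_twP X Y (y : arrows (tw_flat_graph X) (tw_flat_graph Y) 0) :
  arrow_cocycle y -> exists z : twcocycle X Y, tw_arrows (val z) = y.
Proof.
move=> dy; have yP : arrows_tw y \in cocycle (@tw_diff _ _ _ m X Y 0 1).
  rewrite inE; apply/eqP/functional_extensionality_dep => -[i j].
  by apply: etrans (tw_diffP 1 (arrows_tw y) i j) (dy i j).
by exists (exist _ (arrows_tw y) yP).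
Qed.

Definition represents X Y (x : filt_hom X Y) (g : N X -> N Y) :=
  exists2 z : twcocycle X Y, filt_class z = x &
    induces (tw_aug X) (tw_aug Y) (tw_arrows (val z)) g.

(** Two representatives differ by a twisted boundary, which does not change the map on kernels. *)
Lemma represents_class X Y (z : twcocycle X Y) (g : N X -> N Y) :
  represents (filt_class z) g ->
  induces (tw_aug X) (tw_aug Y) (tw_arrows (val z)) g.
Proof.
move=> [z' zz' z'g]; have /subquot_pi_eq : subquot_pi _ z' = subquot_pi _ z := zz'.
rewrite inE => /asboolP[w wE]; apply: (@induces_boundary _ _ _ _ _ _ _ _ F_functor
  _ _ _ _ (tw_aug X) (tw_aug Y) _ _ g (tw_arrows w) _ z'g) => a b.
by rewrite -[RHS]tw_diffP; rewrite [X in X (a, b)]wE.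
Qed.

Lemma filt_classP X Y (x : filt_hom X Y) : exists z : twcocycle X Y, filt_class z = x.
Proof. by exists (repr x); apply: subquot_reprK. Qed.

Lemma hom_ex X Y (x : filt_hom X Y) : exists g : {linear N X -> N Y}, represents x g.
Proof.
have [z <-] := filt_classP x.
have [g zg] := cocycle_induces F_functor (tw_aug X) (tw_aug Y) (tw_cocycleP z).
by exists g, z.
Qed.

Definition filt_map X Y (x : filt_hom X Y) : {linear N X -> N Y} := projT1 (cid (hom_ex x)).

Lemma filt_mapP X Y (x : filt_hom X Y) : represents x (filt_map x).
Proof. by rewrite /filt_map; case: cid. Qed.

Lemma filt_map_class X Y (z : twcocycle X Y) (g : {linear N X -> N Y}) :
  induces (tw_aug X) (tw_aug Y) (tw_arrows (val z)) g ->
  filt_map (filt_class z) = g.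
Proof.
move=> zg; apply: linear_eq.
exact: induces_uniq (represents_class (filt_mapP (filt_class z))) zg.
Qed.

Lemma filt_map_inj X Y : injective (@filt_map X Y).
Proof.
move=> x x' xx; have := filt_mapP x'; rewrite -xx => -[z' <- z'g].
have [z zx zg] := filt_mapP x; rewrite -zx.
have [w wE] := induces_inj F_functor m1_0 F1_inj F1_surj (tw_cocycleP z) (tw_cocycleP z') zg z'g.
apply/subquot_pi_eq; rewrite inE; apply/asboolP; exists (arrows_tw w).
apply: functional_extensionality_dep => -[i j].
by apply: etrans (tw_diffP 0 (arrows_tw w) i j) _; apply: esym (wE i j).
Qed.

Lemma filt_map_surj X Y (g : {linear N X -> N Y}) : exists x, filt_map x = g.
Proof.
have [y dy yg] := induces_surj F_functor m1_0 F1_inj F1_surj (tw_aug X) (tw_aug Y) g.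
have [z zy] := arrows_twP dy; exists (filt_class z).
by apply: filt_map_class; rewrite zy.
Qed.

Definition filt_unmap X Y (g : {linear N X -> N Y}) : filt_hom X Y :=
  projT1 (cid (filt_map_surj g)).

Lemma filt_unmapK X Y : cancel (@filt_unmap X Y) (@filt_map X Y).
Proof. by move=> g; rewrite /filt_unmap; case: cid. Qed.

Lemma filt_mapK X Y : cancel (@filt_map X Y) (@filt_unmap X Y).
Proof. by move=> x; apply: filt_map_inj; rewrite filt_unmapK. Qed.

Definition filt_id X : filt_hom X X := filt_unmap (idfun : {linear N X -> N X}).
Definition filt_comp X Y Z (y : filt_hom Y Z) (x : filt_hom X Y) : filt_hom X Z :=
  filt_unmap (filt_map y \o filt_map x : {linear N X -> N Z}).

Fact filt_comp1m X Y (x : filt_hom X Y) : filt_comp (filt_id Y) x = x.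
Proof.
by apply: filt_map_inj; rewrite !filt_unmapK; apply: linear_eq => u.
Qed.

Fact filt_compm1 X Y (x : filt_hom X Y) : filt_comp x (filt_id X) = x.
Proof.
by apply: filt_map_inj; rewrite !filt_unmapK; apply: linear_eq => u.
Qed.

Fact filt_compA X Y Z T (z : filt_hom Z T) (y : filt_hom Y Z) (x : filt_hom X Y) :
  filt_comp z (filt_comp y x) = filt_comp (filt_comp z y) x.
Proof.
by apply: filt_map_inj; rewrite !filt_unmapK; apply: linear_eq => u.
Qed.

Definition filt_category_on : category_on (@filt_hom _ _ _ m) :=
  CategoryOn filt_comp1m filt_compm1 filt_compA.

(** Both sides have the same image under the injective [filt_map], because the twisted composite
    induces the composite map by [induces_comp]. *)
Lemma filt_category_m2 : composition_induced_by_m2 filt_category_on.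
Proof.
move=> X Y Z z y.
pose yz := arrow_comp (tw_arrows (val z)) (tw_arrows (val y)).
have dyz : arrow_cocycle yz by apply: arrow_comp_cocycle; apply: tw_cocycleP.
have [w wE] := arrows_twP dyz; exists w; split.
  apply: functional_extensionality_dep => -[i j].
  apply: etrans (congr1 (fun u : arrows (tw_flat_graph X) (tw_flat_graph Z) 0 => u i j) wE) _.
  by apply: esym; apply: tw_op_pair_sandwich.
apply: filt_map_inj; rewrite [LHS]filt_unmapK; apply/esym/filt_map_class; rewrite wE.
apply: (induces_comp F_functor); try exact: tw_cocycleP.
  exact: represents_class (filt_mapP _).
exact: represents_class (filt_mapP _).
Qed.

Definition filt_functor_ob (X : Category filt_category_on) : filt_modules M :=
  exist _ (N X) (tw_module_filtered F_functor X).

Fact filt_functor_id X :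
  filt_map (cat_id filt_category_on X) = cat_id (filt_modules M) (filt_functor_ob X).
Proof. exact: filt_unmapK. Qed.

Fact filt_functor_comp X Y Z (y : filt_hom Y Z) (x : filt_hom X Y) :
  filt_map (cat_comp filt_category_on y x) =
  @cat_comp _ _ (filt_modules M) (filt_functor_ob X) (filt_functor_ob Y)
    (filt_functor_ob Z) (filt_map y) (filt_map x).
Proof. exact: filt_unmapK. Qed.

Definition filt_functor : functor (Category filt_category_on) (filt_modules M) :=
  @Functor (Category filt_category_on) (filt_modules M) filt_functor_ob (@filt_map)
    filt_functor_id filt_functor_comp.

Lemma augmentation_iso (G : flat_graph mop) (P Q : rmodType B)
  (AP : augmentation F G P) (AQ : augmentation F G Q) :
  exists u : {linear P -> Q}, forall x, aug_map AQ (u x) = aug_map AP x.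
Proof.
have H x : exists y, aug_map AQ y = aug_map AP x.
  by apply/(aug_map_exact AQ)/(aug_map_exact AP); exists x.
pose f x := projT1 (cid (H x)).
have fE x : aug_map AQ (f x) = aug_map AP x by rewrite /f; case: cid.
have f_lin : linear f.
  move=> c x y; apply: (@aug_map_inj _ _ _ _ _ _ _ _ _ _ AQ).
  by rewrite linearP !fE linearP.
by have [u uE] := linear_pack f_lin; exists u => x; rewrite uE.
Qed.

Lemma filt_equivalence : equivalent (Category filt_category_on) (filt_modules M).
Proof.
apply: (fully_faithful_equivalent (Phi := filt_functor)) => [X Y|[P P_filt]].
  by exists (@filt_unmap X Y); [apply: filt_mapK|apply: filt_unmapK].
have [X [A]] := filtered_representable F_functor m1_0 F1_inj F1_surj P_filt.
have [u uE] := augmentation_iso (tw_aug X) A.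
have [v vE] := augmentation_iso A (tw_aug X).
exists X, u, v; split; apply: linear_eq => x /=.
  by apply: (@aug_map_inj _ _ _ _ _ _ _ _ _ _ A); rewrite uE vE.
by apply: (@aug_map_inj _ _ _ _ _ _ _ _ _ _ (tw_aug X)); rewrite vE uE.
Qed.

End FiltEquivalence.

Theorem mainTheorem2 (k : fieldType) (B : kAlgebra k) (n : nat)
  (M : 'I_n -> rmodType B) (I : forall i, injective_resolution (M i))
  (A : ainf_category (ext_hom I))
  (A_canonical : canonical_structure A)
  (A_unital : strictly_unital A) :
  exists C : category_on (@filt_hom k 'I_n (ext_hom I) A),
    composition_induced_by_m2 C /\
    equivalent (Category C) (filt_modules M).
Proof.
have [m1_0 _ [F [F_functor F1P]]] := A_canonical.
have F1_inj i j p c (x : ext_hom I i j c) (h : ghom (I i) (I j) p) :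
    c = p + 1 -> ghom_diff c h = F i j (pcons x (pnil i)) c -> x = 0.
  (* [ext] takes its coboundaries from degree [c - 1], so [p] has to become that very term. *)
  move=> cE; have pE : p = c - 1 by rewrite cE addrK.
  subst p => dh; have [z [zE <-]] := F1P i j c x.
  rewrite /ext_class /cohomology_class -subquot_pi0; apply/subquot_pi_eq.
  by rewrite subr0 inE; apply/asboolP; exists h; apply: etrans dh (esym zE).
have F1_surj i j p c (h : ghom (I i) (I j) c) : c = p + 1 -> ghom_diff (c + 1) h = 0 ->
    exists (x : ext_hom I i j c) (h' : ghom (I i) (I j) p),
      h = F i j (pcons x (pnil i)) c + ghom_diff c h'.
  move=> cE dh; have pE : p = c - 1 by rewrite cE addrK.
  subst p; have /eqP hP := dh.
  exists (ext_class (exist _ h hP)).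
  (* $F_1$ of the class of [h] is a cocycle in the same class, hence differs from [h] by a
     boundary. *)
  have [z [zE zh]] := F1P i j c (ext_class (exist _ h hP)).
  have /subquot_pi_eq := esym zh; rewrite inE => /asboolP[u uE].
  by exists u; rewrite -zE uE /= addrC subrK.
exists (filt_category_on F_functor m1_0 F1_inj F1_surj); split.
  exact: filt_category_m2.
exact: filt_equivalence.
Qed.
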